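(* Suppose $\mathbb{X}$ is a Banach space with a basis of type $P$ and let $(\mathbb{S},\Vert\cdot\Vert_{\mathbb{S}})$ be a subsymmetric sequence space. Assume that $\mathbb{S}$ is isomorphic to a complemented subspace of $\mathbb{X}$ and that $\mathbb{S}$ has nontrivial type. Then $\mathbb{X}$ has an almost greedy basis $\mathcal{B}_\kappa$ whose fundamental function is equivalent to $\left(\left\Vert\sum_{j=1}^m e_j\right\Vert_{\mathbb{S}}\right)_{m=1}^\infty$ and such that $L_m[\mathcal{B}_\kappa,\mathbb{X}]\approx\log m$ for $m\ge2$.
   Context: Banach spaces are real or complex, over the field $\mathbb{F}$. A basis $\mathcal{B}=(x_j)_{j=1}^\infty$ of a Banach space $\mathbb{X}$ is a Schauder basis, always assumed semi-normalized, i.e. $0<\inf_j\Vert x_j\Vert\le\sup_j\Vert x_j\Vert<\infty$; $(x_j^* )_{j=1}^\infty$ are its coordinate functionals. A basis $(x_j)_{j=1}^\infty$ is of type $P$ if $\sup_k\Vert\sum_{j=1}^kx_j\Vert<\infty$ and $\inf_j\Vert x_j\Vert>0$. For $A\subseteq\mathbb{N}$, $S_A(f)=\sum_{j\in A}x_j^*(f)x_j$ (when well defined), and $\operatorname{supp}(f)=\{j: x_j^*(f)\ne0\}$. Define $$L_m[\mathcal{B},\mathbb{X}]=\sup\left\{\frac{\Vert S_A(f)\Vert}{\Vert f\Vert}: f\in\mathbb{X}\setminus\{0\},\ \max(\operatorname{supp}(f))\le m,\ A\subseteq\mathbb{N}\right\}.$$ The basis is almost greedy if there is a constant $C$ with $\Vert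 f-S_F(f)\Vert\le C\Vert f-S_A(f)\Vert$ whenever $f\in\mathbb{X}$, $|A|\le|F|<\infty$, and $|x_j^*(f)|\le|x_k^*(f)|$ for all $j\in\mathbb{N}\setminus F$, $k\in F$. Its fundamental function is $\varphi_m[\mathcal{B},\mathbb{X}]=\sup_{|A|\le m}\Vert\sum_{j\in A}x_j\Vert$, $m\in\mathbb{N}$. A subsymmetric sequence space is a Banach space $\mathbb{S}\subseteq\mathbb{F}^{\mathbb{N}}$ for which the unit-vector system $(e_j)_{j=1}^\infty$ is a basis satisfying $\Vert\sum_j\varepsilon_ja_je_{\phi(j)}\Vert_{\mathbb{S}}=\Vert\sum_ja_je_j\Vert_{\mathbb{S}}$ for all $\sum_ja_je_j\in\mathbb{S}$, all sequences of signs $(\varepsilon_j)$ and all increasing maps $\phi\colon\mathbb{N}\to\mathbb{N}$. For families of non-negative numbers, $\alpha_i\lesssim\beta_i$ means there is a constant $C$ with $\alpha_i\le C\beta_i$ for all $i$; $\alpha_i\approx\beta_i$ (equivalence) means $\alpha_i\lesssim\beta_i$ and $\beta_i\lesssim\alpha_i$. *)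

(* Defs.v *)
From HB Require Import structures.
From mathcomp Require Import all_boot all_order all_algebra.
From mathcomp Require Import complex.
From mathcomp Require Import all_classical all_reals all_analysis.

Set Implicit Arguments.
Unset Strict Implicit.
Unset Printing Implicit Defensive.

Import Order.TTheory GRing.Theory Num.Theory.
Import numFieldNormedType.Exports.

Local Open Scope classical_set_scope.
Local Open Scope ring_scope.

Variant scalar_field (R : realType) : numFieldType -> Type :=
  | RealScalars : scalar_field R R
  | ComplexScalars : scalar_field R (complex R).

Definition scalar_re (R : realType) (K : numFieldType)
    (hK : scalar_field R K) : K -> R :=
  match hK in scalar_field _ K' return K' -> R with
  | RealScalars => fun x => x
  | ComplexScalars => fun z => complex.Re z
  end.

(* MathComp-Analysis norms take their values in the scalar field. For complex
   scalars these values are real numbers seen in R[i], and [nrm] brings them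
   back to R, where suprema and logarithms can be taken. *)
Definition nrm (R : realType) (K : numFieldType) (hK : scalar_field R K)
    (V : normedModType K) (v : V) : R := scalar_re hK `|v|.

(* Sequences are indexed from 0, so that the first m vectors of a basis are
   those of index j < m. *)
Definition expansion (K : numFieldType) (X : normedModType K) (x : nat -> X)
    (f : X) (a : nat -> K) : Prop :=
  series (fun j => a j *: x j) @ \oo --> f.

Definition is_schauder_basis (K : numFieldType) (X : normedModType K)
    (x : nat -> X) : Prop :=
  forall f : X, exists! a : nat -> K, expansion x f a.

Definition semi_normalized (R : realType) (K : numFieldType)
    (hK : scalar_field R K) (X : normedModType K) (x : nat -> X) : Prop :=
  exists c C : R, 0 < c /\ forall j, c <= nrm hK (x j) <= C.

Definition is_basis (R : realType) (K : numFieldType)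
    (hK : scalar_field R K) (X : normedModType K) (x : nat -> X) : Prop :=
  is_schauder_basis x /\ semi_normalized hK x.

Definition type_P (R : realType) (K : numFieldType)
    (hK : scalar_field R K) (X : normedModType K) (x : nat -> X) : Prop :=
  (exists C : R, forall k, nrm hK (\sum_(j < k) x j) <= C) /\
  (exists2 c : R, 0 < c & forall j, c <= nrm hK (x j)).

(* [coord x f j] is x_j^*(f); the default value 0 is never used when x is a
   Schauder basis. *)
Definition coord (K : numFieldType) (X : normedModType K) (x : nat -> X)
    (f : X) : nat -> K :=
  xget (fun=> 0) [set a : nat -> K | expansion x f a].

(* The sum over A is the limit of the partial sums in the order of the indices;
   it is a finite sum if A is finite or f has finite support. *)
Definition coord_proj (K : numFieldType) (X : normedModType K) (x : nat -> X)
    (A : set nat) (f : X) : X :=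
  limn (series (fun j => if j \in A then coord x f j *: x j else 0)).

Definition bsupp (K : numFieldType) (X : normedModType K) (x : nat -> X)
    (f : X) : set nat := [set j | coord x f j != 0].

Definition L_const (R : realType) (K : numFieldType)
    (hK : scalar_field R K) (X : normedModType K) (x : nat -> X)
    (m : nat) : \bar R :=
  ereal_sup [set r : \bar R | exists (f : X) (A : set nat),
    [/\ f != 0, bsupp x f `<=` `I_m &
        r = (nrm hK (coord_proj x A f) / nrm hK f)%:E]].

Definition almost_greedy (R : realType) (K : numFieldType)
    (hK : scalar_field R K) (X : normedModType K) (x : nat -> X) : Prop :=
  exists C : R, forall (f : X) (A F : set nat),
    finite_set F -> (A #<= F)%card ->
    (forall j k, ~ F j -> F k -> `|coord x f j| <= `|coord x f k|) ->
    nrm hK (f - coord_proj x F f) <= C * nrm hK (f - coord_proj x A f).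

Definition fundamental_function (R : realType) (K : numFieldType)
    (hK : scalar_field R K) (X : normedModType K) (x : nat -> X)
    (m : nat) : \bar R :=
  ereal_sup [set r : \bar R | exists A : set nat,
    (A #<= `I_m)%card /\ r = (nrm hK (\sum_(j \in A) x j))%:E].

(* S is presented as a sequence space by its inclusion [coe] into K^nat. *)
Definition is_sequence_space (K : numFieldType) (S : normedModType K)
    (coe : S -> nat -> K) : Prop :=
  injective coe /\
  (forall (a : K) (f g : S) (j : nat),
     coe (a *: f + g) j = a * coe f j + coe g j).

Definition subsymmetric_sequence_space (R : realType) (K : numFieldType)
    (hK : scalar_field R K) (S : completeNormedModType K)
    (coe : S -> nat -> K) (e : nat -> S) : Prop :=
  [/\ is_sequence_space coe,
      forall j k, coe (e j) k = (j == k)%:R,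
      is_basis hK e,
      forall f : S, expansion e f (coe f) &
      forall (f : S) (s : nat -> bool) (phi : nat -> nat),
        {homo phi : i j / (i < j)%N} ->
        exists g : S,
          series (fun j => ((-1) ^+ s j * coe f j) *: e (phi j)) @ \oo --> g /\
          nrm hK g = nrm hK f].

Definition complemented (K : numFieldType) (X : normedModType K)
    (Y : set X) : Prop :=
  exists P : {linear X -> X},
    [/\ continuous P, forall x, P (P x) = P x & range P = Y].

Definition isomorphism_onto (R : realType) (K : numFieldType)
    (hK : scalar_field R K) (S X : normedModType K)
    (T : {linear S -> X}) (Y : set X) : Prop :=
  range T = Y /\
  exists c C : R, 0 < c /\
    forall s, c * nrm hK s <= nrm hK (T s) <= C * nrm hK s.

Definition isomorphic_to_complemented_subspace (R : realType)
    (K : numFieldType) (hK : scalar_field R K) (S X : normedModType K) : Prop :=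
  exists Y : set X, complemented Y /\
    exists T : {linear S -> X}, isomorphism_onto hK T Y.

Definition has_rademacher_type (R : realType) (K : numFieldType)
    (hK : scalar_field R K) (V : normedModType K) (p : R) : Prop :=
  exists C : R, forall (n : nat) (v : 'I_n -> V),
    ((2 ^+ n)^-1 * \sum_(s : {ffun 'I_n -> bool})
        nrm hK (\sum_(i < n) (-1) ^+ s i *: v i) `^ p) `^ p^-1
    <= C * (\sum_(i < n) nrm hK (v i) `^ p) `^ p^-1.

Definition nontrivial_type (R : realType) (K : numFieldType)
    (hK : scalar_field R K) (V : normedModType K) : Prop :=
  exists2 p : R, 1 < p <= 2 & has_rademacher_type hK V p.

Definition lesssim (R : realType) (D : set nat) (a b : nat -> \bar R) : Prop :=
  exists C : R, forall m, D m -> (a m <= C%:E * b m)%E.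

Definition equivalent (R : realType) (D : set nat) (a b : nat -> \bar R) :
  Prop := lesssim D a b /\ lesssim D b a.

(* Main.v *)
Require Import Defs.
From HB Require Import structures.
From mathcomp Require Import all_boot all_order all_algebra.
From mathcomp Require Import complex.
From mathcomp Require Import all_classical all_reals all_analysis.
From mathcomp Require Import ring lra zify.
Import Defs.

Set Implicit Arguments.
Unset Strict Implicit.
Unset Printing Implicit Defensive.

Import Order.TTheory GRing.Theory Num.Theory.
Import numFieldNormedType.Exports.

Local Open Scope classical_set_scope.
Local Open Scope ring_scope.

(** The space [S] is a sequence space in which one can average over blocks: if
    the indices are cut into consecutive blocks, replacing the coefficients in
    every block by their mean is a bounded projection, because it is a mean of
    cyclic shifts and a cyclic shift is increasing on two pieces
    ([block_avg_bound]). Let the [n]-th block have length [b ^ n], let [N] be the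
    kernel of the projection, and let [(y_n)] be any basis of [X]. On the direct
    sum of [N] and [X] consider the vectors obtained from a unit vector [e_j] of
    the [n]-th block: its residual [e_j - avg e_j] in [N], together with the
    multiple of [y_n] for which [y_n] plays the role of the normalized sum of the
    unit vectors of the block. They form a basis (the method of Dilworth, Kalton
    and Kutzarova) in which finite combinations inside one block have the norm of
    [S] up to a constant, while combinations that are constant on blocks behave
    like [(y_n)].

    This basis is almost greedy whatever [(y_n)] is ([dkk_almost_greedy]).
    The coordinates along [(y_n)] are bounded, so the mean over the [n]-th block of
    a vector of norm one is at most a constant over [Lambda(b ^ n)], the norm of
    the sum of [b ^ n] unit vectors of [S]. Compared with a threshold [t], these
    means are negligible on all but finitely many blocks, where the coefficients
    above [t] are governed by the part in [N]; on the remaining short blocks the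
    coefficients below [t] have a small sum. The second step sums the numbers
    [Lambda(b ^ n)] as a geometric series. Nontrivial type makes this possible:
    otherwise [S] would contain the [l_infty^k] uniformly, hence the [l_1^k]
    ([lam_doubling]).

    The direct sum of [N] and [X] is again [X] ([mean_zero_absorbed]). Indeed [X]
    is the sum of [S] and a complement, and [S] can be averaged over another
    partition, whose list of lengths interlaces [(b ^ n)] with itself: the kernel
    of that projection is isomorphic to its own sum with [N].

    A vector supported in the first [m] coordinates meets about [log m] blocks,
    and inside a block all coordinate projections are bounded, so [L_m] is at most
    of order [log m]. Conversely, a set of indices made of whole blocks acts on
    averages as a coordinate projection of [(y_n)], with [log m] terms at our
    disposal. So it remains to find [(y_n)] as conditional as possible. From a
    basis [(x_j)] of type P one makes it in dyadic blocks: with initial sums [T_i]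
    over the first half of a block and vectors [v_i] of the second half, the
    vectors [T_i] and [v_i - T_i] add up to the bounded sum of the [v_i], whereas
    the [T_i] alone add up linearly since [x_p^*(T_i) = 1] for the first index [p]
    ([cond_system], [cond_block_sum], [cond_block_even]). *)

(** * Scalars and norms with values in the reals *)

Lemma le_of_eq (R : realType) (x y : R) : x = y -> x <= y.
Proof. by move->. Qed.

Section Scalars.
Variables (R : realType) (K : numFieldType) (hK : scalar_field R K).

Definition scalar_emb : R -> K :=
  match hK in scalar_field _ K' return R -> K' with
  | RealScalars => fun x => x
  | ComplexScalars => fun x => real_complex R x
  end.

Definition mag (a : K) : R := scalar_re hK `|a|.

Lemma scalar_embD x y : scalar_emb (x + y) = scalar_emb x + scalar_emb y.
Proof. by rewrite /scalar_emb; case: hK => //; rewrite rmorphD. Qed.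

Lemma scalar_embM x y : scalar_emb (x * y) = scalar_emb x * scalar_emb y.
Proof. by rewrite /scalar_emb; case: hK => //; rewrite rmorphM. Qed.

Lemma scalar_emb1 : scalar_emb 1 = 1.
Proof. by rewrite /scalar_emb; case: hK. Qed.

Lemma scalar_emb0 : scalar_emb 0 = 0.
Proof. by rewrite /scalar_emb; case: hK. Qed.

Lemma scalar_embN x : scalar_emb (- x) = - scalar_emb x.
Proof. by apply: (addIr (scalar_emb x)); rewrite -scalar_embD !addNr scalar_emb0. Qed.

Lemma scalar_embn n : scalar_emb n%:R = n%:R.
Proof. by elim: n => [|n IH]; rewrite ?scalar_emb0// !mulrS scalar_embD IH scalar_emb1. Qed.

Lemma scalar_embV x : scalar_emb x^-1 = (scalar_emb x)^-1.
Proof.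
have [->|x0] := eqVneq x 0; first by rewrite invr0 scalar_emb0 invr0.
have h : scalar_emb x * scalar_emb x^-1 = 1 by rewrite -scalar_embM mulfV// scalar_emb1.
have e0 : scalar_emb x != 0.
  by apply/eqP => e0; move/eqP: h; rewrite e0 mul0r eq_sym oner_eq0.
by apply: (mulfI e0); rewrite h mulfV.
Qed.

Lemma ler_scalar_emb x y : (scalar_emb x <= scalar_emb y) = (x <= y).
Proof. by rewrite /scalar_emb; case: hK => //=; rewrite lecE/= eqxx. Qed.

Lemma ltr_scalar_emb x y : (scalar_emb x < scalar_emb y) = (x < y).
Proof.
have inj : injective scalar_emb.
  by move=> u v uv; apply/eqP; rewrite eq_le -!ler_scalar_emb uv lexx.
by rewrite !lt_def ler_scalar_emb (inj_eq inj).
Qed.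

Lemma scalar_re_emb x : scalar_re hK (scalar_emb x) = x.
Proof. by rewrite /scalar_emb /scalar_re; case: hK. Qed.

Lemma scalar_emb_re (a : K) : 0 <= a -> scalar_emb (scalar_re hK a) = a.
Proof.
rewrite /scalar_emb /scalar_re; case: hK a => //= - [x y].
by rewrite lecE/= => /andP[/eqP-> _].
Qed.

(** Real multipliers can be averaged from signs; this reduces scalar ones to them.
    The factor [w] is the same for all scalars, so that it can be taken out of a
    sum. *)
Lemma scalar_split : exists2 w : K, mag w <= 1 & forall a : K, exists u v : R,
  [/\ a = scalar_emb u + w * scalar_emb v, `|u| <= mag a & `|v| <= mag a].
Proof.
rewrite /mag /scalar_emb /scalar_re; case: hK => //=.
  exists 0 => [|a]; first by rewrite normr0 ler01.
  by exists a, 0; rewrite mul0r addr0 normr0 normr_ge0.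
have sq (u v : R) : `|u| <= Num.sqrt (u ^+ 2 + v ^+ 2).
  by rewrite -sqrtr_sqr ler_wsqrtr// lerDl sqr_ge0.
exists 'i%C => [|[x y]]; first by rewrite /= expr0n/= add0r expr1n sqrtr1.
exists x, y; split => /=.
- by rewrite /real_complex_def; simpc.
- exact: sq.
- by rewrite addrC sq.
Qed.

End Scalars.

Section Norms.
Variables (R : realType) (K : numFieldType) (hK : scalar_field R K).
Local Notation "⟦ v ⟧" := (nrm hK v) (at level 0, v at level 99).
Local Notation emb := (scalar_emb hK).

Lemma emb_nrm (V : normedModType K) (v : V) : emb ⟦v⟧ = `|v|.
Proof. by rewrite scalar_emb_re. Qed.

Lemma emb_mag (a : K) : emb (mag hK a) = `|a|.
Proof. by rewrite scalar_emb_re. Qed.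

Lemma nrm_ge0 (V : normedModType K) (v : V) : 0 <= ⟦v⟧.
Proof. by rewrite -(ler_scalar_emb hK) emb_nrm scalar_emb0. Qed.

Lemma nrm_eq0 (V : normedModType K) (v : V) : (⟦v⟧ == 0) = (v == 0).
Proof.
apply/eqP/eqP => [h|->]; last by rewrite /nrm normr0 -(scalar_emb0 hK) scalar_re_emb.
by apply/normr0_eq0; rewrite -emb_nrm h scalar_emb0.
Qed.

Lemma nrm0 (V : normedModType K) : ⟦0 : V⟧ = 0.
Proof. by apply/eqP; rewrite nrm_eq0. Qed.

Lemma nrm_gt0 (V : normedModType K) (v : V) : (0 < ⟦v⟧) = (v != 0).
Proof. by rewrite lt_def nrm_ge0 nrm_eq0 andbT. Qed.

Lemma ler_nrmD (V : normedModType K) (u v : V) : ⟦u + v⟧ <= ⟦u⟧ + ⟦v⟧.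
Proof. by rewrite -(ler_scalar_emb hK) scalar_embD !emb_nrm ler_normD. Qed.

Lemma nrmN (V : normedModType K) (v : V) : ⟦- v⟧ = ⟦v⟧.
Proof. by rewrite /nrm normrN. Qed.

Lemma ler_nrmB (V : normedModType K) (u v : V) : ⟦u - v⟧ <= ⟦u⟧ + ⟦v⟧.
Proof. by rewrite (le_trans (ler_nrmD _ _))// nrmN. Qed.

Lemma nrmC (V : normedModType K) (u v : V) : ⟦u - v⟧ = ⟦v - u⟧.
Proof. by rewrite -nrmN opprB. Qed.

Lemma nrmZ (V : normedModType K) (a : K) (v : V) : ⟦a *: v⟧ = mag hK a * ⟦v⟧.
Proof.
rewrite -[RHS](scalar_re_emb hK) scalar_embM emb_nrm emb_mag /nrm.
by rewrite normrZ.
Qed.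

Lemma mag_ge0 a : 0 <= mag hK a. Proof. exact: (@nrm_ge0 K^o). Qed.
Lemma mag0 : mag hK 0 = 0. Proof. exact: (@nrm0 K^o). Qed.
Lemma mag_eq0 a : (mag hK a == 0) = (a == 0). Proof. exact: (@nrm_eq0 K^o). Qed.
Lemma ler_magD a b : mag hK (a + b) <= mag hK a + mag hK b.
Proof. exact: (@ler_nrmD K^o). Qed.
Lemma magN a : mag hK (- a) = mag hK a. Proof. exact: (@nrmN K^o). Qed.
Lemma magM a b : mag hK (a * b) = mag hK a * mag hK b.
Proof. exact: (@nrmZ K^o). Qed.

Lemma mag_emb x : mag hK (emb x) = `|x|.
Proof.
have pos y : 0 <= y -> mag hK (emb y) = y.
  move=> y0; rewrite /mag ger0_norm ?scalar_re_emb//.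
  by rewrite -(scalar_emb0 hK) ler_scalar_emb.
have [x0|x0] := leP 0 x; first by rewrite ger0_norm// pos.
rewrite ltr0_norm//.
by rewrite -[x in LHS]opprK scalar_embN magN pos// oppr_ge0 ltW.
Qed.

Lemma mag1 : mag hK 1 = 1.
Proof. by rewrite -(scalar_emb1 hK) mag_emb normr1. Qed.

Lemma mag_le a b : (mag hK a <= mag hK b) = (`|a| <= `|b|).
Proof. by rewrite -(ler_scalar_emb hK) !emb_mag. Qed.

Lemma ler_nrm_sum (V : normedModType K) (I : Type) (r : seq I) (P : pred I)
    (F : I -> V) : ⟦\sum_(i <- r | P i) F i⟧ <= \sum_(i <- r | P i) ⟦F i⟧.
Proof.
apply: (big_ind2 (fun (x : V) y => ⟦x⟧ <= y)) => [|x y z t h k|//].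
  by rewrite nrm0.
by apply: le_trans (ler_nrmD _ _) _; rewrite lerD.
Qed.

Lemma ler_nrm_tri (V : normedModType K) (u v w : V) : ⟦u - w⟧ <= ⟦u - v⟧ + ⟦v - w⟧.
Proof. by apply: le_trans (ler_nrmD _ _); rewrite addrA subrK. Qed.

Lemma ler_nrm_addl (V : normedModType K) (u v : V) : ⟦u⟧ <= ⟦v⟧ + ⟦u - v⟧.
Proof. by apply: le_trans (ler_nrmD _ _); rewrite addrC subrK. Qed.

(** * Convergence of sequences *)

Definition tends (V : normedModType K) (u : nat -> V) (l : V) :=
  forall eps : R, 0 < eps -> exists N, forall n, (N <= n)%N -> ⟦u n - l⟧ < eps.

Lemma tendsP (V : normedModType K) (u : nat -> V) (l : V) :
  u @ \oo --> l <-> tends u l.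
Proof.
split=> [/cvgrPdist_lt h eps e0|h].
  have : 0 < emb eps by rewrite -(scalar_emb0 hK) ltr_scalar_emb.
  move=> /h[N _ hN]; exists N => n Nn; have := hN n Nn; rewrite /=.
  by rewrite -emb_nrm ltr_scalar_emb nrmC.
apply/cvgrPdist_lt => eps e0.
have ee : eps = emb (scalar_re hK eps) by rewrite scalar_emb_re// ltW.
rewrite ee -(scalar_emb0 hK) ltr_scalar_emb in e0.
have [N hN] := h _ e0; exists N => // n /= Nn.
by rewrite ee -emb_nrm ltr_scalar_emb nrmC hN.
Qed.

Lemma tends_unique (V : normedModType K) (u : nat -> V) l l' :
  tends u l -> tends u l' -> l = l'.
Proof. by move=> /tendsP h /tendsP h'; apply: cvg_unique h h'. Qed.

Lemma tends_complete (V : completeNormedModType K) (u : nat -> V) :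
  (forall eps : R, 0 < eps -> exists N, forall m n,
     (N <= m)%N -> (m <= n)%N -> ⟦u n - u m⟧ < eps) ->
  exists l, tends u l.
Proof.
move=> h; suff /cvg_ex[l /tendsP] : cvgn u by exists l.
apply/cauchy_cvgP/cauchy_exP => eps e0.
have ee : eps = emb (scalar_re hK eps) by rewrite scalar_emb_re// ltW.
rewrite ee -(scalar_emb0 hK) ltr_scalar_emb in e0.
have [N hN] := h _ e0; exists (u N); exists N => // n /= Nn.
rewrite -ball_normE/= ee -emb_nrm ltr_scalar_emb nrmC.
exact: hN.
Qed.

Lemma tends_ext (V : normedModType K) (u v : nat -> V) l N :
  (forall n, (N <= n)%N -> u n = v n) -> tends u l -> tends v l.
Proof.
move=> uv h eps /h[M hM]; exists (maxn M N) => n.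
by rewrite geq_max => /andP[Mn Nn]; rewrite -uv// hM.
Qed.

Lemma tends_cst (V : normedModType K) (l : V) : tends (fun=> l) l.
Proof. by move=> eps e0; exists 0 => n _; rewrite subrr nrm0. Qed.

Lemma tendsD (V : normedModType K) (u v : nat -> V) l m :
  tends u l -> tends v m -> tends (fun n => u n + v n) (l + m).
Proof. by move=> /tendsP h /tendsP k; apply/tendsP; apply: cvgD. Qed.

Lemma tendsZ (V : normedModType K) (u : nat -> V) l a :
  tends u l -> tends (fun n => a *: u n) (a *: l).
Proof. by move=> /tendsP h; apply/tendsP; apply: cvgZr. Qed.

Lemma tendsN (V : normedModType K) (u : nat -> V) l :
  tends u l -> tends (fun n => - u n) (- l).
Proof. by move=> /tendsP h; apply/tendsP; apply: cvgN. Qed.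

Lemma tendsB (V : normedModType K) (u v : nat -> V) l m :
  tends u l -> tends v m -> tends (fun n => u n - v n) (l - m).
Proof. by move=> h k; apply: tendsD => //; apply: tendsN. Qed.

Lemma tends_subseq (V : normedModType K) (u : nat -> V) l (phi : nat -> nat) :
  (forall n, (n <= phi n)%N) -> tends u l -> tends (u \o phi) l.
Proof.
move=> hphi h eps /h[N hN]; exists N => n Nn; apply: hN.
exact: leq_trans (hphi n).
Qed.

Lemma tends_le (V : normedModType K) (u : nat -> V) l (C : R) N :
  tends u l -> (forall n, (N <= n)%N -> ⟦u n⟧ <= C) -> ⟦l⟧ <= C.
Proof.
move=> h hu; apply/ler_addgt0Pr => eps /h[M hM].
pose n := maxn M N.
apply: le_trans (ler_nrm_addl _ (u n)) _; apply: lerD; first by rewrite hu ?leq_maxr.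
by rewrite nrmC ltW// hM ?leq_maxl.
Qed.

Lemma tends_norm (V : normedModType K) (u : nat -> V) l (C : R) : 
  tends u l -> (forall N, exists2 n, (N <= n)%N & C <= ⟦u n⟧) -> C <= ⟦l⟧.
Proof.
move=> h hu; apply/ler_addgt0Pr => eps /h[M hM].
have [n Mn hn] := hu M.
apply: le_trans hn _; apply: le_trans (ler_nrm_addl _ l) _.
by rewrite lerD2l ltW// hM.
Qed.

(** * Bounded linear maps *)

Definition bounded_linear (V W : normedModType K) (f : V -> W) :=
  linear f /\ exists2 C : R, 0 < C & forall v, ⟦f v⟧ <= C * ⟦v⟧.

Section Linear.
Variables (V W : lmodType K) (f : V -> W).
Hypothesis lf : linear f.

Let pack : {linear V -> W} := HB.pack f (GRing.isLinear.Build _ _ _ _ _ lf).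

Lemma lin0 : f 0 = 0. Proof. exact: (linear0 pack). Qed.
Lemma linD u v : f (u + v) = f u + f v. Proof. exact: (linearD pack). Qed.
Lemma linB u v : f (u - v) = f u - f v. Proof. exact: (linearB pack). Qed.
Lemma linZ a u : f (a *: u) = a *: f u. Proof. exact: (linearZ_LR pack). Qed.
Lemma lin_sum (I : Type) (r : seq I) (P : pred I) (F : I -> V) :
  f (\sum_(i <- r | P i) F i) = \sum_(i <- r | P i) f (F i).
Proof. exact: (linear_sum pack). Qed.
Lemma lin_sumZ (I : Type) (r : seq I) (P : pred I) (F : I -> V) (a : I -> K) :
  f (\sum_(i <- r | P i) a i *: F i) = \sum_(i <- r | P i) a i *: f (F i).
Proof. by rewrite lin_sum; apply: eq_bigr => i _; rewrite linZ. Qed.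
End Linear.

Lemma linear_comp (U V W : lmodType K) (g : V -> W) (f : U -> V) :
  linear g -> linear f -> linear (fun u => g (f u)).
Proof. by move=> lg lf a u v; rewrite lf lg. Qed.

Lemma linear_sub (V W : lmodType K) (f g : V -> W) :
  linear f -> linear g -> linear (fun u => f u - g u).
Proof. by move=> lg lf a u v; rewrite lf lg scalerBr opprD addrACA. Qed.

Lemma linear_add (V W : lmodType K) (f g : V -> W) :
  linear f -> linear g -> linear (fun u => f u + g u).
Proof. by move=> lg lf a u v; rewrite lf lg scalerDr addrACA. Qed.

Lemma blin_id (V : normedModType K) : bounded_linear (fun v : V => v).
Proof. by split=> //; exists 1 => // v; rewrite mul1r. Qed.

Lemma blin_comp (U V W : normedModType K) (g : V -> W) (f : U -> V) :
  bounded_linear g -> bounded_linear f -> bounded_linear (fun u => g (f u)).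
Proof.
move=> [lg [C C0 hC]] [lf [D D0 hD]]; split; first exact: linear_comp.
exists (C * D); first exact: mulr_gt0.
move=> u; apply: le_trans (hC _) _; rewrite -mulrA ler_wpM2l//; exact: ltW.
Qed.

Lemma blin_add (V W : normedModType K) (f g : V -> W) :
  bounded_linear f -> bounded_linear g -> bounded_linear (fun u => f u + g u).
Proof.
move=> [lg [C C0 hC]] [lf [D D0 hD]]; split; first exact: linear_add.
exists (C + D); first exact: addr_gt0.
by move=> u; apply: le_trans (ler_nrmD _ _) _; rewrite mulrDl lerD.
Qed.

Lemma blin_sub (V W : normedModType K) (f g : V -> W) :
  bounded_linear f -> bounded_linear g -> bounded_linear (fun u => f u - g u).
Proof.
move=> [lg [C C0 hC]] [lf [D D0 hD]]; split; first exact: linear_sub.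
exists (C + D); first exact: addr_gt0.
by move=> u; apply: le_trans (ler_nrmB _ _) _; rewrite mulrDl lerD.
Qed.

Lemma blin_tends (V W : normedModType K) (f : V -> W) u l :
  bounded_linear f -> tends u l -> tends (fun n => f (u n)) (f l).
Proof.
move=> [lf [C C0 hC]] h eps e0.
have [N hN] := h _ (divr_gt0 e0 C0); exists N => n /hN.
rewrite ltr_pdivlMr// mulrC => lt; apply: le_lt_trans lt.
by rewrite -linB.
Qed.

End Norms.

(** * Schauder bases and their coordinate functionals *)

Section ScalarComplete.
Variables (R : realType).

Let real_complete (u : nat -> R) :
  (forall eps : R, 0 < eps -> exists N, forall m n,
     (N <= m)%N -> (m <= n)%N -> `|u n - u m| < eps) ->
  exists l, forall eps : R, 0 < eps -> exists N, forall n,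
     (N <= n)%N -> `|u n - l| < eps.
Proof. exact: (@tends_complete R R (RealScalars R) R^o). Qed.

Lemma scalar_complete (K : numFieldType) (hK : scalar_field R K) (u : nat -> K) :
  (forall eps : R, 0 < eps -> exists N, forall m n,
     (N <= m)%N -> (m <= n)%N -> mag hK (u n - u m) < eps) ->
  exists l : K, tends hK (u : nat -> K^o) l.
Proof.
case: hK u => [u|u] hu; first exact: real_complete.
have hre (z : R[i]) : `|complex.Re z| <= mag (ComplexScalars R) z.
  by case: z => x y; rewrite /mag/= -sqrtr_sqr ler_wsqrtr// lerDl sqr_ge0.
have him (z : R[i]) : `|complex.Im z| <= mag (ComplexScalars R) z.
  by case: z => x y; rewrite /mag/= -sqrtr_sqr ler_wsqrtr// lerDr sqr_ge0.
have [p hp] : exists l, forall eps : R, 0 < eps -> exists N, forall n,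
    (N <= n)%N -> `|complex.Re (u n) - l| < eps.
  apply: real_complete => eps /hu[N hN]; exists N => m n Nm mn.
  apply: le_lt_trans (hN m n Nm mn); apply: le_trans (hre _).
  by case: (u n) (u m) => ? ? [? ?].
have [q hq] : exists l, forall eps : R, 0 < eps -> exists N, forall n,
    (N <= n)%N -> `|complex.Im (u n) - l| < eps.
  apply: real_complete => eps /hu[N hN]; exists N => m n Nm mn.
  apply: le_lt_trans (hN m n Nm mn); apply: le_trans (him _).
  by case: (u n) (u m) => ? ? [? ?].
exists (Complex p q) => eps e0.
have e2 : 0 < eps / 2 by rewrite divr_gt0.
have [N hN] := hp _ e2; have [M hM] := hq _ e2.
exists (maxn N M) => n; rewrite geq_max => /andP[/hN h1 /hM h2].
rewrite [X in _ < X]splitr; apply: le_lt_trans (ltrD h1 h2).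
case: (u n) => x y /=; rewrite /nrm/=.
rewrite -[leRHS]ger0_norm ?addr_ge0// -[leRHS]sqrtr_sqr ler_wsqrtr//.
rewrite [leRHS]sqrrD !real_normK ?num_real// lerD2r lerDl mulrn_wge0// mulr_ge0//.
Qed.

End ScalarComplete.

Section Schauder.
Variables (R : realType) (K : numFieldType) (hK : scalar_field R K).
Local Notation "⟦ v ⟧" := (nrm hK v) (at level 0, v at level 99).
Local Notation emb := (scalar_emb hK).
Local Notation mag := (mag hK).
Local Notation tends := (tends hK).

(** The functionals and the constant are data here: a basis given by unique
    expansions has them by [schauder_system_of_basis], and the bases constructed
    below come with explicit formulas for both. *)
Definition schauder_system (X : normedModType K) (x : nat -> X)
    (xs : nat -> X -> K^o) (C : R) :=
  [/\ forall j, linear (xs j), forall i j, xs j (x i) = (i == j)%:R,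
      forall n f, ⟦\sum_(0 <= j < n) xs j f *: x j⟧ <= C * ⟦f⟧ &
      forall f, tends (fun n => \sum_(0 <= j < n) xs j f *: x j) f].

Section Baire.
Variable X : completeNormedModType K.
Variable B : nat -> set X.
Hypothesis coverB : forall f, exists k, B k f.

(** Otherwise one could nest balls, each missing one more of the sets [B k]; their
    common point would lie in no [B k]. *)
Lemma baire_dense_ball : exists k c (r : R), 0 < r /\
  forall f, ⟦f - c⟧ < r -> forall eta : R, 0 < eta ->
    exists2 g, B k g & ⟦f - g⟧ < eta.
Proof.
apply: contrapT => nB.
have step k (p : X * R) : exists q : X * R, 0 < p.2 ->
    [/\ 0 < q.2, q.2 <= p.2 / 2, ⟦q.1 - p.1⟧ + q.2 <= p.2 &
        forall g, ⟦g - q.1⟧ <= q.2 -> ~ B k g].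
  case: p => c r /=; have [r0|r0] := ltP 0 r; last by exists (c, r); rewrite ltNge r0.
  have /existsNP[f /not_implyP[fr /existsNP[eta /not_implyP[eta0 hf]]]] :
      ~ forall f, ⟦f - c⟧ < r -> forall eta : R, 0 < eta ->
        exists2 g, B k g & ⟦f - g⟧ < eta.
    by move=> h; apply: nB; exists k, c, r.
  exists (f, Num.min (eta / 2) (Num.min (r - ⟦f - c⟧) (r / 2))) => _ /=; split.
  - by rewrite !lt_min subr_gt0 fr !divr_gt0.
  - by rewrite !ge_min lexx !orbT.
  - by rewrite addrC -lerBrDr !ge_min lexx orbT.
  - move=> g; rewrite !le_min => /andP[h _] Bg; apply: hf; exists g => //.
    by rewrite nrmC (le_lt_trans h)// ltr_pdivrMr// mulr_natr mulr2n ltrDl.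
pose F k p := xget p [set q : X * R | 0 < p.2 ->
    [/\ 0 < q.2, q.2 <= p.2 / 2, ⟦q.1 - p.1⟧ + q.2 <= p.2 &
        forall g, ⟦g - q.1⟧ <= q.2 -> ~ B k g]].
have hF k p : 0 < p.2 -> [/\ 0 < (F k p).2, (F k p).2 <= p.2 / 2,
    ⟦(F k p).1 - p.1⟧ + (F k p).2 <= p.2 &
    forall g, ⟦g - (F k p).1⟧ <= (F k p).2 -> ~ B k g].
  by move=> p0; apply: (xgetPex p (step k p)).
pose fix s k : X * R := if k is k'.+1 then F k' (s k') else (0, 1).
have s0 k : 0 < (s k).2 by elim: k => [|k IH]//=; case: (hF k _ IH).
have shalf k : (s k).2 <= 2^-1 ^+ k.
  elim: k => [|k IH]; first by rewrite /= expr0.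
  have [_ + _ _] := hF k _ (s0 k); move=> h; apply: le_trans h _.
  by rewrite exprSr ler_wpM2r.
have snest m k : ⟦(s (m + k)%N).1 - (s m).1⟧ + (s (m + k)%N).2 <= (s m).2.
  elim: k => [|k IH]; first by rewrite addn0 subrr nrm0 add0r.
  have [_ _ h _] := hF (m + k)%N _ (s0 (m + k)%N); rewrite addnS.
  apply: le_trans IH; apply: (le_trans (y := ⟦(s (m + k)%N).1 - (s m).1⟧ +
    (⟦(s (m + k).+1%N).1 - (s (m + k)%N).1⟧ + (s (m + k).+1%N).2))); last by rewrite lerD2l.
  by rewrite addrA lerD2r addrC; exact: ler_nrm_tri.
have half_small (eps : R) : 0 < eps -> exists N, 2^-1 ^+ N < eps.
  move=> e0; have h := @cvg_expr R 2^-1.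
  have : `|2^-1 : R| < 1 by rewrite ger0_norm// invf_lt1// ltr1n.
  move=> /h /cvgrPdist_lt/(_ _ e0)[N _ /(_ N)]; rewrite /= leqnn sub0r normrN => /(_ isT) hN.
  by exists N; rewrite (le_lt_trans (ler_norm _)).
have [l hl] : exists l, tends (fun k => (s k).1) l.
  apply: tends_complete => eps /half_small[N hN]; exists N => m n Nm mn.
  have := snest m (n - m)%N; rewrite subnKC// => h.
  apply: le_lt_trans hN; apply: le_trans (le_trans _ h) _; first by rewrite lerDl ltW.
  apply: le_trans (shalf m) _; apply: ler_wiXn2l => //.
  by rewrite invf_le1// ler1n.
have [k Bk] := coverB l.
have [_ _ _ /(_ l)] := hF k _ (s0 k); apply => //.
apply: (@tends_le _ _ _ _ (fun n => (s (k.+1 + n)%N).1 - (F k (s k)).1) _ _ 0).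
  apply: tendsB (tends_cst hK _).
  by apply: (@tends_subseq _ _ _ _ (fun k => (s k).1) l (addn k.+1)) => // i; rewrite leq_addl.
by move=> i _; apply: le_trans (snest k.+1 i); rewrite lerDl ltW.
Qed.

End Baire.

Section BasisToSystem.
Variables (X : completeNormedModType K) (x : nat -> X).
Hypothesis bx : is_schauder_basis x.

Let psum n f := \sum_(0 <= j < n) coord x f j *: x j.

Lemma coord_expansion f : tends (psum ^~ f) f.
Proof. by apply/tendsP; apply: (xgetPex _ (ex_intro _ _ (proj1 (projT2 (cid (bx f)))))). Qed.

Lemma coord_unique f a :
  tends (fun n => \sum_(0 <= j < n) a j *: x j) f -> coord x f = a.
Proof.
move=> /tendsP h; have [b [hb ub]] := bx f.
by rewrite -(ub a h); apply/esym/ub/tendsP; exact: coord_expansion.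
Qed.

Lemma coord_linear j : linear (fun f => coord x f j : K^o).
Proof.
move=> a u v; suff -> : coord x (a *: u + v) = fun j => a * coord x u j + coord x v j by [].
apply: coord_unique.
apply: (tends_ext (N := 0)) (tendsD (tendsZ a (coord_expansion u)) (coord_expansion v)).
move=> n _; rewrite /psum scaler_sumr -big_split; apply: eq_bigr => i _ /=.
by rewrite scalerDl scalerA.
Qed.

Lemma coord_dual i j : coord x (x i) j = (i == j)%:R.
Proof.
suff -> : coord x (x i) = fun j => (i == j)%:R by [].
apply: coord_unique; apply: (tends_ext (N := i.+1)) (tends_cst hK _) => n ni.
rewrite (bigD1_seq i) ?iota_uniq ?mem_index_iota//= eqxx scale1r.
by rewrite big1 ?addr0// => k /negbTE; rewrite eq_sym => ->; rewrite scale0r.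
Qed.

Lemma basis_neq0 j : x j != 0.
Proof.
apply/eqP => xj; have := coord_dual j j; rewrite xj eqxx => /eqP.
by rewrite (lin0 (coord_linear j)) eq_sym oner_eq0.
Qed.

Let psum_linear n : linear (psum n).
Proof.
move=> a u v; rewrite /psum scaler_sumr -big_split; apply: eq_bigr => i _ /=.
by rewrite coord_linear scalerDl scalerA.
Qed.

Let tends_bounded (u : nat -> X) l : tends u l -> exists C : nat, forall n, ⟦u n⟧ <= C%:R.
Proof.
move=> /(_ 1 ltr01)[N hN].
have [C hC] : exists C : R, forall n, (n < N)%N -> ⟦u n⟧ <= C.
  elim: N {hN} => [|N [C hC]]; first by exists 0.
  exists (Num.max C ⟦u N⟧) => n; rewrite ltnS leq_eqVlt => /orP[/eqP->|/hC h].
    by rewrite le_max lexx orbT.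
  by rewrite le_max h.
exists (Num.trunc (Num.max C (⟦l⟧ + 1))).+1 => n.
apply: le_trans (ltW (truncnS_gt _)); rewrite le_max.
have [/hC->//|/hN h] := ltnP n N.
by apply/orP; right; apply: le_trans (ler_nrm_addl _ _ l) _; rewrite lerD2l ltW.
Qed.

(** Some set of vectors with partial sums bounded by [k] is dense in a ball, so
    the differences of its elements are dense in a ball around 0; the rest is
    homogeneity. *)
Let approx : exists2 D : R, 0 < D & forall f, forall eta : R, 0 < eta ->
  exists2 g, (forall n, ⟦psum n g⟧ <= D * ⟦f⟧) & ⟦f - g⟧ < eta.
Proof.
have cover f : exists k : nat, [set f | forall n, ⟦psum n f⟧ <= k%:R] f.
  exact: tends_bounded (coord_expansion f).
have [k [c [r [r0 hr]]]] := baire_dense_ball cover.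
exists (4 * (k%:R + 1) / r); first by rewrite !divr_gt0 ?mulr_gt0// ltr_wpDl.
move=> f eta eta0; have [->|f0] := eqVneq f 0.
  exists 0; last by rewrite subrr nrm0.
  by move=> n; rewrite (lin0 (psum_linear n)) !nrm0 mulr0.
have nf : 0 < ⟦f⟧ by rewrite nrm_gt0.
pose t := r / (2 * ⟦f⟧); have t0 : 0 < t by rewrite divr_gt0 ?mulr_gt0.
have nt : ⟦emb t *: f⟧ < r.
  rewrite nrmZ mag_emb gtr0_norm// /t invfM mulrA -mulrA mulVf ?gt_eqF// mulr1.
  by rewrite ltr_pdivrMr// mulr_natr mulr2n ltrDl.
have e1 : 0 < t * eta / 2 by apply: divr_gt0 => //; apply: mulr_gt0.
have [g1 hg1 d1] := hr (emb t *: f + c) ltac:(by rewrite addrK) _ e1.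
have [g2 hg2 d2] := hr c ltac:(by rewrite subrr nrm0) _ e1.
have embt : emb t != 0 by rewrite -(scalar_emb0 hK) gt_eqF// ltr_scalar_emb.
exists ((emb t)^-1 *: (g1 - g2)).
  move=> n; rewrite (linZ (psum_linear n)) (linB (psum_linear n)) nrmZ.
  rewrite -scalar_embV mag_emb ger0_norm ?invr_ge0 ?(ltW t0)//.
  have -> : t^-1 = 2 * ⟦f⟧ / r by rewrite /t invf_div.
  have -> : 4 * (k%:R + 1) / r * ⟦f⟧ = 2 * ⟦f⟧ / r * (2 * (k%:R + 1)) by ring.
  rewrite ler_wpM2l ?divr_ge0 ?mulr_ge0 ?nrm_ge0 ?(ltW r0)//.
  apply: le_trans (ler_nrmB _ _ _) _; apply: le_trans (lerD (hg1 n) (hg2 n)) _.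
  by lra.
have -> : f - (emb t)^-1 *: (g1 - g2) =
    (emb t)^-1 *: ((emb t *: f + c - g1) - (c - g2)).
  rewrite -{1}[f](scalerK embt) -scalerBr; congr (_ *: _).
  by rewrite !opprB -[_ + c - g1]addrA -addrA; congr (_ + _); rewrite [RHS]addrC addrA subrK addrC.
rewrite nrmZ -scalar_embV mag_emb ger0_norm ?invr_ge0 ?(ltW t0)//.
rewrite mulrC ltr_pdivrMr// (le_lt_trans (ler_nrmB _ _ _))//.
by rewrite mulrC [X in _ < X]splitr ltrD.
Qed.

(** Successive approximation, as in the open mapping theorem: [f] is a series of
    vectors whose partial sums are bounded by a geometric sequence. Adding their
    expansions gives an expansion of [f], which is the only one. *)
Lemma schauder_system_of_basis :
  exists2 C : R, 0 < C & schauder_system x (fun j f => coord x f j) C.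
Proof.
have [D D0 hD] := approx.
exists (2 * D); first exact: mulr_gt0.
split; [exact: coord_linear|exact: coord_dual| |exact: coord_expansion].
move=> n0 f; rewrite -/(psum n0 f); have [->|f0] := eqVneq f 0.
  by rewrite (lin0 (psum_linear n0)) !nrm0 mulr0.
have nf : 0 < ⟦f⟧ by rewrite nrm_gt0.
(* [rem i] is what is left of [f] after [i] approximations, [s i] what was found. *)
pose rho i : R := ⟦f⟧ * 2^-1 ^+ i.
have rho0 i : 0 < rho i by rewrite /rho mulr_gt0// exprn_gt0.
have rhoS i : rho i.+1 = rho i / 2 by rewrite /rho exprSr mulrA.
have rho_small (eps : R) : 0 < eps -> exists N, forall m, (N <= m)%N -> rho m < eps.
  move=> e0; have : `|2^-1 : R| < 1 by rewrite ger0_norm// invf_lt1// ltr1n.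
  move=> /cvg_expr/cvgrPdist_lt/(_ _ (divr_gt0 e0 nf))[N _ hN]; exists N => m /hN /=.
  rewrite sub0r normrN ltr_pdivlMr// => h; rewrite /rho mulrC (le_lt_trans _ h)//.
  by rewrite ler_pM2r// ler_norm.
pose G i := xget 0 [set g | (forall n, ⟦psum n g⟧ <= D * ⟦i.2⟧) /\ ⟦i.2 - g⟧ < rho i.1.+1].
have hG i h : (forall n, ⟦psum n (G (i, h))⟧ <= D * ⟦h⟧) /\ ⟦h - G (i, h)⟧ < rho i.+1.
  have [g hg1 hg2] := hD h _ (rho0 i.+1).
  have ex : exists g, [set g | (forall n, ⟦psum n g⟧ <= D * ⟦h⟧) /\ ⟦h - g⟧ < rho i.+1] g.
    by exists g.
  exact: (xgetPex 0 ex).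
pose fix rem i : X := if i is i'.+1 then rem i' - G (i', rem i') else f.
have hrem i : ⟦rem i⟧ <= rho i.
  case: i => [|i]; first by rewrite /rho /= expr0 mulr1.
  by apply/ltW; case: (hG i (rem i)).
pose s m := f - rem m.
have sS m n : psum n (s m.+1) - psum n (s m) = psum n (G (m, rem m)).
  rewrite -(linB (psum_linear n)); congr psum.
  by rewrite /s /= !opprB addrC addrA subrK addrC subrK.
have incr m k n : ⟦psum n (s (m + k)%N) - psum n (s m)⟧ <= 2 * D * (rho m - rho (m + k)%N).
  elim: k => [|k IH]; first by rewrite addn0 !subrr nrm0 mulr0.
  apply: le_trans (ler_nrm_tri _ _ (psum n (s (m + k)%N)) _) _.
  rewrite addnS sS; have [/(_ n) h _] := hG (m + k)%N (rem (m + k)%N).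
  have h2 : D * ⟦rem (m + k)%N⟧ <= D * rho (m + k)%N by rewrite ler_pM2l.
  rewrite rhoS; apply: le_trans (lerD (le_trans h h2) IH) _.
  by apply: le_of_eq; field.
have incr2 m m' n : (m <= m')%N -> ⟦psum n (s m') - psum n (s m)⟧ <= 2 * D * rho m.
  move=> mm; have := incr m (m' - m)%N n; rewrite subnKC// => h; apply: le_trans h _.
  by rewrite ler_pM2l ?mulr_gt0// gerBl ltW.
have inc_coef m m' j : (m <= m')%N ->
    mag (coord x (s m') j - coord x (s m) j) * ⟦x j⟧ <= 4 * D * rho m.
  move=> mm; rewrite -nrmZ scalerBl.
  have -> : coord x (s m') j *: x j - coord x (s m) j *: x j =
    (psum j.+1 (s m') - psum j.+1 (s m)) - (psum j (s m') - psum j (s m)).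
    rewrite {1 2}/psum !big_nat_recr//= -/(psum j (s m')) -/(psum j (s m)).
    by rewrite [- (_ + _ *: _)]opprD addrACA [RHS]addrC addKr.
  apply: le_trans (ler_nrmB _ _ _) _; apply: le_trans (lerD (incr2 _ _ _ mm) (incr2 _ _ _ mm)) _.
  by apply: le_of_eq; ring.
have xj0 j : 0 < ⟦x j⟧ by rewrite nrm_gt0 basis_neq0.
have limc j : exists l : K, tends (fun m => coord x (s m) j : K^o) l.
  apply: scalar_complete => eps e0.
  have e1 : 0 < eps * ⟦x j⟧ / (4 * D).
    by apply: divr_gt0; apply: mulr_gt0.
  have [N hN] := rho_small _ e1; exists N => m m' Nm mm.
  rewrite -(ltr_pM2r (xj0 j)); apply: le_lt_trans (inc_coef _ _ _ mm) _.
  by have := hN m Nm; rewrite ltr_pdivlMr ?mulr_gt0// mulrC.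
have [a ha] := choice limc.
pose z n := \sum_(0 <= j < n) a j *: x j.
have limz n : tends (fun m => psum n (s m)) (z n).
  elim: n => [|n IH].
    apply: (tends_ext (N := 0)) (tends_cst hK _) => m _.
    by rewrite /psum /z !big_geq.
  apply: (tends_ext (N := 0) (u := fun m => psum n (s m) + coord x (s m) n *: x n)).
    by move=> m _; rewrite /psum big_nat_recr.
  rewrite /z big_nat_recr//=; apply: tendsD IH _ => eps e0.
  have [N hN] := ha n _ (divr_gt0 e0 (xj0 n)); exists N => m /hN.
  by rewrite ltr_pdivlMr// -scalerBl nrmZ.
have dz n m : ⟦z n - psum n (s m)⟧ <= 2 * D * rho m.
  apply: (tends_le (u := fun m' => psum n (s m') - psum n (s m)) (N := m)).
    exact: tendsB (limz n) (tends_cst hK _).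
  by move=> m' /incr2.
have zf : tends z f.
  move=> eps e0; have e3 : 0 < eps / 3 by apply: divr_gt0.
  have e4 : 0 < eps / 3 / (2 * D + 1) by apply: divr_gt0 => //; apply: addr_gt0 => //; apply: mulr_gt0.
  have [m /(_ m (leqnn m)) hm] := rho_small _ e4.
  have [N hN] := coord_expansion (s m) e3; exists N => n /hN hn.
  have D1 : 0 < 2 * D + 1 by apply: addr_gt0 => //; apply: mulr_gt0.
  rewrite ltr_pdivlMr// in hm.
  have := dz n m; have : ⟦s m - f⟧ <= rho m.
    by rewrite /s addrC addKr nrmN.
  have := ler_nrm_tri hK (z n) (psum n (s m)) f.
  have := ler_nrm_tri hK (psum n (s m)) (s m) f.
  by move: hn (rho0 m); rewrite -/(psum n (s m)) => *; nra.
have <- : z n0 = psum n0 f.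
  by rewrite /psum (coord_unique zf).
have := dz n0 0; rewrite {1}/s /= subrr (lin0 (psum_linear n0)) subr0.
by rewrite /rho expr0 mulr1.
Qed.

End BasisToSystem.

Section SystemToBasis.
Variables (X : normedModType K) (x : nat -> X) (xs : nat -> X -> K^o) (C : R).
Hypothesis sx : schauder_system x xs C.

Lemma system_linear j : linear (xs j). Proof. by case: sx. Qed.
Lemma system_dual i j : xs j (x i) = (i == j)%:R. Proof. by case: sx. Qed.
Lemma system_partial n f : ⟦\sum_(0 <= j < n) xs j f *: x j⟧ <= C * ⟦f⟧.
Proof. by case: sx. Qed.
Lemma system_tends f : tends (fun n => \sum_(0 <= j < n) xs j f *: x j) f.
Proof. by case: sx. Qed.

Lemma system_coef j f : mag (xs j f) * ⟦x j⟧ <= 2 * C * ⟦f⟧.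
Proof.
rewrite -nrmZ; have -> : xs j f *: x j =
    \sum_(0 <= i < j.+1) xs i f *: x i - \sum_(0 <= i < j) xs i f *: x i.
  by rewrite big_nat_recr//= [RHS]addrC addKr.
apply: le_trans (ler_nrmB _ _ _) _.
by rewrite -mulrA [leRHS]mulrDl mul1r lerD ?system_partial.
Qed.

Lemma system_neq0 j : x j != 0.
Proof.
apply/eqP => xj; have := system_dual j j; rewrite xj eqxx => /eqP.
by rewrite (lin0 (system_linear j)) eq_sym oner_eq0.
Qed.

Lemma system_blin j : 0 < C -> bounded_linear hK (xs j).
Proof.
move=> C0; split; first exact: system_linear.
have xj0 : 0 < ⟦x j⟧ by rewrite nrm_gt0 system_neq0.
exists (2 * C / ⟦x j⟧) => [|f]; first by rewrite divr_gt0 ?mulr_gt0.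
by rewrite mulrAC ler_pdivlMr// system_coef.
Qed.

Lemma system_comb (D : seq nat) (a : nat -> K) j : uniq D ->
  xs j (\sum_(i <- D) a i *: x i) = if j \in D then a j else 0.
Proof.
move=> uD; rewrite (lin_sumZ (system_linear j)).
under eq_bigr do rewrite system_dual.
case: ifPn => jD; last first.
  rewrite big_seq big1// => i iD; have [ij|_] := eqVneq i j; last by rewrite scaler0.
  by move: jD; rewrite -ij iD.
rewrite (bigD1_seq j)//= eqxx big1 ?addr0 ?[_ *: _]mulr1// => i /negbTE ->.
by rewrite scaler0.
Qed.

Hypothesis C0 : 0 < C.

Lemma system_unique f (a : nat -> K) :
  tends (fun n => \sum_(0 <= j < n) a j *: x j) f -> a = xs ^~ f.
Proof.
move=> h; apply/funext => j.
have := blin_tends (system_blin j C0) h => /(tends_ext (N := j.+1) (v := fun=> a j : K^o)) h2.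
apply: (@tends_unique _ _ hK K^o (fun=> a j)) (h2 _); first exact: tends_cst.
by move=> n jn; rewrite system_comb ?iota_uniq// mem_index_iota/= jn.
Qed.

Lemma schauder_basis_of_system : is_schauder_basis x.
Proof.
move=> f; exists (xs ^~ f); split; first by apply/tendsP; exact: system_tends.
by move=> a /tendsP /system_unique.
Qed.

Lemma coordE f j : coord x f j = xs j f.
Proof.
have h : exists a, [set a | expansion x f a] a.
  by exists (xs ^~ f); apply/tendsP; exact: system_tends.
by have /tendsP/system_unique := xgetPex (fun=> 0) h => /(congr1 (fun g => g j)).
Qed.

Lemma coord_proj_finite (D : seq nat) f : uniq D ->
  coord_proj x [set` D] f = \sum_(j <- D) xs j f *: x j.
Proof.
move=> uD; apply: cvg_lim => //; apply/tendsP.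
pose N := \sum_(j <- D) j.+1.
apply: (tends_ext (N := N)) (tends_cst hK _) => n Nn.
rewrite /series/=; under [RHS]eq_bigr do rewrite coordE.
have -> : \sum_(0 <= j < n) (if j \in [set` D] then xs j f *: x j else 0) =
   \sum_(0 <= j < n | j \in D) xs j f *: x j.
  by rewrite [RHS]big_mkcond/=; apply: eq_bigr => i _; rewrite mem_setE.
rewrite -[RHS]big_filter; apply: perm_big; apply: uniq_perm => //.
  by rewrite filter_uniq// iota_uniq.
move=> i; rewrite mem_filter mem_index_iota/=; case: (boolP (i \in D)) => //= iD.
apply/esym/(leq_trans _ Nn); rewrite /N (bigD1_seq i)//=; exact: leq_addr.
Qed.

Lemma coord_proj_supp (A : set nat) f m : bsupp x f `<=` `I_m ->
  coord_proj x A f = \sum_(0 <= j < m | j \in A) xs j f *: x j.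
Proof.
move=> fm; apply: cvg_lim => //; apply/tendsP.
apply: (tends_ext (N := m)) (tends_cst hK _) => n mn.
rewrite /series/=; under [RHS]eq_bigr do rewrite coordE.
rewrite big_mkcond/= (big_cat_nat _ mn)//= [X in _ + X]big_nat_cond [X in _ + X]big1 ?addr0//.
move=> i /andP[/andP[mi _] _]; case: ifP => // _.
have [->|h] := eqVneq (xs i f) 0; first by rewrite scale0r.
by have := fm i; rewrite /bsupp/= coordE => /(_ h); rewrite ltnNge mi.
Qed.

Lemma system_extension (W : completeNormedModType K) (u : nat -> W) (B : R) :
  0 < B -> (forall (a : nat -> K) n, ⟦\sum_(0 <= j < n) a j *: u j⟧ <=
     B * ⟦\sum_(0 <= j < n) a j *: x j⟧) ->
  exists2 L : X -> W, bounded_linear hK L & forall j, L (x j) = u j.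
Proof.
move=> B0 hB.
have cv f : exists l, tends (fun n => \sum_(0 <= j < n) xs j f *: u j) l.
  apply: tends_complete => eps e0.
  have [N hN] := system_tends f (divr_gt0 e0 (mulr_gt0 (ltr0Sn R 1) B0)).
  exists N => m n Nm mn.
  have split (V : normedModType K) (y : nat -> V) : \sum_(0 <= j < n) xs j f *: y j -
      \sum_(0 <= j < m) xs j f *: y j =
      \sum_(0 <= j < n) (if (m <= j)%N then xs j f else 0) *: y j.
    rewrite [in RHS](big_cat_nat _ mn)//= [in LHS](big_cat_nat _ mn)//= [LHS]addrC addKr.
    rewrite [X in _ = X + _]big_nat_cond [X in _ = X + _]big1 ?add0r; last first.
      by move=> i /andP[/andP[_ im] _]; rewrite leqNgt im scale0r.
    by apply: eq_big_nat => i /andP[-> _].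
  rewrite split; apply: le_lt_trans (hB _ _) _; rewrite -split.
  apply: le_lt_trans (ler_wpM2l (ltW B0) (ler_nrm_tri _ _ f _)) _.
  have := hN _ Nm; have := hN _ (leq_trans Nm mn).
  by rewrite !ltr_pdivlMr ?mulr_gt0// [⟦f - _⟧]nrmC => h1 h2; lra.
have [L hL] := choice cv.
exists L; last first.
  move=> j; apply: tends_unique (hL _) _.
  apply: (tends_ext (N := j.+1)) (tends_cst hK _) => n jn.
  rewrite (bigD1_seq j) ?iota_uniq ?mem_index_iota//= system_dual eqxx scale1r.
  by rewrite big1 ?addr0// => i /negbTE; rewrite system_dual eq_sym => ->; rewrite scale0r.
split; last first.
  exists (B * C); first exact: mulr_gt0.
  move=> f; apply: (tends_le (hL f) (N := 0)) => n _.
  by apply: le_trans (hB _ _) _; rewrite -mulrA ler_pM2l// system_partial.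
move=> c f g; apply: tends_unique (hL _) _.
apply: (tends_ext (N := 0)) (tendsD (tendsZ c (hL f)) (hL g)) => n _.
rewrite scaler_sumr -big_split; apply: eq_bigr => j _ /=.
by rewrite (system_linear j) scalerDl scalerA.
Qed.

Lemma blin_eq_system (W : normedModType K) (f g : X -> W) :
  bounded_linear hK f -> bounded_linear hK g -> (forall j, f (x j) = g (x j)) -> f =1 g.
Proof.
move=> bf bg fg v.
apply: tends_unique (blin_tends bf (system_tends v)) _.
apply: (tends_ext (N := 0)) (blin_tends bg (system_tends v)) => n _.
rewrite (lin_sumZ (proj1 bf)) (lin_sumZ (proj1 bg)).
by apply: eq_bigr => j _; rewrite fg.
Qed.

End SystemToBasis.
End Schauder.

(** * Subsymmetric bases *)

Section Subsymmetric.
Variables (R : realType) (K : numFieldType) (hK : scalar_field R K).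
Local Notation "⟦ v ⟧" := (nrm hK v) (at level 0, v at level 99).
Local Notation emb := (scalar_emb hK).
Local Notation mag := (mag hK).
Local Notation tends := (tends hK).

Definition subsymmetric (S : normedModType K) (e : nat -> S)
    (es : nat -> S -> K^o) :=
  schauder_system hK e es 1 /\
  forall (a : nat -> K) (s : nat -> bool) (phi : nat -> nat) n,
    {homo phi : i j / (i < j)%N} ->
    ⟦\sum_(0 <= j < n) ((-1) ^+ s j * a j) *: e (phi j)⟧ =
    ⟦\sum_(0 <= j < n) a j *: e j⟧.

Lemma sum_seq_nat (V : nmodType) (D : seq nat) n (F : nat -> V) :
  uniq D -> (forall j, j \in D -> (j < n)%N) ->
  \sum_(j <- D) F j = \sum_(0 <= j < n) (if j \in D then F j else 0).
Proof.
move=> uD Dn; rewrite -big_mkcond/= -[RHS]big_filter; apply: perm_big.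
apply: uniq_perm => //; first by rewrite filter_uniq// iota_uniq.
move=> i; rewrite mem_filter mem_index_iota/=.
by case: (boolP (i \in D)) => //= /Dn ->.
Qed.

Lemma seq_nat_bound (D : seq nat) : exists n, forall j, j \in D -> (j < n)%N.
Proof.
exists (\max_(j <- D) j).+1 => j jD; rewrite ltnS.
exact: (@leq_bigmax_seq _ D xpredT id j jD).
Qed.

(** Flipping the signs of the coefficients beyond [n] preserves the norm, and the
    partial sum is half the sum of a vector and its flip: this is why the
    constant is 1. *)
Lemma subsymmetric_of_space (S : completeNormedModType K) (coe : S -> nat -> K)
    (e : nat -> S) : subsymmetric_sequence_space hK coe e ->
  subsymmetric e (fun j f => coe f j : K^o).
Proof.
move=> [[inj lin] dual [_ _] expa sub].
have lcoe j : linear (fun f => coe f j : K^o) by move=> a u v; rewrite lin.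
have spread (a : nat -> K) (s : nat -> bool) (phi : nat -> nat) n :
    {homo phi : i j / (i < j)%N} ->
    ⟦\sum_(0 <= j < n) ((-1) ^+ s j * a j) *: e (phi j)⟧ =
    ⟦\sum_(0 <= j < n) a j *: e j⟧.
  move=> hphi; set f := \sum_(0 <= j < n) a j *: e j.
  have cf j : coe f j = if (j < n)%N then a j else 0.
    rewrite /f (lin_sumZ (lcoe j)); under eq_bigr do rewrite dual.
    case: ltnP => jn; last first.
      rewrite big_nat_cond big1// => i /andP[/andP[_ im] _].
      by rewrite ltn_eqF ?(leq_trans im)// scaler0.
    rewrite (bigD1_seq j) ?iota_uniq ?mem_index_iota//= eqxx big1 ?addr0 ?[_ *: _]mulr1//.
    by move=> i /negbTE ->; rewrite scaler0.
  have [g [/(tendsP hK) hg <-]] := sub f s phi hphi; congr nrm.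
  apply: (tends_unique (tends_ext (N := n) _ (tends_cst hK _)) hg) => m nm.
  rewrite /series/= (big_cat_nat _ nm)//= [X in _ + X]big_nat_cond [X in _ + X]big1 ?addr0.
    by apply: eq_big_nat => i /andP[_ im]; rewrite cf im.
  by move=> i /andP[/andP[ni _] _]; rewrite cf ltnNge ni mulr0 scale0r.
split => //; split => //.
- move=> n f; rewrite mul1r; apply: (tends_norm (u := series (fun j => coe f j *: e j))).
    exact/tendsP/expa.
  move=> N; exists (maxn N n); first exact: leq_maxl.
  rewrite /series/=; set m := maxn N n; have nm : (n <= m)%N := leq_maxr _ _.
  have := spread (coe f) (fun j => n <= j)%N id m (fun _ _ => id).
  set P := \sum_(0 <= j < m) coe f j *: e j; set Q := \sum_(0 <= j < m) _.
  have PQ : P + Q = 2%:R *: \sum_(0 <= j < n) coe f j *: e j.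
    rewrite /P /Q !(big_cat_nat (leq0n n) nm)//= addrACA scaler_nat mulr2n.
    rewrite -[X in _ + X]big_split [X in _ + X]big_nat_cond [X in _ + X]big1 ?addr0; last first.
      by move=> i /andP[/andP[ni _] _]; rewrite /= ni/= mulN1r scaleNr subrr.
    by congr (_ + _); apply: eq_big_nat => i /andP[_ im]; rewrite leqNgt im/= mul1r.
  move=> QP; have := ler_nrmD hK P Q; rewrite PQ QP nrmZ -(scalar_embn hK) mag_emb.
  by rewrite ger0_norm// => h; lra.
- by move=> f; apply/tendsP/expa.
Qed.

Section Theory.
Variables (S : completeNormedModType K) (e : nat -> S) (es : nat -> S -> K^o).
Hypothesis hS : subsymmetric e es.

Let sysS : schauder_system hK e es 1 := proj1 hS.

(** Only the order of the indices matters, so every sorted list of indices can be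
    compared with an initial segment. *)
Lemma subsym_nth (D : seq nat) (c : nat -> K) : sorted ltn D ->
  ⟦\sum_(0 <= i < size D) c i *: e (nth 0%N D i)⟧ =
  ⟦\sum_(0 <= i < size D) c i *: e i⟧.
Proof.
move=> sD; have [M hM] := seq_nat_bound D.
pose phi i := if (i < size D)%N then nth 0%N D i else (M + i)%N.
rewrite -(proj2 hS c (fun=> false) phi).
  by congr nrm; apply: eq_big_nat => i /andP[_ iD]; rewrite /phi iD mul1r.
move=> i j ij; rewrite /phi; case: (ltnP j (size D)) => jD.
  by rewrite (ltn_trans ij jD) (sorted_ltn_nth ltn_trans)// inE (ltn_trans ij).
case: (ltnP i (size D)) => iD; last by rewrite ltn_add2l.
by rewrite (leq_trans (hM _ (mem_nth _ iD)))// leq_addr.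
Qed.

Lemma subsym_spread (D : seq nat) (a : nat -> K) (phi : nat -> nat) :
  sorted ltn D -> sorted ltn (map phi D) ->
  ⟦\sum_(j <- D) a j *: e (phi j)⟧ = ⟦\sum_(j <- D) a j *: e j⟧.
Proof.
move=> sD sphi; rewrite [X in ⟦X⟧ = _](big_nth 0%N) [X in _ = ⟦X⟧](big_nth 0%N).
rewrite (subsym_nth (fun i => a (nth 0%N D i)) sD).
rewrite -(size_map phi D) -(subsym_nth (fun i => a (nth 0%N D i)) sphi).
congr nrm; rewrite size_map; apply: eq_big_nat => i /andP[_ iD].
by rewrite (nth_map 0%N).
Qed.

Lemma subsym_sign (D : seq nat) (a : nat -> K) (s : nat -> bool) : uniq D ->
  ⟦\sum_(j <- D) ((-1) ^+ s j * a j) *: e j⟧ = ⟦\sum_(j <- D) a j *: e j⟧.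
Proof.
move=> uD; have [n hn] := seq_nat_bound D; rewrite !(sum_seq_nat _ uD hn).
have := proj2 hS (fun j => if j \in D then a j else 0) s id n (fun _ _ => id).
under eq_bigr do rewrite (fun_if (fun x => (_ * x) *: _)) mulr0 scale0r.
by move=> ->; congr nrm; apply: eq_bigr => j _; case: ifP => //; rewrite scale0r.
Qed.

(** Real multipliers in [-1, 1] are averages of signs, one coordinate at a time. *)
Lemma subsym_multiplier (D : seq nat) (a : nat -> K) (t : nat -> R) : uniq D ->
  (forall j, `|t j| <= 1) ->
  ⟦\sum_(j <- D) (emb (t j) * a j) *: e j⟧ <= ⟦\sum_(j <- D) a j *: e j⟧.
Proof.
move=> uD ht; pose T (E : seq nat) j := if j \in E then t j else 1.
suff h (E : seq nat) : ⟦\sum_(j <- D) (emb (T E j) * a j) *: e j⟧ <= ⟦\sum_(j <- D) a j *: e j⟧.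
  apply: le_trans (h D); apply: le_of_eq; congr nrm.
  by apply: eq_big_seq => j jD; rewrite /T jD.
elim: E => [|k E IH].
  apply: le_of_eq; congr nrm.
  by apply: eq_bigr => j _; rewrite /T in_nil scalar_emb1 mul1r.
pose u := (1 + t k) / 2; pose v := (1 - t k) / 2.
have uv1 : u + v = 1 by rewrite /u /v; field.
have uvt : u - v = t k by rewrite /u /v; field.
have := ht k; rewrite ler_norml => /andP[tk1 tk2].
have u0 : 0 <= u by rewrite /u; lra.
have v0 : 0 <= v by rewrite /v; lra.
have [kE|kE] := boolP (k \in E).
  apply: le_trans IH; apply: le_of_eq; congr nrm.
  apply: eq_bigr => j _; rewrite /T inE; case: eqP => [->|//]; by rewrite kE.
have -> : \sum_(j <- D) (emb (T (k :: E) j) * a j) *: e j =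
   emb u *: (\sum_(j <- D) (emb (T E j) * a j) *: e j) +
   emb v *: (\sum_(j <- D) ((-1) ^+ (j == k) * (emb (T E j) * a j)) *: e j).
  rewrite !scaler_sumr -big_split; apply: eq_bigr => j _ /=.
  rewrite !scalerA -scalerDl; congr (_ *: _); rewrite /T inE; case: eqP => [->|_] /=.
    rewrite (negbTE kE) scalar_emb1 mul1r mulN1r mulrN -mulrBl -uvt.
    by rewrite scalar_embD scalar_embN.
  by rewrite mul1r -mulrDl -scalar_embD uv1 scalar_emb1 mul1r.
apply: le_trans (ler_nrmD _ _ _) _; rewrite !nrmZ subsym_sign// -mulrDl !mag_emb.
by rewrite !ger0_norm// uv1 mul1r.
Qed.

(** The quotients [a j / b j] split into real multipliers, each of norm at most 1;
    the two parts account for the factor 2. *)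
Lemma subsym_lattice (D : seq nat) (a b : nat -> K) : uniq D ->
  (forall j, j \in D -> mag (a j) <= mag (b j)) ->
  ⟦\sum_(j <- D) a j *: e j⟧ <= 2 * ⟦\sum_(j <- D) b j *: e j⟧.
Proof.
move=> uD hab; have [w hw hsplit] := scalar_split hK.
have [u /choice[v huv]] := choice (fun j => hsplit (if j \in D then a j / b j else 0)).
have q1 j : mag (if j \in D then a j / b j else 0) <= 1.
  case: ifP => [/hab h|_]; last by rewrite mag0.
  have [b0|b0] := eqVneq (b j) 0; first by rewrite b0 invr0 mulr0 mag0.
  have mb : 0 < mag (b j) by rewrite lt_def mag_ge0 mag_eq0 b0.
  by rewrite -(ler_pM2r mb) mul1r -magM divfK.
have -> : \sum_(j <- D) a j *: e j =
    \sum_(j <- D) (emb (u j) * b j) *: e j + w *: \sum_(j <- D) (emb (v j) * b j) *: e j.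
  rewrite scaler_sumr -big_split; apply: eq_big_seq => j jD /=.
  rewrite scalerA -scalerDl mulrA -mulrDl; have [<- _ _] := huv j; rewrite jD.
  have [b0|b0] := eqVneq (b j) 0; last by rewrite divfK.
  have := hab j jD; rewrite b0 mag0 mulr0 le_eqVlt ltNge mag_ge0 orbF mag_eq0.
  by move=> /eqP ->.
apply: le_trans (ler_nrmD _ _ _) _; rewrite nrmZ mulrDl !mul1r; apply: lerD.
  by apply: subsym_multiplier => // j; have [_ h _] := huv j; apply: le_trans h _.
apply: (le_trans (y := 1 * ⟦\sum_(j <- D) (emb (v j) * b j) *: e j⟧)).
  by rewrite ler_wpM2r ?nrm_ge0.
rewrite mul1r; apply: subsym_multiplier => // j.
by have [_ _ h] := huv j; apply: le_trans h _.
Qed.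

Lemma subsym_restrict (D : seq nat) (P : pred nat) (a : nat -> K) : uniq D ->
  ⟦\sum_(j <- D | P j) a j *: e j⟧ <= ⟦\sum_(j <- D) a j *: e j⟧.
Proof.
move=> uD.
apply: le_trans (@subsym_multiplier D a (fun j => (P j)%:R) uD _); last first.
  by move=> j; case: (P j); rewrite /= ?normr1 ?normr0.
apply: le_of_eq; congr nrm.
rewrite big_mkcond; apply: eq_bigr => j _; case: (P j).
  by rewrite /= scalar_emb1 mul1r.
by rewrite /= scalar_emb0 mul0r scale0r.
Qed.

Lemma subsym_sub (D E : seq nat) (a : nat -> K) : uniq D -> uniq E ->
  {subset D <= E} -> ⟦\sum_(j <- D) a j *: e j⟧ <= ⟦\sum_(j <- E) a j *: e j⟧.
Proof.
move=> uD uE DE; apply: le_trans (@subsym_restrict E (mem D) a uE).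
apply: le_of_eq; congr nrm.
rewrite -[RHS]big_filter; apply: perm_big; apply: uniq_perm => //.
  exact: filter_uniq.
by move=> j; rewrite mem_filter/=; case: (boolP (j \in D)) => //= /DE ->.
Qed.

Lemma subsym_coef (D : seq nat) f : uniq D ->
  ⟦\sum_(j <- D) es j f *: e j⟧ <= ⟦f⟧.
Proof.
move=> uD; have [n hn] := seq_nat_bound D.
rewrite -[leRHS]mul1r; apply: le_trans (system_partial sysS n f).
by apply: subsym_sub => //; [exact: iota_uniq|move=> j /hn; rewrite mem_index_iota].
Qed.

(** ** The norm of a sum of unit vectors *)

Definition unit_fund m := ⟦\sum_(0 <= j < m) e j⟧.

Local Notation lam := unit_fund.

Lemma lam_size (D : seq nat) : uniq D -> ⟦\sum_(j <- D) e j⟧ = lam (size D).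
Proof.
move=> uD; have pD : perm_eq D (sort leq D) by rewrite perm_sym perm_sort.
rewrite (perm_big _ pD)/= (perm_size pD).
have sD : sorted ltn (sort leq D).
  by rewrite ltn_sorted_uniq_leq sort_uniq uD sort_sorted//; exact: leq_total.
have := subsym_nth (fun=> 1) sD; rewrite -(big_nth 0%N xpredT (fun i => 1 *: e i)).
rewrite /unit_fund; under eq_bigr do rewrite scale1r.
by move=> ->; congr nrm; apply: eq_bigr => i _; rewrite scale1r.
Qed.

Lemma e_gt0 j : 0 < ⟦e j⟧.
Proof. by rewrite nrm_gt0 (system_neq0 sysS). Qed.

Lemma lam_le m n : (m <= n)%N -> lam m <= lam n.
Proof.
move=> mn; have := @subsym_sub (index_iota 0 m) (index_iota 0 n) (fun=> 1).
rewrite /unit_fund; under eq_bigr do rewrite scale1r.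
under [X in (_ -> _ -> _ -> _ <= ⟦X⟧) -> _]eq_bigr do rewrite scale1r.
apply; rewrite ?iota_uniq// => j; rewrite !mem_index_iota/=.
by move=> /leq_trans; apply.
Qed.

Lemma lam_gt0 m : (0 < m)%N -> 0 < lam m.
Proof.
move=> m0; apply: lt_le_trans (lam_le m0).
by rewrite /unit_fund big_nat1 e_gt0.
Qed.

Lemma lam_ge0 m : 0 <= lam m. Proof. exact: nrm_ge0. Qed.

Lemma lamD m n : lam (m + n) <= lam m + lam n.
Proof.
rewrite /unit_fund (big_cat_nat (leq0n m) (leq_addr n m))/=.
apply: le_trans (ler_nrmD _ _ _) _; rewrite lerD2l lam_size ?iota_uniq//.
by rewrite size_iota addKn.
Qed.

Lemma lamM b m : lam (b * m) <= b%:R * lam m.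
Proof.
elim: b => [|b IH]; first by rewrite mul0n mul0r /unit_fund big_geq// nrm0.
by rewrite mulSn mulrS mulrDl mul1r (le_trans (lamD _ _))// lerD2l.
Qed.

Lemma lam_inv m n : lam m < lam n -> (m < n)%N.
Proof. by move=> h; rewrite ltnNge; apply/negP => /lam_le; rewrite leNgt h. Qed.

Lemma lam_lower (D : seq nat) (a : nat -> K) (t : R) : uniq D -> 0 <= t ->
  (forall j, j \in D -> t <= mag (a j)) ->
  t * lam (size D) <= 2 * ⟦\sum_(j <- D) a j *: e j⟧.
Proof.
move=> uD t0 h; rewrite -lam_size// -[t]ger0_norm// -(mag_emb hK) -nrmZ scaler_sumr.
by apply: subsym_lattice => // j /h; rewrite mag_emb ger0_norm.
Qed.

Lemma lam_upper (D : seq nat) (a : nat -> K) (t : R) : uniq D -> 0 <= t ->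
  (forall j, j \in D -> mag (a j) <= t) ->
  ⟦\sum_(j <- D) a j *: e j⟧ <= 2 * (t * lam (size D)).
Proof.
move=> uD t0 h; rewrite -lam_size// -[t]ger0_norm// -(mag_emb hK) -nrmZ scaler_sumr.
by apply: subsym_lattice => // j /h; rewrite mag_emb ger0_norm.
Qed.

End Theory.
End Subsymmetric.

(** * Partitions of the index set into consecutive blocks *)

Section Blocks.
Local Open Scope nat_scope.
Variable r : nat -> nat.
Hypothesis r_gt0 : forall n, 0 < r n.

Definition bstart n := \sum_(0 <= i < n) r i.

Definition bidx j := find (fun n => j < bstart n.+1) (iota 0 j.+1).

Definition block n := index_iota (bstart n) (bstart n.+1).

Lemma bstart0 : bstart 0 = 0. Proof. by rewrite /bstart big_geq. Qed.

Lemma bstartS n : bstart n.+1 = bstart n + r n.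
Proof. by rewrite /bstart big_nat_recr. Qed.

Lemma bstart_le m n : m <= n -> bstart m <= bstart n.
Proof.
elim: n => [|n IH]; first by rewrite leqn0 => /eqP->.
rewrite leq_eqVlt => /orP[/eqP->//|/IH h].
by rewrite bstartS (leq_trans h)// leq_addr.
Qed.

Lemma bstart_ge n : n <= bstart n.
Proof. by elim: n => // n IH; rewrite bstartS -addn1 leq_add// r_gt0. Qed.

Lemma bidxP j : bstart (bidx j) <= j < bstart (bidx j).+1.
Proof.
pose p n := j < bstart n.+1.
have hp : has p (iota 0 j.+1).
  apply/hasP; exists j; first by rewrite mem_iota ltnSn.
  by rewrite /p (leq_trans _ (bstart_ge _)).
have := nth_find 0 hp; have := hp; rewrite has_find size_iota => lt.
rewrite -/(bidx j) nth_iota// add0n /p => ->; rewrite andbT.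
case E : (bidx j) => [|k]; first by rewrite bstart0.
have kj : k < find p (iota 0 j.+1) by rewrite -/(bidx j) E.
have := before_find 0 kj; rewrite nth_iota ?add0n; last exact: ltn_trans lt.
by rewrite /p => /negbT; rewrite -leqNgt.
Qed.

Lemma bidx_eq n j : bstart n <= j < bstart n.+1 -> bidx j = n.
Proof.
move=> /andP[h1 h2]; have /andP[h3 h4] := bidxP j.
apply/eqP; rewrite eqn_leq; apply/andP; split; rewrite leqNgt; apply/negP => lt.
  by have := bstart_le lt; rewrite leqNgt (leq_ltn_trans h3 h2).
by have := bstart_le lt; rewrite leqNgt (leq_ltn_trans h1 h4).
Qed.

Lemma bidx_lt j n : (bidx j < n) = (j < bstart n).
Proof.
have /andP[h1 h2] := bidxP j; apply/idP/idP => h.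
  exact: leq_trans h2 (bstart_le h).
by rewrite ltnNge; apply/negP => /bstart_le; rewrite leqNgt (leq_ltn_trans h1 h).
Qed.

Lemma bidx_le i j : i <= j -> bidx i <= bidx j.
Proof.
move=> ij; rewrite -ltnS bidx_lt (leq_ltn_trans ij)//.
by have /andP[] := bidxP j.
Qed.

Lemma bidx_leq_self j : bidx j <= j.
Proof. by rewrite -ltnS bidx_lt (leq_trans (ltnSn j) (bstart_ge _)). Qed.

Lemma mem_block n j : (j \in block n) = (bidx j == n).
Proof.
rewrite mem_index_iota; apply/idP/eqP => [/bidx_eq//|<-]; exact: bidxP.
Qed.

Lemma block_uniq n : uniq (block n). Proof. exact: iota_uniq. Qed.

Lemma size_block n : size (block n) = r n.
Proof. by rewrite size_iota bstartS addKn. Qed.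

Lemma bidxD n i : i < r n -> bidx (bstart n + i) = n.
Proof. by move=> ir; apply: bidx_eq; rewrite leq_addr bstartS ltn_add2l. Qed.

Lemma offset_lt j : j - bstart (bidx j) < r (bidx j).
Proof.
by have /andP[h1] := bidxP j; rewrite bstartS => h2; rewrite ltn_subLR.
Qed.

Lemma offsetK j : bstart (bidx j) + (j - bstart (bidx j)) = j.
Proof. by rewrite subnKC//; have /andP[] := bidxP j. Qed.

Lemma sum_block (V : nmodType) n (F : nat -> V) :
  (\sum_(j <- block n) F j = \sum_(0 <= i < r n) F (bstart n + i)%N)%R.
Proof.
rewrite /block -{1}[bstart n]add0n big_addn bstartS addKn.
by apply: eq_bigr => i _; rewrite addnC.
Qed.

Lemma sum_bstart (V : nmodType) N (F : nat -> V) :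
  (\sum_(0 <= j < bstart N) F j = \sum_(0 <= n < N) \sum_(j <- block n) F j)%R.
Proof.
elim: N => [|N IH]; first by rewrite bstart0 !big_geq.
rewrite big_nat_recr//= -IH (big_cat_nat (leq0n (bstart N)))//=.
by rewrite bstart_le.
Qed.

End Blocks.

(** Increasing on the blocks where [kappa] is, hence compatible with the norm of a
    subsymmetric space. *)
Definition relocate (r r' : nat -> nat) (kappa : nat -> nat) j : nat :=
  (bstart r' (kappa (bidx r j)) + (j - bstart r (bidx r j)))%N.

Section Relocate.
Local Open Scope nat_scope.
Variables r r' : nat -> nat.
Hypotheses (r_gt0 : forall n, 0 < r n) (r'_gt0 : forall n, 0 < r' n).
Variables (P : pred nat) (kappa : nat -> nat).
Hypothesis kappa_lt : {in P &, {homo kappa : m n / m < n}}.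
Hypothesis kappa_size : {in P, forall n, r' (kappa n) = r n}.

Lemma bidx_relocate j : P (bidx r j) -> bidx r' (relocate r r' kappa j) = kappa (bidx r j).
Proof. by move=> Pj; apply: bidxD => //; rewrite kappa_size// offset_lt. Qed.

Lemma relocateD n i : i < r n -> relocate r r' kappa (bstart r n + i) = bstart r' (kappa n) + i.
Proof. by move=> ir; rewrite /relocate bidxD// addKn. Qed.

Lemma relocate_lt i j : P (bidx r i) -> P (bidx r j) -> i < j ->
  relocate r r' kappa i < relocate r r' kappa j.
Proof.
move=> Pi Pj ij; have := bidx_le r_gt0 (ltnW ij).
rewrite leq_eqVlt => /orP[/eqP E|lt].
  by rewrite /relocate E ltn_add2l ltn_sub2r// -E; have := bidxP r_gt0 j;
     rewrite -E => /andP[h _]; apply: leq_ltn_trans ij; have /andP[] := bidxP r_gt0 i.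
have /andP[h1 h2] := bidxP r'_gt0 (relocate r r' kappa i).
have /andP[h3 h4] := bidxP r'_gt0 (relocate r r' kappa j).
apply: leq_trans h2 (leq_trans _ h3); apply: bstart_le => //.
by rewrite !bidx_relocate// kappa_lt.
Qed.

End Relocate.

Lemma relocate_comp (r r' r'' : nat -> nat) (kappa kappa' : nat -> nat) j :
  (forall n, 0 < r n)%N -> (forall n, 0 < r' n)%N ->
  r' (kappa (bidx r j)) = r (bidx r j) ->
  relocate r' r'' kappa' (relocate r r' kappa j) =
  relocate r r'' (kappa' \o kappa) j.
Proof.
by move=> h h' E; rewrite [X in relocate _ _ _ X]/relocate relocateD// E offset_lt.
Qed.

Lemma relocate_id (r : nat -> nat) (kappa : nat -> nat) j : (forall n, 0 < r n)%N ->
  kappa (bidx r j) = bidx r j -> relocate r r kappa j = j.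
Proof. by move=> h E; rewrite /relocate E offsetK. Qed.

(** * Averaging over blocks *)

Section Averaging.
Variables (R : realType) (K : numFieldType) (hK : scalar_field R K).
Local Notation "⟦ v ⟧" := (nrm hK v) (at level 0, v at level 99).
Local Notation emb := (scalar_emb hK).
Local Notation mag := (mag hK).
Variables (S : completeNormedModType K) (e : nat -> S) (es : nat -> S -> K^o).
Hypothesis hS : subsymmetric hK e es.
Let sysS : schauder_system hK e es 1 := proj1 hS.
Local Notation lam := (unit_fund hK e).

Lemma subsym_two_pieces (D : seq nat) (P : pred nat) (a : nat -> K) (phi : nat -> nat) :
  sorted ltn D ->
  {in [pred j in D | P j] &, {homo phi : i j / (i < j)%N}} ->
  {in [pred j in D | ~~ P j] &, {homo phi : i j / (i < j)%N}} ->
  ⟦\sum_(j <- D) a j *: e (phi j)⟧ <= 2 * ⟦\sum_(j <- D) a j *: e j⟧.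
Proof.
move=> sD h1 h2.
have uD : uniq D by move: sD; rewrite ltn_sorted_uniq_leq => /andP[].
have piece (Q : pred nat) : {in [pred j in D | Q j] &, {homo phi : i j / (i < j)%N}} ->
    ⟦\sum_(j <- D | Q j) a j *: e (phi j)⟧ <= ⟦\sum_(j <- D) a j *: e j⟧.
  move=> hQ; apply: le_trans (subsym_restrict hS Q a uD).
  rewrite -big_filter -[X in _ <= ⟦X⟧]big_filter (subsym_spread hS)//.
    by apply: sorted_filter => //; exact: ltn_trans.
  apply: (homo_sorted_in hQ); first by apply/allP => j; rewrite mem_filter inE andbC.
  by apply: sorted_filter => //; exact: ltn_trans.
rewrite (bigID P)/= mulrDl mul1r; apply: le_trans (ler_nrmD _ _ _) _.
exact: lerD (piece _ h1) (piece (predC P) h2).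
Qed.

Lemma sum_mod_shift (V : nmodType) (G : nat -> V) r i : (0 < r)%N ->
  \sum_(0 <= k < r) G ((i + k) %% r)%N = \sum_(0 <= k < r) G k.
Proof.
case: r => // r _; elim: i => [|i <-].
  by apply: eq_big_nat => k /andP[_ kr]; rewrite add0n modn_small.
rewrite big_nat_recr//= [RHS]big_nat_recl//= [RHS]addrC; congr (_ + _).
  by apply: eq_bigr => k _; rewrite addnS.
by rewrite addSnnS modnDr addn0.
Qed.

Lemma sum_mod_period (V : nmodType) (G : nat -> V) r i q : (0 < r)%N ->
  \sum_(0 <= k < q * r) G ((i + k) %% r)%N = (\sum_(0 <= k < r) G k) *+ q.
Proof.
move=> r0; elim: q => [|q IH]; first by rewrite mul0n big_geq.
rewrite mulSn (big_cat_nat (leq0n r) (leq_addr _ _))/= sum_mod_shift// mulrS; congr (_ + _).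
rewrite -IH -{1}[r]add0n big_addn addKn; apply: eq_bigr => k _.
by rewrite addnA modnDr.
Qed.

Variable r : nat -> nat.
Hypothesis r_gt0 : forall n, (0 < r n)%N.

Definition block_avg j : S :=
  emb (r (bidx r j))%:R^-1 *: \sum_(i <- block r (bidx r j)) e i.

Definition cyc k j := (bstart r (bidx r j) +
  (j - bstart r (bidx r j) + k) %% r (bidx r j))%N.

Lemma bidx_cyc k j : bidx r (cyc k j) = bidx r j.
Proof. by apply: bidxD => //; rewrite ltn_mod. Qed.

Lemma cyc_lt k i j : (i < j)%N ->
  (i - bstart r (bidx r i) + k %% r (bidx r i) < r (bidx r i))%N =
  (j - bstart r (bidx r j) + k %% r (bidx r j) < r (bidx r j))%N ->
  (cyc k i < cyc k j)%N.
Proof.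
move=> ij; have := bidx_le r_gt0 (ltnW ij).
rewrite leq_eqVlt => /orP[/eqP E|lt _].
  rewrite /cyc -E ltn_add2l -!(modnDmr _ k).
  have := offset_lt r_gt0 j; have := offset_lt r_gt0 i; rewrite -E.
  have := ltn_mod k (r (bidx r i)); rewrite r_gt0.
  have /andP[+ _] := bidxP r_gt0 i.
  set b := bstart _ _; set m := r _; set t := (k %% m)%N => h1 ht h2 h3 h4.
  have h5 : (i - b < j - b)%N by rewrite ltn_sub2r// (leq_ltn_trans h1).
  move: h4; case: (ltnP (i - b + t) m) => h6 /esym h7.
    by rewrite !modn_small// ltn_add2r.
  have md (u : nat) : (u < m)%N -> (m <= u + t)%N -> ((u + t) %% m = u + t - m)%N.
    by move=> um mu; rewrite -{1}(subnK mu) modnDr modn_small//; lia.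
  by rewrite !md//; lia.
have /andP[_ h2] := bidxP r_gt0 (cyc k i).
have /andP[h3 _] := bidxP r_gt0 (cyc k j).
apply: leq_trans h2 (leq_trans _ h3); apply: bstart_le.
by rewrite !bidx_cyc.
Qed.

(** Averaging over a block is the mean of the cyclic shifts of the block, and
    each shift is increasing on the two pieces into which it cuts the block.
    Running the shift over a common multiple of the lengths averages over all
    blocks at once. *)
Lemma block_avg_bound (a : nat -> K) n :
  ⟦\sum_(0 <= j < n) a j *: block_avg j⟧ <= 2 * ⟦\sum_(0 <= j < n) a j *: e j⟧.
Proof.
(* A common multiple of the lengths of all blocks that meet [0, n). *)
pose L := (\prod_(0 <= m < n) r m)%N.
have L0 : (0 < L)%N by rewrite /L; apply: prodn_gt0.
have dv j : (j < n)%N -> (r (bidx r j) %| L)%N.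
  move=> jn; rewrite /L (bigD1_seq (bidx r j)) ?iota_uniq ?dvdn_mulr//=.
  by rewrite mem_index_iota (leq_ltn_trans (bidx_leq_self r_gt0 j)).
have E : emb L%:R *: (\sum_(0 <= j < n) a j *: block_avg j) =
    \sum_(0 <= k < L) \sum_(0 <= j < n) a j *: e (cyc k j).
  rewrite exchange_big scaler_sumr /=; apply: eq_big_nat => j /andP[_ jn].
  rewrite -scaler_sumr scalerA mulrC -scalerA; congr (_ *: _).
  rewrite /block_avg scalerA -scalar_embM sum_block.
  have /dvdnP[q Lq] := dv j jn.
  have -> : \sum_(0 <= k < L) e (cyc k j) =
      (\sum_(0 <= i < r (bidx r j)) e (bstart r (bidx r j) + i)%N) *+ q.
    by rewrite Lq -(sum_mod_period _ (j - bstart r (bidx r j)) _ (r_gt0 _)).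
  rewrite Lq natrM mulfK; last by rewrite pnatr_eq0 -lt0n.
  by rewrite scalar_embn scaler_nat.
have L0' : 0 < (L%:R : R) by rewrite ltr0n.
rewrite -(ler_pM2l L0') -[L%:R in leLHS](@ger0_norm R)// -(mag_emb hK) -nrmZ E.
apply: le_trans (ler_nrm_sum _ _ _ _) _.
apply: (le_trans (y := \sum_(0 <= k < L) (2 * ⟦\sum_(0 <= j < n) a j *: e j⟧))).
  apply: ler_sum => k _.
  apply: (@subsym_two_pieces _ (fun j => j - bstart r (bidx r j) + k %% r (bidx r j) < r (bidx r j))%N).
  - exact: iota_ltn_sorted.
  - move=> i j /= ; rewrite !inE => /andP[_ hi] /andP[_ hj] ij; apply: cyc_lt => //.
    by rewrite hi hj.
  - move=> i j /= ; rewrite !inE => /andP[_ hi] /andP[_ hj] ij; apply: cyc_lt => //.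
    by rewrite (negbTE hi) (negbTE hj).
by rewrite sumr_const_nat subn0 -[leLHS]mulr_natl.
Qed.

End Averaging.

Section AveragingOperators.
Variables (R : realType) (K : numFieldType) (hK : scalar_field R K).
Local Notation "⟦ v ⟧" := (nrm hK v) (at level 0, v at level 99).
Local Notation emb := (scalar_emb hK).
Local Notation mag := (mag hK).
Variables (S : completeNormedModType K) (e : nat -> S) (es : nat -> S -> K^o).
Hypothesis hS : subsymmetric hK e es.
Let sysS : schauder_system hK e es 1 := proj1 hS.
Local Notation lam := (unit_fund hK e).

(** The case of a single block of length [M]: in a subsymmetric space the
    l_1-norm of [M] coefficients is dominated as if they were all equal. *)
Lemma sum_mag_le (D : seq nat) (a : nat -> K) M : uniq D -> (size D <= M)%N ->
  (0 < M)%N ->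
  (\sum_(j <- D) mag (a j)) * (lam M / M%:R) <= 4 * ⟦\sum_(j <- D) a j *: e j⟧.
Proof.
move=> uD DM M0.
have pD : perm_eq D (sort leq D) by rewrite perm_sym perm_sort.
have sD : sorted ltn (sort leq D).
  by rewrite ltn_sorted_uniq_leq sort_uniq uD sort_sorted//; exact: leq_total.
have : ⟦\sum_(j <- D) emb (mag (a j)) *: e j⟧ <= 2 * ⟦\sum_(j <- D) a j *: e j⟧.
  by apply: (subsym_lattice hS) => // j _; rewrite mag_emb ger0_norm ?mag_ge0.
rewrite !(perm_big _ pD)/=; rewrite (perm_size pD) in DM.
move: (sort leq D) sD DM => {uD pD} D' sD DM h.
have {h} h : 2 * ⟦\sum_(j <- D') emb (mag (a j)) *: e j⟧ <= 4 * ⟦\sum_(j <- D') a j *: e j⟧.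
  lra.
apply: le_trans h; rewrite [X in _ <= 2 * ⟦X⟧](big_nth 0%N) [X in X * _](big_nth 0%N).
rewrite (subsym_nth hS (fun i => emb (mag (a (nth 0%N D' i)))) sD).
pose c i := emb (mag (a (nth 0%N D' i))).
apply: le_trans (block_avg_bound hS (r := fun=> M) (fun=> M0) c (size D')).
have -> : \sum_(0 <= i < size D') c i *: block_avg hK e (fun=> M) i =
    (emb ((\sum_(0 <= i < size D') mag (a (nth 0%N D' i))) / M%:R)) *: \sum_(0 <= i < M) e i.
  rewrite scalar_embM (big_morph _ (scalar_embD hK) (scalar_emb0 hK)) mulr_suml scaler_suml.
  apply: eq_big_nat => i /andP[_ iD]; rewrite /block_avg.
  have -> : bidx (fun=> M) i = 0%N.
    apply: bidx_eq => //; rewrite bstartS bstart0 add0n leq0n/=; exact: leq_trans DM.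
  by rewrite /block bstartS bstart0 add0n scalerA.
rewrite nrmZ mag_emb ger0_norm; last by rewrite divr_ge0// sumr_ge0// => i _; exact: mag_ge0.
by rewrite /unit_fund mulrAC mulrA.
Qed.

Definition mean_zero (r : nat -> nat) (q : S) :=
  forall n, \sum_(j <- block r n) es j q = 0.

Section OnePartition.
Variable r : nat -> nat.
Hypothesis r_gt0 : forall n, (0 < r n)%N.

Lemma averaging_operator : exists P : S -> S,
  [/\ bounded_linear hK P, forall j, P (e j) = block_avg hK e r j,
      forall f, P (P f) = P f & forall f, P f = 0 <-> mean_zero r f].
Proof.
have [P bP Pe] := system_extension sysS ltr01 (ltr0Sn R 1) (block_avg_bound hS r_gt0).
have Pblock n : P (\sum_(i <- block r n) e i) = \sum_(i <- block r n) e i.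
  rewrite (lin_sum (proj1 bP)).
  have -> : \sum_(i <- block r n) P (e i) =
      \sum_(i <- block r n) (emb (r n)%:R^-1 *: \sum_(i <- block r n) e i).
    by apply: eq_big_seq => i; rewrite (mem_block r_gt0) Pe /block_avg => /eqP ->.
  rewrite big_const_seq count_predT size_block iter_addr_0 -scaler_nat scalerA.
  rewrite -(scalar_embn hK) -scalar_embM mulfV ?scalar_emb1 ?scale1r//.
  by rewrite pnatr_eq0 -lt0n.
have coefP j f : es j (P f) = emb (r (bidx r j))%:R^-1 * \sum_(i <- block r (bidx r j)) es i f.
  have lr : bounded_linear hK (fun f => \sum_(i <- block r (bidx r j)) es i f : K^o).
    elim: (block r (bidx r j)) => [|i D IH].
      split; first by move=> c u v; rewrite !big_nil scaler0 addr0.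
      by exists 1 => // v; rewrite big_nil nrm0 mul1r nrm_ge0.
    rewrite (_ : (fun _ => _) = fun g => es i g + \sum_(i <- D) es i g); last first.
      by apply/funext => g; rewrite big_cons.
    by apply: blin_add => //; apply: (system_blin sysS).
  have lz : bounded_linear hK (fun u : K^o => emb (r (bidx r j))%:R^-1 *: u).
    split; first by move=> c u v; rewrite scalerDr !scalerA mulrC.
    exists (mag (emb (r (bidx r j))%:R^-1)) => [|v]; last by rewrite nrmZ.
    by rewrite mag_emb normr_gt0 invr_neq0// pnatr_eq0 -lt0n.
  move: f; apply: (blin_eq_system sysS (blin_comp (system_blin sysS j ltr01) bP) (blin_comp lz lr)) => i.
  rewrite Pe /block_avg (linZ (system_linear sysS j)).
  have -> : es j (\sum_(i <- block r (bidx r i)) e i) = (bidx r j == bidx r i)%:R.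
    have := system_comb sysS (fun=> 1) j (block_uniq r (bidx r i)).
    by under eq_bigr do rewrite scale1r; move=> ->; rewrite (mem_block r_gt0); case: eqP.
  have -> : \sum_(k <- block r (bidx r j)) es k (e i) = (bidx r j == bidx r i)%:R.
    under eq_bigr do rewrite (system_dual sysS).
    have [ij|ij] := eqVneq (bidx r j) (bidx r i).
      rewrite (bigD1_seq i) ?block_uniq ?(mem_block r_gt0) ?ij//= eqxx big1 ?addr0//.
      by move=> k; rewrite eq_sym => /negbTE ->.
    rewrite big_seq big1// => k; rewrite (mem_block r_gt0) => /eqP kj.
    by case: eqP => // ik; move: ij; rewrite -kj ik eqxx.
  by have [->//|_] := eqVneq (bidx r j) (bidx r i); rewrite !scaler0.
exists P; split=> //.
  apply: (blin_eq_system sysS (blin_comp bP bP) bP) => j.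
  by rewrite Pe (linZ (proj1 bP)) Pblock.
move=> f; split=> [Pf n|mz].
  have := coefP (bstart r n) f; rewrite Pf (lin0 (system_linear sysS _)).
  have -> : bidx r (bstart r n) = n.
    by apply: bidx_eq => //; rewrite leqnn bstartS -[ltnLHS]addn0 ltn_add2l r_gt0.
  move/esym/eqP; rewrite mulf_eq0 => /orP[|/eqP//].
  by rewrite -(mag_eq0 hK) mag_emb normr_eq0 invr_eq0 pnatr_eq0 eqn0Ngt r_gt0.
apply: tends_unique (system_tends sysS _) _.
apply: (tends_ext (N := 0)) (tends_cst hK _) => n _.
by rewrite big1// => j _; rewrite coefP mz mulr0 scale0r.
Qed.

End OnePartition.

Section TwoPartitions.
Variables (r r' : nat -> nat) (P : pred nat) (kappa : nat -> nat).
Hypotheses (r_gt0 : forall n, (0 < r n)%N) (r'_gt0 : forall n, (0 < r' n)%N).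
Hypothesis kappa_lt : {in P &, {homo kappa : m n / (m < n)%N}}.
Hypothesis kappa_size : {in P, forall n, r' (kappa n) = r n}.

Definition move_basis j : S :=
  if P (bidx r j) then e (relocate r r' kappa j) else 0.

Lemma relocate_operator : exists2 U : S -> S, bounded_linear hK U &
  forall j, U (e j) = move_basis j.
Proof.
apply: (system_extension sysS ltr01 (B := 1)) => // a n; rewrite mul1r.
have sD : sorted ltn [seq j <- index_iota 0 n | P (bidx r j)].
  by apply: sorted_filter; [exact: ltn_trans|exact: iota_ltn_sorted].
have -> : \sum_(0 <= j < n) a j *: move_basis j =
    \sum_(j <- [seq j <- index_iota 0 n | P (bidx r j)]) a j *: e (relocate r r' kappa j).
  rewrite big_filter [RHS]big_mkcond; apply: eq_bigr => j _; rewrite /move_basis.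
  by case: ifP => // _; rewrite scaler0.
rewrite (subsym_spread hS)//.
  by rewrite big_filter; apply: (subsym_restrict hS); exact: iota_uniq.
apply: (homo_sorted_in (P := fun j => P (bidx r j)) _ _ sD).
  by move=> i j Pi Pj ij; apply: (relocate_lt r_gt0 r'_gt0 kappa_lt).
by apply/allP => j; rewrite mem_filter => /andP[].
Qed.

Lemma move_basis_avg (U A A' : S -> S) : bounded_linear hK U -> bounded_linear hK A -> bounded_linear hK A' ->
  (forall j, U (e j) = move_basis j) ->
  (forall j, A (e j) = block_avg hK e r j) ->
  (forall j, A' (e j) = block_avg hK e r' j) ->
  forall f, U (A f) = A' (U f).
Proof.
move=> bU bA bA' hU hA hA'.
apply: (blin_eq_system sysS (blin_comp bU bA) (blin_comp bA' bU)) => j.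
rewrite hA /block_avg (linZ (proj1 bU)) (lin_sum (proj1 bU)) hU /move_basis.
case: ifP => Pj; last first.
  rewrite (lin0 (proj1 bA')) big_seq big1 ?scaler0// => i.
  by rewrite (mem_block r_gt0) hU /move_basis => /eqP ->; rewrite Pj.
rewrite hA' /block_avg (bidx_relocate r_gt0 r'_gt0 kappa_size Pj) kappa_size//; congr (_ *: _).
rewrite sum_block [RHS]sum_block kappa_size//; apply: eq_big_nat => i /andP[_ ir].
by rewrite hU /move_basis bidxD// Pj relocateD.
Qed.

End TwoPartitions.

(** ** Absorbing the mean-zero part of the space *)

Section Shuffle.
Variable r : nat -> nat.
Hypothesis r_gt0 : forall n, (0 < r n)%N.

(** A solution of [shuffle (2n) = r n] and [shuffle (2n+1) = shuffle n]: the index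
    comes from the odd part of [n + 1], which is invariant under [n |-> 2n+1]. *)
Definition shuffle n : nat := r ((n.+1 %/ 2 ^ logn 2 n.+1)./2)%N.

Lemma shuffle_gt0 n : (0 < shuffle n)%N. Proof. exact: r_gt0. Qed.

Lemma shuffle_even n : shuffle n.*2 = r n.
Proof.
rewrite /shuffle (_ : logn 2 n.*2.+1 = 0)%N; last first.
  by apply: logn_coprime; rewrite coprime2n /= odd_double.
by rewrite expn0 divn1 -[n.*2.+1]/(true + n.*2)%N half_bit_double.
Qed.

Lemma shuffle_odd n : shuffle n.*2.+1 = shuffle n.
Proof.
rewrite /shuffle -doubleS -muln2 lognM// (_ : logn 2 2 = 1)%N//.
by rewrite addn1 expnSr divnMr.
Qed.

(** Let [N_r] be the mean-zero part for the lengths [r]. Splitting the blocks of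
    [shuffle] by parity splits [S] into two copies of itself and [N_shuffle] into
    [N_r] and [N_shuffle]. As [S] is the sum of [N_shuffle] and of block constant
    vectors, it absorbs [N_r], and so does [X], which has [S] as a summand. *)
Lemma mean_zero_absorbed (X : completeNormedModType K) (T : S -> X) (Q : X -> S) :
  bounded_linear hK T -> bounded_linear hK Q -> (forall s, Q (T s) = s) ->
  exists (A : X -> S) (B : X -> X) (J1 : S -> X) (J2 : X -> X),
  [/\ bounded_linear hK A, bounded_linear hK B, bounded_linear hK J1 & bounded_linear hK J2] /\
  [/\ forall y, mean_zero r (A y), forall y, J1 (A y) + J2 (B y) = y &
      forall q z, mean_zero r q ->
        A (J1 q + J2 z) = q /\ B (J1 q + J2 z) = z].
Proof.
move=> bT bQ QT; have s_gt0 := shuffle_gt0.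
have half_lt (b : bool) : {in [pred n | odd n == b] &, {homo half : m n / (m < n)%N}}.
  by move=> m n; rewrite !inE => /eqP mb /eqP nb; have := odd_double_half m;
     have := odd_double_half n; rewrite mb nb; lia.
have double_lt : {in predT &, {homo double : m n / (m < n)%N}}.
  by move=> m n _ _; rewrite ltn_double.
have double1_lt : {in predT &, {homo (fun n => n.*2.+1) : m n / (m < n)%N}}.
  by move=> m n _ _; rewrite ltnS ltn_double.
have size_half n : odd n == false -> r n./2 = shuffle n.
  by move=> /eqP on; rewrite -{2}[n]odd_double_half on add0n shuffle_even.
have size_half' n : odd n == true -> shuffle n./2 = shuffle n.
  by move=> /eqP on; rewrite -{2}[n]odd_double_half on add1n shuffle_odd.
have [Ea bEa hEa] := @relocate_operator r shuffle predT double r_gt0 s_gt0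
  double_lt (fun n _ => shuffle_even n).
have [Eb bEb hEb] := @relocate_operator shuffle shuffle predT (fun n => n.*2.+1) s_gt0 s_gt0
  double1_lt (fun n _ => shuffle_odd n).
have [Da bDa hDa] := @relocate_operator shuffle r [pred n | odd n == false] half s_gt0 r_gt0
  (half_lt false) size_half.
have [Db bDb hDb] := @relocate_operator shuffle shuffle [pred n | odd n == true] half s_gt0 s_gt0
  (half_lt true) size_half'.
have [P [bP Pe PP Pmz]] := averaging_operator r_gt0.
have [P' [bP' Pe' PP' _]] := averaging_operator s_gt0.
have cEa : forall f, Ea (P f) = P' (Ea f).
  by apply: (move_basis_avg r_gt0 s_gt0 _ bEa bP bP' hEa Pe Pe') => n _; exact: shuffle_even.
have cEb : forall f, Eb (P' f) = P' (Eb f).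
  by apply: (move_basis_avg s_gt0 s_gt0 _ bEb bP' bP' hEb Pe' Pe') => n _; exact: shuffle_odd.
have cDa : forall f, Da (P' f) = P (Da f).
  by apply: (move_basis_avg s_gt0 r_gt0 _ bDa bP' bP hDa Pe' Pe) => n; exact: size_half.
have cDb : forall f, Db (P' f) = P' (Db f).
  by apply: (move_basis_avg s_gt0 s_gt0 _ bDb bP' bP' hDb Pe' Pe') => n; exact: size_half'.
have bidxEa j : bidx shuffle (relocate r shuffle double j) = (bidx r j).*2.
  by apply: (@bidx_relocate _ _ r_gt0 s_gt0 predT) => // n _; exact: shuffle_even.
have bidxEb j : bidx shuffle (relocate shuffle shuffle (fun n => n.*2.+1) j) =
    (bidx shuffle j).*2.+1.
  by apply: (@bidx_relocate _ _ s_gt0 s_gt0 predT) => // n _; exact: shuffle_odd.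
have DaEa : forall f, Da (Ea f) = f.
  apply: (blin_eq_system sysS (blin_comp bDa bEa) (blin_id hK S)) => j.
  rewrite hEa /move_basis/= hDa /move_basis/= bidxEa odd_double/=.
  rewrite relocate_comp ?shuffle_even//; congr e.
  by apply: relocate_id => //=; rewrite doubleK.
have DbEb : forall f, Db (Eb f) = f.
  apply: (blin_eq_system sysS (blin_comp bDb bEb) (blin_id hK S)) => j.
  rewrite hEb /move_basis/= hDb /move_basis/= bidxEb/= odd_double/=.
  rewrite relocate_comp ?shuffle_odd//; congr e.
  by apply: relocate_id => //=; rewrite uphalf_double.
have b0 : bounded_linear hK (fun _ : S => 0 : S).
  split; first by move=> c u v; rewrite scaler0 addr0.
  by exists 1 => // v; rewrite nrm0 mul1r nrm_ge0.
have DaEb : forall f, Da (Eb f) = 0.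
  apply: (blin_eq_system sysS (blin_comp bDa bEb) b0) => j.
  by rewrite hEb /move_basis/= hDa /move_basis/= bidxEb/= odd_double.
have DbEa : forall f, Db (Ea f) = 0.
  apply: (blin_eq_system sysS (blin_comp bDb bEa) b0) => j.
  by rewrite hEa /move_basis/= hDb /move_basis/= bidxEa/= odd_double.
have split_id : forall f, Ea (Da f) + Eb (Db f) = f.
  apply: (blin_eq_system sysS (blin_add (blin_comp bEa bDa) (blin_comp bEb bDb)) (blin_id hK S)) => j.
  rewrite hDa hDb /move_basis/=; case: (boolP (odd (bidx shuffle j))) => oj /=.
    rewrite (lin0 (proj1 bEa)) add0r hEb /move_basis/= relocate_comp//; last first.
      by rewrite size_half'//; apply/eqP.
    by congr e; apply: relocate_id => //=; rewrite -[RHS]odd_double_half oj.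
  rewrite (lin0 (proj1 bEb)) addr0 hEa /move_basis/= relocate_comp//; last first.
    by rewrite size_half//; apply/eqP/negbTE.
  by congr e; apply: relocate_id => //=; rewrite -[RHS]odd_double_half (negbTE oj).
pose N f := f - P' f.
have bN : bounded_linear hK N := blin_sub (blin_id hK S) bP'.
have NEb f : N (Eb f) = Eb (N f) by rewrite /N (linB (proj1 bEb)) cEb.
have NDb f : N (Db f) = Db (N f) by rewrite /N (linB (proj1 bDb)) cDb.
have NN f : N (N f) = N f by rewrite /N (linB (proj1 bP')) PP' subrr subr0.
(* [J2] moves the part in [N_shuffle] of the summand [S] to the odd blocks, [J1]
   fills the even ones; [A] and [B] read them off. *)
exists (fun y => Da (N (Q y))), (fun y => y + T (Db (N (Q y)) - N (Q y))),
  (fun q => T (Ea q)), (fun z => z + T (Eb (N (Q z)) - N (Q z))).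
have bNQ := blin_comp bN bQ.
split.
  split.
  - exact: blin_comp bDa bNQ.
  - apply: blin_add (blin_id hK X) (blin_comp bT _).
    exact: blin_sub (blin_comp bDb bNQ) bNQ.
  - exact: blin_comp bT bEa.
  - apply: blin_add (blin_id hK X) (blin_comp bT _).
    exact: blin_sub (blin_comp bEb bNQ) bNQ.
have lN := linD (proj1 bN). have lNB := linB (proj1 bN).
have lQ := linD (proj1 bQ). have lT := linD (proj1 bT).
split.
- by move=> y; apply/Pmz; rewrite -cDa /N (linB (proj1 bP')) PP' subrr (lin0 (proj1 bDa)).
- move=> y /=; set n := N (Q y); have Nn : N n = n by exact: NN.
  have NQ : N (Q (y + T (Db n - n))) = Db n.
    by rewrite lQ QT lN lNB NDb Nn -/n addrC subrK.
  rewrite NQ -[y + _ + _]addrA [LHS]addrCA -!lT -[RHS]addr0; congr (_ + _).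
  rewrite -[RHS](lin0 (proj1 bT)); congr T.
  by rewrite [Db n - n + _]addrC [_ - Db n + _]addrA subrK addrA split_id subrr.
- move=> q z /Pmz Pq /=; set n := N (Q z); have Nn : N n = n by exact: NN.
  have Nq : N (Ea q) = Ea q by rewrite /N -cEa Pq (lin0 (proj1 bEa)) subr0.
  have QJ : N (Q (T (Ea q) + (z + T (Eb n - n)))) = Ea q + Eb n.
    by rewrite !lQ !QT lN lN lNB Nq NEb Nn -/n [n + (_ - _)]addrC subrK.
  rewrite QJ; split.
    by rewrite (linD (proj1 bDa)) DaEa DaEb addr0.
  rewrite (linD (proj1 bDb)) DbEa DbEb add0r [T (Ea q) + _]addrCA -[LHS]addrA -[X in z + X]addrA -!lT -[RHS]addr0.
  congr (_ + _); rewrite -[RHS](lin0 (proj1 bT)); congr T.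
  by rewrite [_ - n + _]addrA subrK opprD [Eb n + _]addrCA subrr addr0 subrr.
Qed.

End Shuffle.
End AveragingOperators.

(** * Growth of the fundamental function in spaces of nontrivial type *)

Section Rademacher.
Variables (R : realType) (K : numFieldType) (hK : scalar_field R K).
Local Notation "⟦ v ⟧" := (nrm hK v) (at level 0, v at level 99).
Variables (S : completeNormedModType K) (e : nat -> S) (es : nat -> S -> K^o).
Hypothesis hS : subsymmetric hK e es.
Let sysS : schauder_system hK e es 1 := proj1 hS.
Local Notation lam := (unit_fund hK e).

(** The unit ball of l_1^n sits in that of l_infty^(2^n) through the sign
    vectors. Placing it on [2 ^ n] successive blocks of length [m], every choice
    of signs makes some block get the coefficient [n]. *)
Lemma type_sign_vectors (p C : R) n m : 0 < p ->
  (forall v : 'I_n -> S,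
    ((2 ^+ n)^-1 * \sum_(s : {ffun 'I_n -> bool})
        ⟦\sum_(i < n) (-1) ^+ s i *: v i⟧ `^ p) `^ p^-1
    <= C * (\sum_(i < n) ⟦v i⟧ `^ p) `^ p^-1) ->
  n%:R * lam m <= C * (n%:R `^ p^-1 * lam (2 ^ n * m)).
Proof.
move=> p0 htype; have [->|m0] := posnP m.
  rewrite muln0 /unit_fund big_geq// nrm0 !mulr0.
  by [].
pose F := {ffun 'I_n -> bool}; pose N := (2 ^ n)%N.
have cF : #|{: F}| = N by rewrite card_ffun card_bool card_ord.
pose sg i : F := nth [ffun=> false] (enum {: F}) i.
pose v k : S := \sum_(0 <= j < N * m) (-1) ^+ (sg (j %/ m)%N k) *: e j.
have nv k : ⟦v k⟧ = lam (N * m).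
  rewrite /unit_fund; have := subsym_sign hS (fun=> 1) (fun j => sg (j %/ m)%N k) (iota_uniq 0 (N * m - 0)).
  rewrite /v /index_iota; under eq_bigr do rewrite mulr1.
  by move=> ->; congr nrm; apply: eq_bigr => j _; rewrite scale1r.
have np1 (a : R) : 0 <= a -> (a `^ p) `^ p^-1 = a.
  by move=> a0; rewrite -powRrM mulfV ?gt_eqF// powRr1.
have := htype v; under [X in _ <= C * X `^ _]eq_bigr do rewrite nv.
rewrite sumr_const card_ord -[_ *+ n]mulr_natl powRM ?powR_ge0 ?ler0n// np1 ?lam_ge0//.
apply: le_trans; rewrite -[leLHS]np1 ?mulr_ge0 ?lam_ge0 ?ler0n//.
apply: ge0_ler_powR; rewrite ?nnegrE ?invr_ge0 ?powR_ge0 ?(ltW p0)//.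
  by rewrite mulr_ge0 ?invr_ge0 ?exprn_ge0// sumr_ge0// => s _; exact: powR_ge0.
rewrite ler_pdivlMl ?exprn_gt0//.
have -> : 2 ^+ n * (n%:R * lam m) `^ p = \sum_(s : F) (n%:R * lam m) `^ p.
  by rewrite sumr_const cF /N -[RHS]mulr_natl natrX.
apply: ler_sum => th _; apply: ge0_ler_powR; rewrite ?nnegrE ?nrm_ge0 ?mulr_ge0 ?lam_ge0 ?ler0n ?(ltW p0)//.
pose i0 := index th (enum {: F}).
have i0N : (i0 < N)%N by rewrite -cF cardE index_mem mem_enum.
have -> : \sum_(i < n) (-1) ^+ th i *: v i =
    \sum_(0 <= j < N * m) (\sum_(i < n) (-1) ^+ th i * (-1) ^+ (sg (j %/ m)%N i)) *: e j.
  under eq_bigr do rewrite /v scaler_sumr.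
  rewrite exchange_big; apply: eq_bigr => j _; rewrite scaler_suml.
  by apply: eq_bigr => i _; rewrite scalerA.
pose D := index_iota (i0 * m) (i0.+1 * m).
have DN : {subset D <= index_iota 0 (N * m)}.
  move=> j; rewrite !mem_index_iota => /andP[_ h].
  by rewrite leq0n /= (leq_trans h)// leq_mul2r i0N orbT.
apply: le_trans (subsym_sub hS _ (iota_uniq _ _) (iota_uniq _ _) DN).
have -> : \sum_(j <- D) (\sum_(i < n) (-1) ^+ th i * (-1) ^+ (sg (j %/ m)%N i)) *: e j =
    n%:R *: \sum_(j <- D) e j.
  rewrite scaler_sumr; apply: eq_big_seq => j; rewrite mem_index_iota => /andP[h1 h2].
  have -> : (j %/ m)%N = i0.
    by apply/eqP; rewrite eqn_leq -ltnS ltn_divLR// h2 leq_divRL.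
  congr (_ *: _); rewrite (_ : sg i0 = th); last by rewrite /sg nth_index// mem_enum.
  under eq_bigr do rewrite -signr_addb addbb.
  by rewrite sumr_const card_ord.
rewrite nrmZ -(scalar_embn hK) mag_emb ger0_norm// (lam_size hS) ?iota_uniq//.
by rewrite size_iota mulSn addnK.
Qed.

(** By type [p] the ratio of [lam (2 ^ n * m)] to [lam m] is at least a multiple
    of [n `^ (1 - p^-1)], uniformly in [m]; choose [n] to make it 2. *)
Lemma lam_doubling : nontrivial_type hK S ->
  exists2 b, (2 <= b)%N & forall m, 2 * lam m <= lam (b * m).
Proof.
move=> [p /andP[p1 _] [C0 hC0]].
pose C := Num.max C0 1; have C1 : 0 < C by rewrite lt_max ltr01 orbT.
have p0 : 0 < p := lt_trans ltr01 p1.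
pose q := 1 - p^-1.
have q0 : 0 < q by rewrite subr_gt0 invf_lt1.
pose n := (Num.trunc ((2 * C) `^ q^-1)).+1.
have n0 : 0 < (n%:R : R) by rewrite ltr0n.
have nq : 2 * C <= n%:R `^ q.
  have -> : 2 * C = ((2 * C) `^ q^-1) `^ q.
    by rewrite -powRrM mulVf ?gt_eqF// powRr1// mulr_ge0// ltW.
  by apply: ge0_ler_powR; rewrite ?nnegrE ?powR_ge0 ?ler0n ?(ltW q0)//; exact: ltW (truncnS_gt _).
have np0 : 0 < (n%:R : R) `^ p^-1 by rewrite powR_gt0.
have nE : (n%:R : R) = n%:R `^ p^-1 * n%:R `^ q.
  by rewrite -powRD ?(gt_eqF n0) ?implybT// /q addrC subrK powRr1// ltW.
exists (2 ^ n)%N => [|m]; first by rewrite (leq_pexp2l _ (ltn0Sn _))//.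
have := type_sign_vectors m p0 (hC0 n).
have l0 := lam_ge0 hK e m; have l1 := lam_ge0 hK e (2 ^ n * m).
move=> h; rewrite -(ler_pM2l C1) -(ler_pM2l np0).
apply: (le_trans (y := n%:R * lam m)).
  rewrite [X in _ <= X * _]nE [C * _]mulrA [C * 2]mulrC -[in leRHS]mulrA ler_pM2l//.
  by rewrite ler_wpM2r.
apply: le_trans h _; rewrite [leRHS]mulrCA; apply: ler_wpM2r.
  by rewrite mulr_ge0// ltW.
by rewrite le_max lexx.
Qed.

End Rademacher.

(** * A conditional basis from a basis of type P *)

Section TypeP.
Variables (R : realType) (K : numFieldType) (hK : scalar_field R K).
Local Notation "⟦ v ⟧" := (nrm hK v) (at level 0, v at level 99).
Local Notation emb := (scalar_emb hK).
Local Notation mag := (mag hK).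
Variables (X : completeNormedModType K) (x : nat -> X) (xs : nat -> X -> K^o).
Variables (Cx c CP : R).
Hypotheses (Cx0 : 0 < Cx) (c0 : 0 < c) (CP0 : 0 < CP).
Hypothesis sx : schauder_system hK x xs Cx.
Hypothesis cx : forall j, c <= ⟦x j⟧.
Hypothesis Px : forall k, ⟦\sum_(0 <= j < k) x j⟧ <= CP.

Definition dyadic n : nat := (2 ^ n).*2.

Lemma dyadic_gt0 n : (0 < dyadic n)%N.
Proof. by rewrite /dyadic double_gt0 expn_gt0. Qed.

Lemma even_bstart_dyadic n : ~~ odd (bstart dyadic n).
Proof.
elim: n => [|n IH]; first by rewrite bstart0.
by rewrite bstartS oddD (negbTE IH) odd_double.
Qed.

Let p n := bstart dyadic n.
Let hN n := (2 ^ n)%N.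

Let pS n : p n.+1 = (p n + hN n + hN n)%N.
Proof. by rewrite /p bstartS /dyadic -addnn addnA. Qed.

Lemma interval_sum_le m n : ⟦\sum_(m <= j < n) x j⟧ <= 2 * CP.
Proof.
have [mn|nm] := leqP m n; last by rewrite big_geq ?(ltnW nm)// nrm0 mulr_ge0// ltW.
have -> : \sum_(m <= j < n) x j = \sum_(0 <= j < n) x j - \sum_(0 <= j < m) x j.
  by rewrite [in RHS](big_cat_nat (leq0n m) mn)/= [RHS]addrC addKr.
by rewrite mulrDl !mul1r; apply: le_trans (ler_nrmB _ _ _) (lerD _ _).
Qed.

Definition step_sum n i : X := \sum_(p n <= j < p n + i) x j.

(** In the block of length [2N] starting at [p = p n], where [N = 2 ^ n], the pairs are
    [T_i, v_i - T_i] with [T_i = x_p + ... + x_(p+i)] and [v_i = x_(p+N+i)]. *)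
Definition cond_vec k : X :=
  let n := bidx dyadic k in let i := ((k - p n)./2)%N in
  if odd k then x (p n + hN n + i)%N - step_sum n i.+1 else step_sum n i.+1.

(** Writing [b_i] for the coefficients of [f] at the first half of the block, the
    coefficient of [T_i] in the summing basis is [b_i - b_(i+1)], with [0] in place
    of [b_N] at the end. *)
Let trunc_coef n i f : K := if (i < hN n)%N then xs (p n + i)%N f else 0.

Definition cond_coef k (f : X) : K^o :=
  let n := bidx dyadic k in let i := ((k - p n)./2)%N in
  if odd k then xs (p n + hN n + i)%N f else
  xs (p n + i)%N f - trunc_coef n i.+1 f + xs (p n + hN n + i)%N f.

Let trunc_coef_linear n i : linear (fun f => trunc_coef n i f : K^o).
Proof.
move=> a u v; rewrite /trunc_coef; case: ifP => _; first exact: (system_linear sx).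
by rewrite scaler0 addr0.
Qed.

Let idx_even n i : (i < hN n)%N -> [/\ bidx dyadic (p n + i.*2)%N = n,
  odd (p n + i.*2)%N = false & ((p n + i.*2 - p n)./2 = i)%N].
Proof.
move=> iN; split; last by rewrite addKn doubleK.
  by apply: bidxD; [exact: dyadic_gt0|rewrite /dyadic ltn_double].
by rewrite oddD (negbTE (even_bstart_dyadic n)) odd_double.
Qed.

Let idx_odd n i : (i < hN n)%N -> [/\ bidx dyadic (p n + i.*2.+1)%N = n,
  odd (p n + i.*2.+1)%N = true & ((p n + i.*2.+1 - p n)./2 = i)%N].
Proof.
move=> iN; split; last by rewrite addKn -[i.*2.+1]/(true + i.*2)%N half_bit_double.
  by apply: bidxD; [exact: dyadic_gt0|rewrite /dyadic ltn_Sdouble].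
by rewrite oddD (negbTE (even_bstart_dyadic n))/= odd_double.
Qed.

Let cond_vec_even n i : (i < hN n)%N -> cond_vec (p n + i.*2)%N = step_sum n i.+1.
Proof. by move=> /idx_even[h1 h2 h3]; rewrite /cond_vec h1 h2 h3. Qed.

Let cond_vec_odd n i : (i < hN n)%N ->
  cond_vec (p n + i.*2.+1)%N = x (p n + hN n + i)%N - step_sum n i.+1.
Proof. by move=> /idx_odd[h1 h2 h3]; rewrite /cond_vec h1 h2 h3. Qed.

Let cond_coef_even n i f : (i < hN n)%N -> cond_coef (p n + i.*2)%N f =
  xs (p n + i)%N f - trunc_coef n i.+1 f + xs (p n + hN n + i)%N f.
Proof. by move=> /idx_even[h1 h2 h3]; rewrite /cond_coef h1 h2 h3. Qed.

Let cond_coef_odd n i f : (i < hN n)%N ->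
  cond_coef (p n + i.*2.+1)%N f = xs (p n + hN n + i)%N f.
Proof. by move=> /idx_odd[h1 h2 h3]; rewrite /cond_coef h1 h2 h3. Qed.

Let idx_split k : exists n i, (i < hN n)%N /\
  (k = p n + i.*2 \/ k = p n + i.*2.+1)%N.
Proof.
exists (bidx dyadic k), (k - p (bidx dyadic k))./2%N.
have /andP[h1 h2] := bidxP dyadic_gt0 k.
rewrite bstartS /dyadic -addnn in h2; rewrite /p /hN.
have := odd_double_half (k - bstart dyadic (bidx dyadic k)).
have h3 : (bstart dyadic (bidx dyadic k) + (k - bstart dyadic (bidx dyadic k)) = k)%N.
  by rewrite subnKC.
move: (bstart _ _) (2 ^ _)%N h1 h2 h3 => b N h1 h2 h3.
have h4 : (k - b < N + N)%N by lia.
move: (k - b)%N h3 h4 => q <- h4.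
case: (odd q) => /= hq; split; try by right; rewrite -{1}hq.
- by lia.
- by lia.
- by left; rewrite -{1}hq.
Qed.

Lemma cond_coef_linear k : linear (cond_coef k).
Proof.
have [n [i [iN [->|->]]]] := idx_split k.
  rewrite (_ : cond_coef _ = fun f => xs (p n + i)%N f - trunc_coef n i.+1 f +
      xs (p n + hN n + i)%N f); last by apply/funext => f; exact: cond_coef_even.
  apply: linear_add (system_linear sx _).
  exact: linear_sub (system_linear sx _) (trunc_coef_linear _ _).
rewrite (_ : cond_coef _ = xs (p n + hN n + i)%N); first exact: system_linear sx _.
by apply/funext => f; exact: cond_coef_odd.
Qed.

Let xs_step j n i : xs j (step_sum n i) = (p n <= j < p n + i)%N%:R.
Proof.
rewrite /step_sum; have := system_comb sx (fun=> 1) j (iota_uniq (p n) (p n + i - p n)).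
by under eq_bigr do rewrite scale1r; move=> ->; rewrite mem_index_iota; case: ifP.
Qed.

Let p_lt m n : (m < n)%N -> (p m + hN m + hN m <= p n)%N.
Proof. by move=> mn; rewrite -pS; apply: bstart_le. Qed.

(** The vectors [T_i] and [v_i] occupy different halves of their block, so the dual
    pairing is decided by comparing positions. *)
Lemma cond_dual k l : cond_coef l (cond_vec k) = (k == l)%:R.
Proof.
have [n [i [iN hk]]] := idx_split k; have [m [j [jN hl]]] := idx_split l.
have nat_eq (a b : bool) : a = b -> (a%:R : K) = b%:R by move->.
have coefT : forall l, (l = p m + j.*2 \/ l = p m + j.*2.+1)%N ->
    cond_coef l (step_sum n i.+1) = (p n + i.*2 == l)%N%:R.
  move=> l' [->|->]; last first.
    rewrite cond_coef_odd// xs_step; apply: nat_eq.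
    by case: (ltngtP m n) => mn; [have := p_lt mn|have := p_lt mn|subst m]; lia.
  rewrite cond_coef_even// /trunc_coef !xs_step.
  have -> : (p n <= p m + hN m + j < p n + i.+1)%N = false.
    by case: (ltngtP m n) => mn; [have := p_lt mn|have := p_lt mn|subst m]; lia.
  rewrite addr0; case: (ltngtP m n) => mn.
  - have h := p_lt mn.
    have -> : (p n <= p m + j < p n + i.+1)%N = false by lia.
    have -> : (p n <= p m + j.+1 < p n + i.+1)%N = (p n <= p m + j.+1)%N by lia.
    have -> : (p n + i.*2 == p m + j.*2)%N = false by lia.
    case: ifP => jm; rewrite ?subr0// sub0r.
    by rewrite (_ : (_ <= _)%N = false) ?oppr0//; lia.
  - have h := p_lt mn.
    have -> : (p n <= p m + j < p n + i.+1)%N = false by lia.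
    have -> : (p n <= p m + j.+1 < p n + i.+1)%N = false by lia.
    have -> : (p n + i.*2 == p m + j.*2)%N = false by lia.
    by case: ifP => jm; rewrite subr0.
  - subst m.
    have -> : (p n <= p n + j < p n + i.+1)%N = (j <= i)%N by lia.
    have -> : (p n <= p n + j.+1 < p n + i.+1)%N = (j < i)%N by lia.
    have -> : (p n + i.*2 == p n + j.*2)%N = (i == j) by lia.
    have -> : (if (j.+1 < hN n)%N then (j < i)%N%:R else 0) = (j < i)%N%:R :> K.
      by case: ifP => // jN'; rewrite (_ : (j < i)%N = false)//; lia.
    by case: (ltngtP j i) => _; rewrite ?subrr ?subr0.
have coefv : forall l, (l = p m + j.*2 \/ l = p m + j.*2.+1)%N ->
    cond_coef l (x (p n + hN n + i)%N) = ((p n + i.*2 == l) || (p n + i.*2.+1 == l))%N%:R.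
  move=> l' [->|->]; last first.
    rewrite cond_coef_odd// (system_dual sx); apply: nat_eq.
    by case: (ltngtP m n) => mn; [have := p_lt mn|have := p_lt mn|subst m]; lia.
  rewrite cond_coef_even// /trunc_coef !(system_dual sx).
  have -> : (p n + hN n + i == p m + j)%N = false.
    by case: (ltngtP m n) => mn; [have := p_lt mn|have := p_lt mn|subst m]; lia.
  have -> : (if (j.+1 < hN m)%N then (p n + hN n + i == p m + j.+1)%N%:R else 0) = 0 :> K.
    case: ifP => // jm; rewrite (_ : (_ == _) = false)//.
    by case: (ltngtP m n) => mn; [have := p_lt mn|have := p_lt mn|subst m]; lia.
  rewrite subr0 add0r; apply: nat_eq.
  by case: (ltngtP m n) => mn; [have := p_lt mn|have := p_lt mn|subst m]; lia.
case: hk => ->; first by rewrite cond_vec_even// coefT.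
rewrite cond_vec_odd// (linB (cond_coef_linear l)) coefv// coefT//.
case: (eqVneq (p n + i.*2)%N l) => [<-|_] /=.
  rewrite subrr (_ : (_ == _)%N = false)//; lia.
by rewrite subr0.
Qed.

(** Summation by parts: the first [m] pairs of a block give two segments of the
    expansion of [f] and one boundary term. *)
Let pairs n m f : (m <= hN n)%N ->
  \sum_(0 <= k < m.*2) cond_coef (p n + k)%N f *: cond_vec (p n + k)%N =
  \sum_(0 <= i < m) xs (p n + i)%N f *: x (p n + i)%N +
  \sum_(0 <= i < m) xs (p n + hN n + i)%N f *: x (p n + hN n + i)%N -
  trunc_coef n m f *: step_sum n m.
Proof.
elim: m => [|m IH] mN.
  by rewrite !big_geq// /step_sum addn0 big_geq// scaler0 subr0 addr0.
rewrite doubleS !big_nat_recr//= IH ?(ltnW mN)// -addrA.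
rewrite cond_coef_even// cond_vec_even// cond_coef_odd// cond_vec_odd//.
rewrite {1}/trunc_coef mN.
have TS : step_sum n m.+1 = step_sum n m + x (p n + m)%N.
  by rewrite /step_sum addnS big_nat_recr ?leq_addr.
set A := \sum_(0 <= i < m) _; set B := \sum_(0 <= i < m) _.
set b := xs (p n + m)%N f; set b' := xs (p n + hN n + m)%N f.
set V := step_sum n m.+1; set t := trunc_coef _ _ _; set T := step_sum n m.
set u := x (p n + m)%N; set w := x (p n + hN n + m)%N.
rewrite scalerDl scalerBl (scalerBr b') [b' *: w - _]addrC.
rewrite [_ + b' *: V + _]addrA addrK {1}/V TS scalerDr -/u -/T -!addrA.
rewrite [- (b *: T) + _]addrA addNr add0r; congr (_ + _).
by rewrite addrCA; congr (_ + _); congr (_ + _); rewrite addrC.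
Qed.


Let Px_ n f := \sum_(0 <= j < n) xs j f *: x j.
Let Py_ n f := \sum_(0 <= k < n) cond_coef k f *: cond_vec k.

Let segment s m f : \sum_(0 <= i < m) xs (s + i)%N f *: x (s + i)%N = Px_ (s + m)%N f - Px_ s f.
Proof.
rewrite /Px_ (big_cat_nat (leq0n s) (leq_addr m s))/= [RHS]addrC addKr.
by rewrite -[X in _ = \big[_/_]_(X <= _ < _) _]add0n big_addn addKn; apply: eq_bigr => i _; rewrite addnC.
Qed.

Let cond_block n f :
  \sum_(k <- block dyadic n) cond_coef k f *: cond_vec k = Px_ (p n.+1) f - Px_ (p n) f.
Proof.
rewrite sum_block pairs// !segment /trunc_coef ltnn scale0r subr0 -pS.
by rewrite addrC addrA subrK.
Qed.

Let cond_prefix n f : Py_ (p n) f = Px_ (p n) f.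
Proof.
rewrite /Py_ sum_bstart; elim: n => [|n IH].
  by rewrite big_geq// /Px_ /p bstart0 big_geq.
by rewrite big_nat_recr//= IH cond_block addrC subrK.
Qed.

Let M : R := 2 + 8 * CP / c.

Let M0 : 0 < M. Proof. by rewrite addr_gt0// divr_gt0// mulr_gt0. Qed.

(** The partial sums of the new basis inside a block differ from those of [x] by
    two segments of the expansion and finitely many terms with a small scalar. *)
Let cond_tail n f (eta : R) :
  (forall i j, (p n <= i)%N -> (p n <= j)%N -> ⟦Px_ i f - Px_ j f⟧ <= eta) ->
  forall k, bidx dyadic k = n -> ⟦Py_ k f - Px_ (p n) f⟧ <= M * eta.
Proof.
move=> heta k kn.
have eta0 : 0 <= eta by apply: le_trans (heta (p n) (p n) _ _) => //; exact: nrm_ge0.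
have coef j : (p n <= j)%N -> mag (xs j f) <= eta / c.
  move=> pj; rewrite ler_pdivlMr//; apply: (le_trans (y := mag (xs j f) * ⟦x j⟧)).
    by rewrite ler_wpM2l ?mag_ge0.
  rewrite -nrmZ (_ : _ *: _ = Px_ j.+1 f - Px_ j f); last first.
    by rewrite /Px_ big_nat_recr//= [RHS]addrC addKr.
  by rewrite heta// ltnW.
have ec0 : 0 <= eta / c by rewrite divr_ge0// ltW.
have tcoef m : mag (trunc_coef n m f) <= eta / c.
  by rewrite /trunc_coef; case: ifP => _; [rewrite coef ?leq_addr|rewrite mag0].
have term (a : K) m : mag a <= eta / c -> ⟦a *: step_sum n m⟧ <= eta / c * (2 * CP).
  by move=> ha; rewrite nrmZ ler_pM ?mag_ge0 ?nrm_ge0 ?interval_sum_le.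
have [n' [i [iN hk]]] := idx_split k.
have n'n : n' = n by case: hk => hk; rewrite -kn hk; [case: (idx_even iN)|case: (idx_odd iN)].
subst n'.
have even : ⟦Py_ (p n + i.*2)%N f - Px_ (p n) f⟧ <= (2 + 2 * CP / c) * eta.
  have -> : Py_ (p n + i.*2)%N f - Px_ (p n) f =
    (Px_ (p n + i)%N f - Px_ (p n) f) + (Px_ (p n + hN n + i)%N f - Px_ (p n + hN n)%N f) -
    trunc_coef n i f *: step_sum n i.
    rewrite -!segment -pairs ?(ltnW iN)// -cond_prefix /Py_.
    rewrite (big_cat_nat (leq0n (p n)) (leq_addr _ _))/= [LHS]addrC addKr.
    by rewrite -[X in \big[_/_]_(X <= _ < _) _]add0n big_addn addKn; apply: eq_bigr => l _; rewrite addnC.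
  apply: le_trans (ler_nrmB _ _ _) _; apply: le_trans (lerD (ler_nrmD _ _ _) (lexx _)) _.
  have h1 : ⟦Px_ (p n + i)%N f - Px_ (p n) f⟧ <= eta by rewrite heta ?leq_addr.
  have h2 : ⟦Px_ (p n + hN n + i)%N f - Px_ (p n + hN n)%N f⟧ <= eta.
    by rewrite heta// ?leq_addr// -addnA leq_addr.
  apply: le_trans (lerD (lerD h1 h2) (term _ i (tcoef i))) _.
  by apply: le_of_eq; field; rewrite gt_eqF.
case: hk => ->.
  apply: le_trans even _; rewrite ler_wpM2r// /M lerD2l ler_pM2r ?invr_gt0//.
  by rewrite ler_pM2r// ler_nat.
have -> : Py_ (p n + i.*2.+1)%N f - Px_ (p n) f = (Py_ (p n + i.*2)%N f - Px_ (p n) f) +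
    (xs (p n + i)%N f *: step_sum n i.+1 - trunc_coef n i.+1 f *: step_sum n i.+1 +
     xs (p n + hN n + i)%N f *: step_sum n i.+1).
  rewrite /Py_ addnS big_nat_recr//= cond_coef_even// cond_vec_even//.
  by rewrite scalerDl scalerBl addrAC.
have t1 := term _ i.+1 (coef (p n + i)%N (leq_addr _ _)).
have t2 := term _ i.+1 (tcoef i.+1).
have t3 := term _ i.+1 (coef (p n + hN n + i)%N ltac:(by rewrite -addnA leq_addr)).
apply: le_trans (ler_nrmD _ _ _) _.
apply: le_trans (lerD even (le_trans (ler_nrmD _ _ _) (lerD (le_trans (ler_nrmB _ _ _) (lerD t1 t2)) t3))) _.
by apply: le_of_eq; rewrite /M; field; rewrite gt_eqF.
Qed.

Lemma cond_system :
  schauder_system hK cond_vec cond_coef (Cx + M * (2 * Cx)).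
Proof.
split; [exact: cond_coef_linear|exact: cond_dual| |].
  move=> k f; rewrite -/(Py_ k f).
  apply: le_trans (ler_nrm_addl _ _ (Px_ (p (bidx dyadic k)) f)) _.
  rewrite mulrDl; apply: lerD; first exact: (system_partial sx).
  rewrite -mulrA; apply: cond_tail => // i j _ _.
  rewrite -mulrA mulrDl !mul1r.
  by apply: le_trans (ler_nrmB _ _ _) (lerD _ _); apply: (system_partial sx).
move=> f eps e0.
have M1 : 0 < 2 * M + 1 by rewrite addr_gt0// mulr_gt0.
have e1 : 0 < eps / (2 * M + 1) by rewrite divr_gt0.
have [N hN'] := system_tends sx f e1.
exists (p N) => k pk; rewrite -/(Py_ k f); set n := bidx dyadic k.
have Nn : (N <= n)%N by rewrite leqNgt (bidx_lt dyadic_gt0) -leqNgt.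
have Np : (N <= p n)%N by rewrite (leq_trans Nn)// bstart_ge// => ?; exact: dyadic_gt0.
have close i : (p n <= i)%N -> ⟦Px_ i f - f⟧ < eps / (2 * M + 1).
  by move=> pi; apply: hN'; apply: leq_trans pi.
have := @cond_tail n f (2 * (eps / (2 * M + 1))) _ k erefl => tail.
apply: le_lt_trans (ler_nrm_tri _ _ (Px_ (p n) f) _) _.
apply: (lt_le_trans (ler_ltD (tail _) (close _ (leqnn _)))).
  move=> i j pi pj; apply: le_trans (ler_nrm_tri _ _ f _) _.
  by rewrite mulrDl mul1r lerD// ltW ?close// nrmC close.
by apply: le_of_eq; field; rewrite gt_eqF.
Qed.

Lemma cond_coef_le k f : mag (cond_coef k f) <= 6 * Cx / c * ⟦f⟧.
Proof.
have coef j : mag (xs j f) <= 2 * Cx / c * ⟦f⟧.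
  rewrite mulrAC ler_pdivlMr//; apply: le_trans (system_coef sx j f).
  by rewrite ler_wpM2l ?mag_ge0.
have f0 : 0 <= 2 * Cx / c * ⟦f⟧ := le_trans (mag_ge0 hK (xs 0%N f)) (coef 0%N).
have tcoef n i : mag (trunc_coef n i f) <= 2 * Cx / c * ⟦f⟧.
  by rewrite /trunc_coef; case: ifP => _; rewrite ?mag0.
have E : 6 * Cx / c * ⟦f⟧ = 3 * (2 * Cx / c * ⟦f⟧) by field; rewrite gt_eqF.
have [n [i [iN [->|->]]]] := idx_split k.
  rewrite cond_coef_even// E; apply: le_trans (ler_magD _ _ _) _.
  have := ler_magD hK (xs (p n + i)%N f) (- trunc_coef n i.+1 f); rewrite magN.
  by have := coef (p n + i)%N; have := tcoef n i.+1; have := coef (p n + hN n + i)%N; lra.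
by rewrite cond_coef_odd// E; have := coef (p n + hN n + i)%N; lra.
Qed.

Lemma cond_vec_le (C : R) : (forall j, ⟦x j⟧ <= C) -> forall k, ⟦cond_vec k⟧ <= C + 2 * CP.
Proof.
move=> hC k; have C0 : 0 <= C by apply: le_trans (hC 0%N); exact: nrm_ge0.
have [n [i [iN [->|->]]]] := idx_split k.
  rewrite cond_vec_even//; apply: le_trans (interval_sum_le _ _) _; rewrite lerDr//.
rewrite cond_vec_odd//; apply: le_trans (ler_nrmB _ _ _) _.
by rewrite lerD// interval_sum_le.
Qed.

(** [T_i] cancels inside the [i]-th pair and the [v_i] remain. *)
Lemma cond_block_sum n : ⟦\sum_(k <- block dyadic n) cond_vec k⟧ <= 2 * CP.
Proof.
have half m : (m <= hN n)%N -> \sum_(0 <= k < m.*2) cond_vec (p n + k)%N =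
    \sum_(0 <= i < m) x (p n + hN n + i)%N.
  elim: m => [|m IH] mN; first by rewrite !big_geq.
  rewrite doubleS !big_nat_recr//= IH ?(ltnW mN)// -addrA; congr (_ + _).
  by rewrite cond_vec_even// cond_vec_odd// addrC subrK.
rewrite sum_block half//.
have -> : \sum_(0 <= i < hN n) x (p n + hN n + i)%N =
    \sum_(p n + hN n <= j < p n + hN n + hN n) x j.
  rewrite -[X in _ = \big[_/_]_(X <= _ < _) _]add0n big_addn addKn.
  by apply: eq_bigr => i _; rewrite addnC.
exact: interval_sum_le.
Qed.

(** The functional [xs (p n)] takes the value 1 on each of the [2 ^ n] vectors
    [T_i], which are the terms with even index. *)
Lemma cond_block_even n :
  (2 ^ n)%:R * (c / (2 * Cx)) <= ⟦\sum_(k <- block dyadic n | ~~ odd k) cond_vec k⟧.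
Proof.
have half m : (m <= hN n)%N ->
    \sum_(0 <= k < m.*2) (if ~~ odd (p n + k) then cond_vec (p n + k)%N else 0) =
    \sum_(0 <= i < m) step_sum n i.+1.
  elim: m => [|m IH] mN; first by rewrite !big_geq.
  rewrite doubleS !big_nat_recr//= IH ?(ltnW mN)// -addrA; congr (_ + _).
  have [_ -> _] := idx_even mN; have [_ -> _] := idx_odd mN.
  by rewrite /= addr0 cond_vec_even.
rewrite big_mkcond sum_block half//.
set g := \sum_(_ <= _ < _) _.
have xg : xs (p n) g = (2 ^ n)%:R.
  rewrite /g (lin_sum (system_linear sx _)).
  under eq_bigr do rewrite xs_step leqnn addnS ltnS leq_addr.
  by rewrite big_const_nat subn0 iter_addr_0.
have := system_coef sx (p n) g; rewrite xg -(scalar_embn hK) mag_emb ger0_norm// => h.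
rewrite mulrA ler_pdivrMr ?mulr_gt0// [leRHS]mulrC; apply: le_trans h.
by rewrite ler_wpM2l.
Qed.

End TypeP.

(** * The basis built from block averages *)

Section Construction.
Variables (R : realType) (K : numFieldType) (hK : scalar_field R K).
Local Notation "⟦ v ⟧" := (nrm hK v) (at level 0, v at level 99).
Local Notation emb := (scalar_emb hK).
Local Notation mag := (mag hK).
Local Notation tends := (tends hK).
Variables (S : completeNormedModType K) (e : nat -> S) (es : nat -> S -> K^o).
Hypothesis hS : subsymmetric hK e es.
Let sysS : schauder_system hK e es 1 := proj1 hS.
Local Notation lam := (unit_fund hK e).
Variables (b : nat) (b2 : (2 <= b)%N).
Hypothesis lam_b : forall m, 2 * lam m <= lam (b * m).

Definition blen n := (b ^ n)%N.

Lemma blen_gt0 n : (0 < blen n)%N.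
Proof. by rewrite expn_gt0 (leq_trans _ b2). Qed.

(** The norm of the mean of a unit vector over the [n]-th block. *)
Definition weight n : R := lam (blen n) / (blen n)%:R.

Lemma lam_blen_gt0 n : 0 < lam (blen n).
Proof. by apply: (lam_gt0 hS); exact: blen_gt0. Qed.

Lemma blenR_gt0 n : 0 < (blen n)%:R :> R.
Proof. by rewrite ltr0n blen_gt0. Qed.

Lemma weight_gt0 n : 0 < weight n.
Proof. by rewrite divr_gt0 ?lam_blen_gt0 ?blenR_gt0. Qed.

(** Subadditivity of [lam] makes the weights nonincreasing. *)
Lemma weight_le m n : (m <= n)%N -> weight n <= weight m.
Proof.
elim: n => [|n IH]; first by rewrite leqn0 => /eqP->.
rewrite leq_eqVlt => /orP[/eqP->//|/IH]; apply: le_trans.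
rewrite /weight ler_pdivrMr ?blenR_gt0//.
have -> : lam (blen n) / (blen n)%:R * (blen n.+1)%:R = b%:R * lam (blen n).
  by rewrite /blen expnS natrM; field; rewrite gt_eqF// blenR_gt0.
by rewrite /blen expnS; exact: (lamM hS).
Qed.

Lemma lam_blen_double n : 2 * lam (blen n) <= lam (blen n.+1).
Proof. by rewrite /blen expnS. Qed.

Lemma sum_lam_blen n : \sum_(0 <= i < n.+1) lam (blen i) <= 2 * lam (blen n).
Proof.
elim: n => [|n IH]; first by rewrite big_nat1; have := lam_blen_gt0 0; lra.
rewrite big_nat_recr//=; have := lam_blen_double n; move: IH.
by move: (\sum_(_ <= _ < _) _) => s; lra.
Qed.

Lemma lam_blen_unbounded B : exists n, B < lam (blen n).
Proof.
have l1 := lam_blen_gt0 0.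
have h n : n%:R * lam (blen 0) <= lam (blen n).
  elim: n => [|n IH]; first by rewrite mul0r ltW// lam_blen_gt0.
  have h1 : lam (blen 0) <= lam (blen n).
    by apply: (lam_le hS); rewrite /blen expn0 blen_gt0.
  by rewrite mulrS mulrDl mul1r; have := lam_blen_double n; lra.
exists (Num.trunc (B / lam (blen 0))).+1; apply: lt_le_trans (h _).
by rewrite -ltr_pdivrMr// truncnS_gt.
Qed.

Lemma bstart_blen_le n : (bstart blen n.+1 <= 2 * blen n)%N.
Proof.
elim: n => [|n IH]; first by rewrite bstartS bstart0 add0n leq_pmull.
have h : (2 * blen n <= blen n.+1)%N by rewrite {2}/blen expnS leq_mul2r b2 orbT.
by rewrite bstartS; lia.
Qed.

Let lenP := blen_gt0.

(* [X] is identified with the sum of the mean-zero part of [S] and of [X]: the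
   vector with components [q] and [z] is [J1 q + J2 z], and [A], [B] are the
   projections on the components. One constant [C] serves for all bounds. *)
Variables (X : completeNormedModType K) (y : nat -> X) (ys : nat -> X -> K^o).
Variables (A : X -> S) (B : X -> X) (J1 : S -> X) (J2 : X -> X) (C : R).
Hypotheses (C1 : 1 <= C) (sy : schauder_system hK y ys C).
Hypotheses (y_le : forall k, ⟦y k⟧ <= C)
  (ys_le : forall k f, mag (ys k f) <= C * ⟦f⟧).
Hypotheses (bA : bounded_linear hK A) (bB : bounded_linear hK B) (bJ1 : bounded_linear hK J1) (bJ2 : bounded_linear hK J2).
Hypotheses (A_le : forall f, ⟦A f⟧ <= C * ⟦f⟧) (B_le : forall f, ⟦B f⟧ <= C * ⟦f⟧)
  (J1_le : forall q, ⟦J1 q⟧ <= C * ⟦q⟧) (J2_le : forall z, ⟦J2 z⟧ <= C * ⟦z⟧).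
Hypotheses (A_mz : forall f, mean_zero es blen (A f))
  (JAB : forall f, J1 (A f) + J2 (B f) = f)
  (ABJ : forall q z, mean_zero es blen q ->
     A (J1 q + J2 z) = q /\ B (J1 q + J2 z) = z).

Local Notation avg := (block_avg hK e blen).
Local Notation blk := (bidx blen).

Definition dkk_vec j : X := J1 (e j - avg j) + J2 (emb (weight (blk j)) *: y (blk j)).

Definition dkk_coef j (f : X) : K^o :=
  es j (A f) + emb (lam (blen (blk j)))^-1 * ys (blk j) (B f).

Let C0 : 0 < C. Proof. exact: lt_le_trans C1. Qed.

Let C_le_sq : C <= C ^+ 2. Proof. by rewrite expr2 ler_peMl// ltW. Qed.

Lemma dkk_coef_linear j : linear (dkk_coef j).
Proof.
move=> a f g; rewrite /dkk_coef (proj1 bA) (proj1 bB) (system_linear sysS) (system_linear sy).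
rewrite mulrDr scalerDr addrACA; congr (_ + (_ + _)).
by rewrite -![_ *: _]/(_ * _) mulrCA.
Qed.

Let mz_residual j : mean_zero es blen (e j - avg j).
Proof.
have [P [bP Pe PP Pmz]] := averaging_operator hS lenP.
apply/Pmz; rewrite (linB (proj1 bP)) Pe -{2}Pe; apply/eqP; rewrite subr_eq0; apply/eqP.
by rewrite -Pe PP.
Qed.

Let A_dkk j : A (dkk_vec j) = e j - avg j.
Proof. by have [] := ABJ (emb (weight (blk j)) *: y (blk j)) (mz_residual j). Qed.

Let B_dkk j : B (dkk_vec j) = emb (weight (blk j)) *: y (blk j).
Proof. by have [] := ABJ (emb (weight (blk j)) *: y (blk j)) (mz_residual j). Qed.

Let emb_natV_mul n : (0 < n)%N -> emb (n%:R^-1) * n%:R = 1.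
Proof.
by move=> n0; rewrite -(scalar_embn hK) -scalar_embM mulVf ?scalar_emb1// pnatr_eq0 -lt0n.
Qed.

(** The projection of [dkk_vec i] on the mean-zero part loses the mean of [e_i],
    and the component along [y] gives it back. *)
Lemma dkk_dual i j : dkk_coef j (dkk_vec i) = (i == j)%:R.
Proof.
rewrite /dkk_coef A_dkk B_dkk (linB (system_linear sysS j)) (system_dual sysS).
rewrite /block_avg (linZ (system_linear sysS j)) (linZ (system_linear sy _)) (system_dual sy).
have -> : es j (\sum_(k <- block blen (blk i)) e k) = (blk i == blk j)%:R.
  have := system_comb sysS (fun=> 1) j (block_uniq blen (blk i)).
  under eq_bigr do rewrite scale1r; move=> ->; rewrite (mem_block lenP) eq_sym.
  by case: eqP.
have [ij|ij] := eqVneq (blk i) (blk j); last by rewrite !scaler0 mulr0 subr0 addr0.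
rewrite -ij /weight -![_ *: 1]/(_ * 1) !mulr1 -scalar_embM mulrA mulVf ?mul1r ?subrK//.
by rewrite gt_eqF// lam_blen_gt0.
Qed.

(** ** Norm estimates for finite combinations *)

Let block_avg_seq (D : seq nat) (a : nat -> K) : uniq D ->
  ⟦\sum_(j <- D) a j *: avg j⟧ <= 2 * ⟦\sum_(j <- D) a j *: e j⟧.
Proof.
move=> uD; have [n hn] := seq_nat_bound D; rewrite !(sum_seq_nat _ uD hn).
have := block_avg_bound hS lenP (fun j => if j \in D then a j else 0) n.
have h (u : nat -> S) : \sum_(0 <= j < n) (if j \in D then a j else 0) *: u j =
    \sum_(0 <= j < n) (if j \in D then a j *: u j else 0).
  by apply: eq_bigr => j _; case: ifP => // _; rewrite scale0r.
by rewrite !h.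
Qed.

Let comb_const := 3 * C ^+ 2.

Let comb_const_gt0 : 0 < comb_const. Proof. by rewrite mulr_gt0// exprn_gt0. Qed.

Lemma dkk_combE (D : seq nat) (a : nat -> K) :
  \sum_(j <- D) a j *: dkk_vec j = J1 (\sum_(j <- D) a j *: (e j - avg j)) +
    J2 (\sum_(j <- D) a j *: (emb (weight (blk j)) *: y (blk j))).
Proof.
rewrite (lin_sumZ (proj1 bJ1)) (lin_sumZ (proj1 bJ2)) -big_split.
by apply: eq_bigr => j _; rewrite /dkk_vec scalerDr.
Qed.

Lemma dkk_comb_le (D : seq nat) (a : nat -> K) : uniq D ->
  ⟦\sum_(j <- D) a j *: dkk_vec j⟧ <=
  comb_const * (⟦\sum_(j <- D) a j *: e j⟧ + \sum_(j <- D) mag (a j) * weight (blk j)).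
Proof.
move=> uD.
rewrite dkk_combE; apply: le_trans (ler_nrmD _ _ _) _; rewrite mulrDr; apply: lerD.
  have h : ⟦\sum_(j <- D) a j *: (e j - avg j)⟧ <= 3 * ⟦\sum_(j <- D) a j *: e j⟧.
    under eq_bigr do rewrite scalerBr.
    rewrite sumrB; have := ler_nrmB hK (\sum_(j <- D) a j *: e j) (\sum_(j <- D) a j *: avg j).
    by have := block_avg_seq a uD; lra.
  apply: le_trans (J1_le _) _; apply: le_trans (ler_wpM2l (ltW C0) h) _.
  have := ler_wpM2r (nrm_ge0 hK (\sum_(j <- D) a j *: e j)) C_le_sq.
  by rewrite /comb_const; lra.
apply: le_trans (J2_le _) _.
have h : ⟦\sum_(j <- D) a j *: (emb (weight (blk j)) *: y (blk j))⟧ <=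
    C * \sum_(j <- D) mag (a j) * weight (blk j).
  apply: le_trans (ler_nrm_sum _ _ _ _) _; rewrite mulr_sumr; apply: ler_sum => j _.
  rewrite !nrmZ mag_emb gtr0_norm ?weight_gt0// mulrA mulrC ler_wpM2r//.
  by rewrite mulr_ge0 ?mag_ge0// ltW// weight_gt0.
apply: le_trans (ler_wpM2l (ltW C0) h) _; rewrite mulrA -expr2 ler_wpM2r//.
  by rewrite sumr_ge0// => j _; rewrite mulr_ge0 ?mag_ge0// ltW// weight_gt0.
by rewrite /comb_const; have := sqr_ge0 C; lra.
Qed.

(** The weighted sum in [dkk_comb_le] is absorbed by averaging over the block. *)
Lemma dkk_comb_block (D : seq nat) (a : nat -> K) n : uniq D ->
  {in D, forall j, blk j = n} ->
  ⟦\sum_(j <- D) a j *: dkk_vec j⟧ <= 5 * comb_const * ⟦\sum_(j <- D) a j *: e j⟧.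
Proof.
move=> uD hD; apply: le_trans (dkk_comb_le a uD) _.
have -> : \sum_(j <- D) mag (a j) * weight (blk j) = (\sum_(j <- D) mag (a j)) * weight n.
  by rewrite mulr_suml; apply: eq_big_seq => j /hD ->.
have Dn : (size D <= blen n)%N.
  rewrite -(size_block blen n); apply: uniq_leq_size => // j /hD jn.
  by rewrite (mem_block lenP) jn.
have h := sum_mag_le hS a uD Dn (lenP n); rewrite -/(weight n) in h.
have := ler_wpM2l (ltW comb_const_gt0) h; lra.
Qed.

(** In blocks of length at most [N] all indices may be counted, which leads to a
    geometric sum; in longer blocks there are at most [N] indices and the weight
    is at most about [lam N / N]. *)
Lemma sum_weight_le (D : seq nat) N : uniq D -> (size D <= N)%N -> (0 < N)%N ->
  \sum_(j <- D) weight (blk j) <= (2 + b%:R) * lam N.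
Proof.
move=> uD DN N0; pose n := trunc_log b N.
have nN : (blen n <= N)%N by rewrite /blen /n trunc_logP.
have Nn : (N < blen n.+1)%N by rewrite /blen /n trunc_log_ltn.
rewrite (bigID (fun j => blk j < n.+1)%N)/= mulrDl; apply: lerD.
  apply: (le_trans (y := \sum_(0 <= j < bstart blen n.+1) weight (blk j))).
    rewrite -big_filter; rewrite [leRHS](bigID (mem [seq j <- D | (blk j < n.+1)%N]))/=.
    rewrite [X in _ <= X + _](_ : _ = \sum_(j <- [seq j <- D | (blk j < n.+1)%N]) weight (blk j)).
      by rewrite lerDl sumr_ge0// => j _; rewrite ltW// weight_gt0.
    rewrite -[LHS]big_filter; apply: perm_big; apply: uniq_perm.
    - by rewrite filter_uniq// iota_uniq.
    - by rewrite filter_uniq.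
    move=> j; rewrite !mem_filter mem_index_iota -(bidx_lt lenP) /=.
    by case: (blk j < n.+1)%N; rewrite ?andbF// andbT.
  rewrite sum_bstart; apply: (le_trans (y := \sum_(0 <= i < n.+1) lam (blen i))).
    apply: ler_sum => i _.
    rewrite (eq_big_seq (fun=> weight i)); last first.
      by move=> j; rewrite (mem_block lenP) => /eqP ->.
    rewrite big_const_seq count_predT size_block iter_addr_0 -mulr_natr /weight divfK//.
    by rewrite gt_eqF// blenR_gt0.
  apply: le_trans (sum_lam_blen n) _.
  by rewrite ler_pM2l// (lam_le hS).
apply: (le_trans (y := \sum_(j <- D | ~~ (blk j < n.+1)%N) weight n)).
  by apply: ler_sum => j; rewrite -leqNgt => jn; apply: weight_le; exact: ltnW.
rewrite big_const_seq iter_addr_0.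
apply: (le_trans (y := (b * blen n)%:R * weight n)).
  rewrite -[leLHS]mulr_natl ler_wpM2r ?(ltW (weight_gt0 _))// ler_nat.
  apply: leq_trans (count_size _ _) (leq_trans DN _).
  by rewrite /blen -expnS ltnW.
have -> : (b * blen n)%:R * weight n = b%:R * lam (blen n).
  by rewrite natrM /weight; field; rewrite gt_eqF// blenR_gt0.
by rewrite ler_wpM2l// (lam_le hS).
Qed.

Let upper_const := comb_const * (4 + b%:R).

Let upper_const_gt0 : 0 < upper_const. Proof. by rewrite mulr_gt0// ltr_wpDr. Qed.

Lemma dkk_upper (D : seq nat) (a : nat -> K) N (t : R) : uniq D -> (size D <= N)%N ->
  0 <= t -> {in D, forall j, mag (a j) <= t} ->
  ⟦\sum_(j <- D) a j *: dkk_vec j⟧ <= upper_const * (t * lam N).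
Proof.
move=> uD DN t0 hD; have [N0|N0] := posnP N.
  move: DN; rewrite N0 leqn0 size_eq0 => /eqP ->.
  by rewrite big_nil nrm0 mulr_ge0 ?(ltW upper_const_gt0)// mulr_ge0// lam_ge0.
apply: le_trans (dkk_comb_le a uD) _.
rewrite /upper_const -mulrA ler_wpM2l ?(ltW comb_const_gt0)//.
have h1 := lam_upper hS uD t0 hD.
have h2 : t * lam (size D) <= t * lam N by rewrite ler_wpM2l// (lam_le hS).
have h3 : \sum_(j <- D) mag (a j) * weight (blk j) <= t * ((2 + b%:R) * lam N).
  apply: le_trans (ler_wpM2l t0 (sum_weight_le uD DN N0)).
  rewrite mulr_sumr !big_seq; apply: ler_sum => j /hD h.
  by rewrite ler_wpM2r// ltW// weight_gt0.
by move: (lerD h1 h3); lra.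
Qed.

Let coef_split j f : mag (dkk_coef j f) <=
  mag (es j (A f)) + C ^+ 2 * ⟦f⟧ / lam (blen (blk j)).
Proof.
apply: le_trans (ler_magD _ _ _) _; rewrite lerD2l magM mag_emb.
rewrite gtr0_norm ?invr_gt0 ?lam_blen_gt0// mulrC ler_wpM2r ?invr_ge0 ?(ltW (lam_blen_gt0 _))//.
apply: le_trans (ys_le _ _) _; rewrite expr2 -mulrA ler_wpM2l//; exact: ltW.
Qed.

Lemma seq_nat_max (D : seq nat) : D != [::] -> exists2 j, j \in D & forall i, i \in D -> (i <= j)%N.
Proof.
elim: D => // i D IH _; have [->|/IH[j jD hj]] := eqVneq D [::].
  by exists i => [|k]; rewrite inE// => /eqP ->.
have [ij|ji] := leqP i j.
  by exists j => [|k]; rewrite inE ?jD ?orbT// => /orP[/eqP->|/hj].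
exists i => [|k]; rewrite inE ?eqxx// => /orP[/eqP->//|/hj kj].
by rewrite (leq_trans kj)// ltnW.
Qed.

Let sum_es_le (D : seq nat) f : uniq D -> ⟦\sum_(j <- D) es j (A f) *: e j⟧ <= C * ⟦f⟧.
Proof. by move=> uD; apply: le_trans (subsym_coef hS _ uD) (A_le f). Qed.

(** Lower democracy: large coefficients come either from the mean-zero part or
    from the averages, and then the last block involved carries enough of them. *)
Lemma dkk_lower (G : seq nat) f (t : R) : uniq G -> 0 <= t ->
  {in G, forall j, t <= mag (dkk_coef j f)} ->
  t * lam (size G) <= 8 * C ^+ 2 * ⟦f⟧.
Proof.
move=> uG t0 hG; pose Q j := t / 2 <= mag (es j (A f)).
have f0 := nrm_ge0 hK f.
have t20 : 0 <= t / 2 by rewrite divr_ge0.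
have c2 := ler_wpM2r f0 C_le_sq.
have -> : size G = (size [seq j <- G | Q j] + size [seq j <- G | ~~ Q j])%N.
  by rewrite !size_filter count_predC.
apply: le_trans (ler_wpM2l t0 (lamD hS _ _)) _; rewrite mulrDr.
have h1 : t / 2 * lam (size [seq j <- G | Q j]) <= 2 * (C * ⟦f⟧).
  have := lam_lower hS (a := fun j => es j (A f)) (filter_uniq Q uG) t20.
  have := sum_es_le f (filter_uniq Q uG).
  move=> h3 h4; apply: le_trans (h4 _) _; last by rewrite ler_pM2l.
  by move=> j; rewrite mem_filter => /andP[].
have h2 : t * lam (size [seq j <- G | ~~ Q j]) <= 4 * (C ^+ 2 * ⟦f⟧).
  have [->|/seq_nat_max[j]] := eqVneq [seq j <- G | ~~ Q j] [::].
    by rewrite /unit_fund big_geq// nrm0 mulr0 mulr_ge0// mulr_ge0// exprn_ge0// ltW.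
  rewrite mem_filter => /andP[/= nQ jG] jmax.
  have sz : (size [seq j <- G | ~~ Q j] <= 2 * blen (blk j))%N.
    apply: leq_trans (bstart_blen_le _); rewrite -(size_iota 0 (bstart _ _)).
    apply: uniq_leq_size => [|i /jmax ij]; first exact: filter_uniq.
    by rewrite mem_iota leq0n add0n/= -(bidx_lt lenP) ltnS (bidx_le lenP).
  have tl : t / 2 * lam (blen (blk j)) <= C ^+ 2 * ⟦f⟧.
    rewrite -ler_pdivlMr ?lam_blen_gt0//.
    by have := hG j jG; have := coef_split j f; move: nQ; rewrite /Q -ltNge; lra.
  have := ler_wpM2l t0 (le_trans (lam_le hS sz) (lamM hS 2 (blen (blk j)))).
  by move=> h; apply: le_trans h _; move: tl; lra.
by move: h1 h2 c2; lra.
Qed.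

(** ** Schauder basis property *)

(** The part in [S] has mean zero on the block, so only the mean coming from [y]
    is subtracted, and it is exactly what has been added. *)
Lemma dkk_block n f : \sum_(j <- block blen n) dkk_coef j f *: dkk_vec j =
  J1 (\sum_(j <- block blen n) es j (A f) *: e j) + J2 (ys n (B f) *: y n).
Proof.
rewrite dkk_combE; set c := emb (lam (blen n))^-1 * ys n (B f).
set V := \sum_(i <- block blen n) e i.
have coefE : {in block blen n, forall j, dkk_coef j f = es j (A f) + c}.
  by move=> j; rewrite (mem_block lenP) /dkk_coef /c => /eqP ->.
have sum_coef : \sum_(j <- block blen n) dkk_coef j f = c * (blen n)%:R.
  rewrite (eq_big_seq _ coefE) big_split/= A_mz add0r.
  by rewrite big_const_seq count_predT size_block iter_addr_0 mulr_natr.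
congr (J1 _ + J2 _).
  under eq_bigr do rewrite scalerBr.
  rewrite sumrB (_ : \sum_(j <- block blen n) dkk_coef j f *: avg j = c *: V); last first.
    rewrite (eq_big_seq (fun j => dkk_coef j f *: (emb (blen n)%:R^-1 *: V))).
      by rewrite -scaler_suml sum_coef scalerA -mulrA [_%:R * _]mulrC emb_natV_mul// mulr1.
    by move=> j; rewrite (mem_block lenP) /block_avg => /eqP ->.
  rewrite (eq_big_seq (fun j => es j (A f) *: e j + c *: e j)); last first.
    by move=> j jn; rewrite coefE// scalerDl.
  by rewrite big_split/= -scaler_sumr -/V addrK.
rewrite (eq_big_seq (fun j => dkk_coef j f *: (emb (weight n) *: y n))); last first.
  by move=> j; rewrite (mem_block lenP) => /eqP ->.
rewrite -scaler_suml sum_coef scalerA; congr (_ *: _).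
have key : emb (lam (blen n))^-1 * (blen n)%:R * emb (weight n) = 1.
  rewrite -(scalar_embn hK) -!scalar_embM (_ : _ * _ * _ = 1) ?scalar_emb1// /weight.
  by field; rewrite !gt_eqF ?blenR_gt0 ?lam_blen_gt0.
have key2 (z : K) : emb (lam (blen n))^-1 * z * (blen n)%:R * emb (weight n) = z.
  by rewrite -[RHS]mulr1 -[X in _ = _ * X]key; ring.
exact: key2.
Qed.

Lemma dkk_prefix k f : \sum_(0 <= j < bstart blen k) dkk_coef j f *: dkk_vec j =
  J1 (\sum_(0 <= j < bstart blen k) es j (A f) *: e j) +
  J2 (\sum_(0 <= n < k) ys n (B f) *: y n).
Proof.
rewrite !sum_bstart (lin_sum (proj1 bJ1)) (lin_sum (proj1 bJ2)) -big_split.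
by apply: eq_bigr => n _; rewrite dkk_block.
Qed.

Let block_part (D : seq nat) n f : uniq D -> {in D, forall j, blk j = n} ->
  ⟦\sum_(j <- D) dkk_coef j f *: dkk_vec j⟧ <=
  5 * comb_const * (⟦\sum_(j <- block blen n) es j (A f) *: e j⟧ + mag (ys n (B f))).
Proof.
move=> uD hD; apply: le_trans (dkk_comb_block _ uD hD) _.
rewrite ler_pM2l ?mulr_gt0//.
apply: (le_trans (y := ⟦\sum_(j <- block blen n) dkk_coef j f *: e j⟧)).
  apply: (subsym_sub hS) => //; first exact: block_uniq.
  by move=> j /hD jn; rewrite (mem_block lenP) jn.
rewrite (eq_big_seq (fun j => es j (A f) *: e j +
    (emb (lam (blen n))^-1 * ys n (B f)) *: e j)); last first.
  by move=> j; rewrite (mem_block lenP) /dkk_coef => /eqP ->; rewrite scalerDl.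
rewrite big_split/= -scaler_sumr; apply: le_trans (ler_nrmD _ _ _) _.
rewrite lerD2l nrmZ magM mag_emb (lam_size hS (block_uniq _ _)) size_block.
rewrite gtr0_norm ?invr_gt0 ?lam_blen_gt0// mulrAC mulVf ?mul1r//.
by rewrite gt_eqF// lam_blen_gt0.
Qed.

Lemma y_coef_le k f : mag (ys k f) <= C * ⟦ys k f *: y k⟧.
Proof.
have h := ys_le k (y k); rewrite (system_dual sy) eqxx mag1 in h.
by rewrite nrmZ mulrCA -[leLHS]mulr1 ler_wpM2l ?mag_ge0.
Qed.

Let block_part_le (D : seq nat) n f : uniq D -> {in D, forall j, blk j = n} ->
  ⟦\sum_(j <- D) dkk_coef j f *: dkk_vec j⟧ <= 10 * comb_const * C ^+ 2 * ⟦f⟧.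
Proof.
move=> uD hD; apply: le_trans (block_part f uD hD) _.
have h1 := sum_es_le f (block_uniq blen n).
have h2 : mag (ys n (B f)) <= C ^+ 2 * ⟦f⟧.
  by apply: le_trans (ys_le _ _) _; rewrite expr2 -mulrA ler_wpM2l// ltW.
have c2 := ler_wpM2r (nrm_ge0 hK f) C_le_sq.
have : 5 * comb_const * (⟦\sum_(j <- block blen n) es j (A f) *: e j⟧ + mag (ys n (B f))) <=
    5 * comb_const * (2 * (C ^+ 2 * ⟦f⟧)).
  by rewrite ler_pM2l ?mulr_gt0//; lra.
by move=> h; apply: le_trans h _; lra.
Qed.

Let tail m f : \sum_(0 <= j < m) dkk_coef j f *: dkk_vec j =
  \sum_(0 <= j < bstart blen (blk m)) dkk_coef j f *: dkk_vec j +
  \sum_(j <- index_iota (bstart blen (blk m)) m) dkk_coef j f *: dkk_vec j.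
Proof. by have /andP[h _] := bidxP lenP m; rewrite (big_cat_nat (leq0n _) h). Qed.

Let tail_blk m j : j \in index_iota (bstart blen (blk m)) m -> blk j = blk m.
Proof.
rewrite mem_index_iota => /andP[h1 h2]; apply: (bidx_eq lenP).
by rewrite h1 (ltn_trans h2)//; have /andP[] := bidxP lenP m.
Qed.

Let basis_const : R := 2 * C ^+ 3 + 10 * comb_const * C ^+ 2.

Let basis_const_gt0 : 0 < basis_const.
Proof. by rewrite addr_gt0// !mulr_gt0// exprn_gt0. Qed.

Let prefix_le k f : ⟦\sum_(0 <= j < bstart blen k) dkk_coef j f *: dkk_vec j⟧ <= 2 * C ^+ 3 * ⟦f⟧.
Proof.
rewrite dkk_prefix; apply: le_trans (ler_nrmD _ _ _) _.
have f0 := nrm_ge0 hK f.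
have h1 := le_trans (J1_le _) (ler_wpM2l (ltW C0) (sum_es_le f (iota_uniq 0 (bstart blen k - 0)))).
have h2 := le_trans (J2_le _) (ler_wpM2l (ltW C0) (le_trans (system_partial sy k (B f)) (ler_wpM2l (ltW C0) (B_le f)))).
apply: le_trans (lerD h1 h2) _.
have : C * (C * ⟦f⟧) <= C * (C * (C * ⟦f⟧)).
  by rewrite !ler_pM2l// ler_peMl.
by rewrite exprS expr2; lra.
Qed.

Lemma dkk_system : schauder_system hK dkk_vec dkk_coef basis_const.
Proof.
split; [exact: dkk_coef_linear|exact: dkk_dual| |].
  move=> m f; rewrite tail mulrDl; apply: le_trans (ler_nrmD _ _ _) _; apply: lerD.
    exact: prefix_le.
  by apply: (@block_part_le _ (blk m)); [exact: iota_uniq|exact: tail_blk].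
move=> f.
have blk_tends (V : normedModType K) (u : nat -> V) l :
    tends u l -> tends (fun m => u (blk m)) l.
  move=> h eps /h[N hN]; exists (bstart blen N) => m Nm; apply: hN.
  by rewrite leqNgt (bidx_lt lenP) -leqNgt.
pose PA k := \sum_(0 <= j < bstart blen k) es j (A f) *: e j.
have tA : tends PA (A f).
  apply: (tends_subseq (phi := bstart blen)) (system_tends sysS (A f)).
  exact: bstart_ge.
have tB := system_tends sy (B f).
rewrite -{2}[f]JAB -[X in tends _ X]addr0.
apply: (tends_ext (N := 0) (fun m _ => esym (tail m f))).
apply: tendsD.
  apply: (blk_tends _ (fun k => \sum_(0 <= j < bstart blen k) dkk_coef j f *: dkk_vec j)).
  apply: (tends_ext (N := 0) (fun k _ => esym (dkk_prefix k f))).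
  by apply: tendsD; [exact: blin_tends bJ1 tA|exact: blin_tends bJ2 tB].
have shift (V : normedModType K) (u : nat -> V) l : tends u l -> tends (fun k => u k.+1 - u k) 0.
  move=> h; rewrite -[X in tends _ X](subrr l); apply: tendsB => //.
  by apply: (tends_subseq (phi := succn)) h => n; exact: leqW.
have zA := blk_tends _ _ _ (shift _ _ _ tA).
have zB := blk_tends _ _ _ (shift _ _ _ tB).
move=> eps e0.
have e1 : 0 < eps / (10 * comb_const * C) by rewrite divr_gt0// !mulr_gt0.
have [N1 h1] := zA _ e1; have [N2 h2] := zB _ e1.
exists (maxn N1 N2) => m; rewrite geq_max => /andP[/h1 {}h1 /h2 {}h2]; rewrite subr0 in h1; rewrite subr0 in h2; rewrite subr0.
apply: le_lt_trans (block_part f (iota_uniq _ _) (@tail_blk m)) _.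
have E1 : PA (blk m).+1 - PA (blk m) = \sum_(j <- block blen (blk m)) es j (A f) *: e j.
  rewrite /PA (big_cat_nat (leq0n (bstart blen (blk m))) (bstart_le _ (leqnSn _)))/=.
  by rewrite [LHS]addrC addKr.
have E2 : \sum_(0 <= n < (blk m).+1) ys n (B f) *: y n - \sum_(0 <= n < blk m) ys n (B f) *: y n
    = ys (blk m) (B f) *: y (blk m).
  by rewrite big_nat_recr//= [LHS]addrC addKr.
rewrite E1 in h1; rewrite E2 in h2.
have h3 := y_coef_le (blk m) (B f).
rewrite ltr_pdivlMr ?mulr_gt0// in h1; rewrite ltr_pdivlMr ?mulr_gt0// in h2.
set s := nrm _ _ in h1 *; set t := nrm _ _ in h2 h3; set z := mag _ in h3 *.
have s0 : 0 <= s := nrm_ge0 _ _.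
have h4 : 5 * comb_const * z <= 5 * comb_const * (C * t) by rewrite ler_pM2l ?mulr_gt0.
have h5 : 5 * comb_const * s <= 5 * comb_const * (C * s) by rewrite ler_pM2l ?mulr_gt0// ler_peMl.
by lra.
Qed.

Lemma dkk_le j : ⟦dkk_vec j⟧ <= 5 * comb_const * lam 1.
Proof.
have := @dkk_comb_block [:: j] (fun=> 1) (blk j) isT.
rewrite !big_seq1 !scale1r; have := lam_size hS (D := [:: j]) isT.
by rewrite big_seq1 => ->; apply => i; rewrite inE => /eqP ->.
Qed.

Lemma dkk_ge j : lam 1 / (8 * C ^+ 2) <= ⟦dkk_vec j⟧.
Proof.
rewrite ler_pdivrMr ?mulr_gt0 ?exprn_gt0// mulrC.
have := @dkk_lower [:: j] (dkk_vec j) 1 isT ler01; rewrite mul1r; apply.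
by move=> i; rewrite inE => /eqP ->; rewrite dkk_dual eqxx mag1.
Qed.

(** ** Greedy sums *)

Let greedy_const : R := 12 * comb_const * C + basis_const + 16 * upper_const * C ^+ 2.

(** In the long blocks the averages are negligible and the mean-zero part
    dominates; in the short blocks the full sum is bounded and the coefficients
    left out are small. *)
Lemma dkk_quasi_greedy (F : seq nat) f (t : R) : uniq F -> 0 < t ->
  {in F, forall j, t <= mag (dkk_coef j f)} ->
  (forall j, j \notin F -> mag (dkk_coef j f) <= t) ->
  ⟦\sum_(j <- F) dkk_coef j f *: dkk_vec j⟧ <= greedy_const * ⟦f⟧.
Proof.
move=> uF t0 hF hnF; have f0 := nrm_ge0 hK f.
have ex : exists n, 8 * C ^+ 2 * ⟦f⟧ < t * lam (blen n).
  have [n hn] := lam_blen_unbounded (8 * C ^+ 2 * ⟦f⟧ / t).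
  by exists n; rewrite [ltRHS]mulrC -ltr_pdivrMr.
(* The first block on which the averages are smaller than [t / 8]. *)
pose n0 := ex_minn ex.
have [hn0 n0min] : 8 * C ^+ 2 * ⟦f⟧ < t * lam (blen n0) /\
    forall n, (n < n0)%N -> t * lam (blen n) <= 8 * C ^+ 2 * ⟦f⟧.
  rewrite /n0; case: ex_minnP => m hm min; split=> // n nm; rewrite leNgt.
  by apply/negP => /min; rewrite leqNgt nm.
have c2 := ler_wpM2r f0 C_le_sq.
pose FL := [seq j <- F | (n0 <= blk j)%N].
have uFL : uniq FL by rewrite filter_uniq.
have qFL : {in FL, forall j, t / 2 <= mag (es j (A f)) /\
    mag (dkk_coef j f) <= 2 * mag (es j (A f))}.
  move=> j; rewrite mem_filter => /andP[nj jF].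
  have h1 := hF j jF; have h2 := coef_split j f.
  have h3 : C ^+ 2 * ⟦f⟧ / lam (blen (blk j)) <= t / 8.
    rewrite ler_pdivrMr ?lam_blen_gt0//.
    have h4 : lam (blen n0) <= lam (blen (blk j)).
      by apply: (lam_le hS); rewrite /blen leq_pexp2l ?(ltnW b2).
    by have := ler_wpM2l (ltW t0) h4; lra.
  by split; lra.
have sFL := sum_es_le f uFL.
have szFL : (size FL < blen n0)%N.
  apply: (lam_inv hS); rewrite -(ltr_pM2l t0); apply: le_lt_trans hn0.
  have t20 : 0 <= t / 2 by rewrite divr_ge0// ltW.
  have := lam_lower hS (a := fun j => es j (A f)) uFL t20 (fun j jF => proj1 (qFL j jF)).
  by have := mulr_ge0 (ltW C0) f0; lra.
have hFL : ⟦\sum_(j <- FL) dkk_coef j f *: dkk_vec j⟧ <= 12 * comb_const * C * ⟦f⟧.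
  have h1 : ⟦\sum_(j <- FL) dkk_coef j f *: e j⟧ <= 4 * (C * ⟦f⟧).
    have := @subsym_lattice _ _ _ _ _ _ hS FL (fun j => dkk_coef j f) (fun j => emb 2 * es j (A f)) uFL.
    have -> : \sum_(j <- FL) (emb 2 * es j (A f)) *: e j = emb 2 *: \sum_(j <- FL) es j (A f) *: e j.
      by rewrite scaler_sumr; apply: eq_bigr => j _; rewrite scalerA.
    rewrite nrmZ mag_emb ger0_norm// => h; apply: le_trans (h _) _; last by lra.
    by move=> j /qFL[_]; rewrite magM mag_emb ger0_norm.
  have h2 : \sum_(j <- FL) mag (dkk_coef j f) * weight (blk j) <= 8 * (C * ⟦f⟧).
    apply: (le_trans (y := 2 * ((\sum_(j <- FL) mag (es j (A f))) * weight n0))).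
      rewrite mulr_suml mulr_sumr !big_seq; apply: ler_sum => j jF.
      rewrite mulrA; apply: ler_pM; rewrite ?mag_ge0 ?(ltW (weight_gt0 _))//.
        by have [] := qFL j jF.
      by apply: weight_le; move: jF; rewrite mem_filter => /andP[].
    have := sum_mag_le hS (fun j => es j (A f)) uFL (ltnW szFL) (lenP n0).
    by rewrite -/(weight n0); lra.
  apply: le_trans (dkk_comb_le _ uFL) _.
  by have := ler_wpM2l (ltW comb_const_gt0) (lerD h1 h2); lra.
(* The small coefficients of the short blocks. *)
pose E := [seq j <- iota 0 (bstart blen n0) | j \notin F].
have uE : uniq E by rewrite filter_uniq// iota_uniq.
have hE : ⟦\sum_(j <- E) dkk_coef j f *: dkk_vec j⟧ <= 16 * upper_const * C ^+ 2 * ⟦f⟧.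
  have [n00|] := posnP n0.
    rewrite /E n00 bstart0 big_nil nrm0; apply: mulr_ge0 => //.
    by apply: mulr_ge0; [apply: mulr_ge0 => //; exact: ltW|exact: sqr_ge0].
  case n0E : n0 => [//|k] _.
  have szE : (size E <= 2 * blen k)%N.
    rewrite /E n0E; apply: leq_trans (bstart_blen_le k).
    by rewrite -[leqRHS](size_iota 0) size_filter count_size.
  have h := dkk_upper uE szE (ltW t0) (a := fun j => dkk_coef j f).
  apply: le_trans (h _) _; first by move=> j; rewrite mem_filter => /andP[/hnF].
  have h1 := lamM hS 2 (blen k); have h2 := n0min k; rewrite n0E leqnn in h2.
  have h3 := ler_wpM2l (ltW t0) h1.
  have h4 : t * lam (2 * blen k) <= 16 * (C ^+ 2 * ⟦f⟧) by have := h2 isT; lra.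
  by have := ler_wpM2l (ltW upper_const_gt0) h4; lra.
have -> : \sum_(j <- F) dkk_coef j f *: dkk_vec j =
    \sum_(j <- FL) dkk_coef j f *: dkk_vec j +
    (\sum_(0 <= j < bstart blen n0) dkk_coef j f *: dkk_vec j - \sum_(j <- E) dkk_coef j f *: dkk_vec j).
  rewrite (bigID (fun j => n0 <= blk j)%N)/= big_filter; congr (_ + _).
  rewrite [X in _ = X - _](bigID (mem F))/= /E big_filter /index_iota subn0 addrK.
  rewrite -[LHS]big_filter -[RHS]big_filter; apply: perm_big; apply: uniq_perm.
  - by rewrite filter_uniq.
  - by rewrite filter_uniq// iota_uniq.
  by move=> j; rewrite !mem_filter mem_iota add0n -(bidx_lt lenP) -ltnNge andbC.
have hp := system_partial dkk_system (bstart blen n0) f.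
have h5 := ler_nrmD hK (\sum_(j <- FL) dkk_coef j f *: dkk_vec j)
  (\sum_(0 <= j < bstart blen n0) dkk_coef j f *: dkk_vec j - \sum_(j <- E) dkk_coef j f *: dkk_vec j).
have h6 := ler_nrmB hK (\sum_(0 <= j < bstart blen n0) dkk_coef j f *: dkk_vec j)
  (\sum_(j <- E) dkk_coef j f *: dkk_vec j).
apply: le_trans h5 _; apply: le_trans (lerD hFL (le_trans h6 (lerD hp hE))) _.
by rewrite /greedy_const addrA -!mulrDl.
Qed.

(** ** Almost greediness *)

Lemma finite_uniq_seq (F : set nat) : finite_set F ->
  exists2 s : seq nat, uniq s & F = [set` s].
Proof.
move=> /finite_seqP[s ->]; exists (undup s); first exact: undup_uniq.
by apply/seteqP; split=> j /=; rewrite mem_undup.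
Qed.

Lemma card_le_size (s t : seq nat) : uniq s ->
  ([set` s] #<= [set` t])%card -> (size s <= size t)%N.
Proof.
move=> us /pcard_leP[f]; rewrite -(size_map f s); apply: uniq_leq_size.
  by rewrite map_inj_in_uniq// => i j si sj; apply: inj; rewrite inE.
by move=> _ /mapP[i si ->]; exact: (@funS _ _ _ _ f i).
Qed.

Lemma dkk_coefE f : coord dkk_vec f = dkk_coef ^~ f.
Proof. by apply/funext => j; rewrite (coordE dkk_system). Qed.

Lemma dkk_projE (s : seq nat) f : uniq s ->
  coord_proj dkk_vec [set` s] f = \sum_(j <- s) dkk_coef j f *: dkk_vec j.
Proof. by move=> us; rewrite (coord_proj_finite dkk_system). Qed.

Let lower_const : R := 8 * C ^+ 2.

(** Comparing with [g = f - S_E f], the sum of [f] over [E] without [F] is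
    estimated from above by [t * lam k] and that of [g] over [F] without [E] from
    below by the same number, [t] being the least coefficient on [F]. *)
Lemma dkk_almost_greedy : almost_greedy hK dkk_vec.
Proof.
exists (1 + greedy_const + upper_const * lower_const) => f E F finF EF hF.
have finE := card_le_finite EF finF.
have [sF uF FE] := finite_uniq_seq finF; have [sE uE EE] := finite_uniq_seq finE.
move: hF EF; rewrite FE EE => hF /(card_le_size uE) szEF.
rewrite !dkk_projE//; rewrite dkk_coefE in hF.
have {}hF j k : j \notin sF -> k \in sF -> mag (dkk_coef j f) <= mag (dkk_coef k f).
  by move=> jF kF; rewrite mag_le hF//; exact/negP.
have greedy_const_ge0 : 0 <= greedy_const.
  have a1 : 0 <= 12 * comb_const * C.
    by apply: mulr_ge0; [apply: mulr_ge0 => //; exact: ltW|exact: ltW].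
  have a2 : 0 <= 16 * upper_const * C ^+ 2.
    by apply: mulr_ge0; [apply: mulr_ge0 => //; exact: ltW|exact: sqr_ge0].
  exact: addr_ge0 (addr_ge0 a1 (ltW basis_const_gt0)) a2.
have lower_const_ge0 : 0 <= lower_const by apply: mulr_ge0 => //; exact: sqr_ge0.
set g := f - \sum_(j <- sE) dkk_coef j f *: dkk_vec j.
have g0 := nrm_ge0 hK g.
have total_const_ge1 : 1 <= 1 + greedy_const + upper_const * lower_const.
  by rewrite -addrA lerDl addr_ge0// mulr_ge0// ltW.
have prod_const_ge0 : 0 <= upper_const * lower_const by apply: mulr_ge0 => //; exact: ltW.
have gcoef j : dkk_coef j g = if j \in sE then 0 else dkk_coef j f.
  rewrite /g (linB (dkk_coef_linear j)) (system_comb dkk_system)//.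
  by case: ifP => _; rewrite ?subrr ?subr0.
have [sF0|] := eqVneq sF [::].
  have sE0 : sE = [::].
    by apply/eqP; rewrite -size_eq0 -leqn0; move: szEF; rewrite sF0.
  by rewrite /g sF0 sE0 !big_nil -[leLHS]mul1r ler_wpM2r// nrm_ge0.
move=> sF0; have [k0 k0F k0min] : exists2 k, k \in sF &
    forall j, j \in sF -> mag (dkk_coef k f) <= mag (dkk_coef j f).
  elim: (sF) sF0 => // i D IH _; have [->|/IH[k kD hk]] := eqVneq D [::].
    by exists i => [|j]; rewrite inE// => /eqP ->.
  have [ik|ki] := leP (mag (dkk_coef i f)) (mag (dkk_coef k f)).
    exists i => [|j]; rewrite inE ?eqxx// => /orP[/eqP->//|/hk]; exact: le_trans.
  by exists k => [|j]; rewrite inE ?kD ?orbT// => /orP[/eqP->|/hk//]; exact: ltW.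
pose t := mag (dkk_coef k0 f).
have [t0|t0] := leP t 0.
  have fF : f = \sum_(j <- sF) dkk_coef j f *: dkk_vec j.
    have [n hn] := seq_nat_bound sF.
    apply: (tends_unique (system_tends dkk_system f)).
    apply: (tends_ext (N := n)) (tends_cst hK _) => m nm.
    rewrite (sum_seq_nat (n := m)) ?uF//; last by move=> j /hn; move=> h; exact: leq_trans nm.
    apply: eq_bigr => j _; case: ifPn => // jF.
    have : mag (dkk_coef j f) <= 0 by apply: le_trans (hF _ _ jF k0F) t0.
    rewrite le_eqVlt ltNge mag_ge0 orbF mag_eq0 => /eqP ->.
    by rewrite scale0r.
  by rewrite {1}fF subrr nrm0 mulr_ge0// (le_trans ler01).
pose FE' := [seq j <- sF | j \notin sE]; pose EF' := [seq j <- sE | j \notin sF].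
have uFE' : uniq FE' by rewrite filter_uniq.
have uEF' : uniq EF' by rewrite filter_uniq.
have szEF' : (size EF' <= size FE')%N.
  have h1 : (count (mem sF) sE + size EF' = size sE)%N.
    by rewrite /EF' size_filter; exact: count_predC.
  have h2 : (count (mem sE) sF + size FE' = size sF)%N.
    by rewrite /FE' size_filter; exact: count_predC.
  have h3 : count (mem sF) sE = count (mem sE) sF.
    rewrite -!size_filter; apply: perm_size; apply: uniq_perm; rewrite ?filter_uniq//.
    by move=> j; rewrite !mem_filter/= andbC.
  by rewrite -(leq_add2l (count (mem sF) sE)) h1 h3 h2.
have gFE : {in FE', forall j, t <= mag (dkk_coef j g)}.
  move=> j; rewrite mem_filter gcoef => /andP[/negbTE -> jF]; exact: k0min.
have h1 : ⟦\sum_(j <- FE') dkk_coef j g *: dkk_vec j⟧ <= greedy_const * ⟦g⟧.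
  apply: (dkk_quasi_greedy uFE' t0 gFE) => j; rewrite gcoef.
  case: ifPn => jE; first by rewrite mag0 ltW.
  by rewrite mem_filter jE/= => jF; exact: hF.
have h2 : ⟦\sum_(j <- EF') dkk_coef j f *: dkk_vec j⟧ <= upper_const * (lower_const * ⟦g⟧).
  apply: le_trans (dkk_upper uEF' szEF' (ltW t0) _) _.
    by move=> j; rewrite mem_filter => /andP[jF _]; exact: hF.
  by rewrite ler_pM2l ?upper_const_gt0//; exact: (dkk_lower uFE' (ltW t0) gFE).
have -> : f - \sum_(j <- sF) dkk_coef j f *: dkk_vec j =
   g + \sum_(j <- EF') dkk_coef j f *: dkk_vec j - \sum_(j <- FE') dkk_coef j g *: dkk_vec j.
  rewrite (eq_big_seq (r := FE') (fun j => dkk_coef j f *: dkk_vec j)); last first.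
    by move=> j; rewrite mem_filter gcoef => /andP[/negbTE ->].
  rewrite /g !big_filter (bigID (mem sE))/=.
  rewrite (_ : \sum_(j <- sE) dkk_coef j f *: dkk_vec j =
    \sum_(j <- sE | j \in sF) dkk_coef j f *: dkk_vec j +
    \sum_(j <- sE | j \notin sF) dkk_coef j f *: dkk_vec j); last by rewrite (bigID (mem sF)).
  rewrite (_ : \sum_(j <- sF | j \in sE) dkk_coef j f *: dkk_vec j =
    \sum_(j <- sE | j \in sF) dkk_coef j f *: dkk_vec j).
    by rewrite !opprD !addrA subrK.
  rewrite -[LHS]big_filter -[RHS]big_filter; apply: perm_big; apply: uniq_perm.
  - by rewrite filter_uniq.
  - by rewrite filter_uniq.
  by move=> j; rewrite !mem_filter andbC.
apply: le_trans (ler_nrmB _ _ _) _; apply: le_trans (lerD (ler_nrmD _ _ _) (lexx _)) _.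
by have := lerD h1 h2; rewrite !mulrDl mul1r; lra.
Qed.

(** ** The fundamental function *)

Lemma dkk_fundamental : equivalent [set m | (1 <= m)%N]
  (fundamental_function hK dkk_vec) (fun m => (nrm hK (\sum_(j < m) e j))%:E).
Proof.
have lamE m : nrm hK (\sum_(j < m) e j) = lam m by rewrite /unit_fund big_mkord.
have II m : `I_m = [set` iota 0 m].
  by apply/seteqP; split=> j /=; rewrite mem_iota.
split.
  exists upper_const => m _; rewrite lamE -EFinM; apply: ge_ereal_sup => _ [E [Em ->]].
  have [s us Es] := finite_uniq_seq (card_le_finite Em (finite_II m)).
  have sz : (size s <= m)%N.
    by rewrite -(size_iota 0 m); apply: card_le_size => //; rewrite -Es -II.
  rewrite Es -fsbig_seq// lee_fin.
  have sum1 : \sum_(j <- s) 1 *: dkk_vec j = \sum_(j <- s) dkk_vec j.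
    by apply: eq_bigr => j _; rewrite scale1r.
  have := dkk_upper (a := fun=> 1) us sz ler01; rewrite sum1 mul1r; apply => j _.
  by rewrite mag1.
exists lower_const => m _; rewrite lamE.
have h : ((nrm hK (\sum_(j <- iota 0 m) dkk_vec j))%:E <= fundamental_function hK dkk_vec m)%E.
  apply: ereal_sup_ubound; exists `I_m; split; first exact: card_lexx.
  by rewrite II -fsbig_seq// iota_uniq.
have lower_const_ge0 : 0 <= lower_const by apply: mulr_ge0 => //; exact: sqr_ge0.
apply: le_trans (lee_wpmul2l _ h); last by rewrite lee_fin.
rewrite -EFinM lee_fin -[X in lam X](size_iota 0 m) -[leLHS]mul1r.
apply: dkk_lower => //; first exact: iota_uniq.
move=> j jm; have := system_comb dkk_system (fun=> 1) j (iota_uniq 0 m).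
by under eq_bigr do rewrite scale1r; move=> ->; rewrite jm mag1.
Qed.
(** ** Conditionality constants *)

Let log_blocks q m : (1 < m)%N -> (bstart blen q < m)%N ->
  q.+1%:R <= 3 / ln 2 * ln (m%:R : R).
Proof.
move=> m1 qm; have l2 : 0 < ln (2 : R) by apply: ln_gt0; rewrite ltr1n.
have lm : ln (2 : R) <= ln (m%:R : R).
  by rewrite ler_ln ?posrE ?ltr0n// ?ler_nat// ltnW.
rewrite mulrAC ler_pdivlMr//.
case: q qm => [|q] qm; first by rewrite mul1r; lra.
have qm2 : (2 ^ q <= m)%N.
  apply: leq_trans (ltnW qm); rewrite bstartS; apply: leq_trans (leq_addl _ _).
  by rewrite /blen; case: (q) => // q'; rewrite leq_exp2r.
have : ln ((2 ^ q)%:R : R) <= ln m%:R.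
  by rewrite ler_ln ?posrE ?ltr0n ?expn_gt0 ?(ltnW m1)// ler_nat.
rewrite natrX lnXn// -[_ *+ q]mulr_natl -[q.+2]addn2 natrD => h.
by rewrite mulrDl; lra.
Qed.

Let masked_sum (P : pred nat) m k f : (m <= bstart blen k)%N ->
  \sum_(0 <= j < m | P j) dkk_coef j f *: dkk_vec j =
  \sum_(0 <= n < k) \sum_(j <- block blen n | P j && (j < m)%N) dkk_coef j f *: dkk_vec j.
Proof.
move=> mk; pose G j := if P j && (j < m)%N then dkk_coef j f *: dkk_vec j else 0.
transitivity (\sum_(0 <= j < bstart blen k) G j).
  rewrite (big_cat_nat (leq0n m) mk)/= [X in _ = _ + X]big_nat_cond [X in _ = _ + X]big1.
    rewrite addr0 big_mkcond; apply: eq_big_nat => j /andP[_ jm].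
    by rewrite /G jm andbT.
  by move=> j /andP[/andP[mj _] _]; rewrite /G ltnNge mj andbF.
by rewrite sum_bstart; apply: eq_bigr => n _; rewrite [RHS]big_mkcond.
Qed.

(** Inside one block every coordinate projection is bounded, so the constant is at
    most the number of blocks that meet the support. *)
Lemma dkk_L_upper m : (1 < m)%N ->
  (L_const hK dkk_vec m <= (10 * comb_const * C ^+ 2 * (3 / ln 2))%:E * (ln (m%:R : R))%:E)%E.
Proof.
move=> m1; rewrite -EFinM; apply: ge_ereal_sup => _ [f [E [f0 fm ->]]].
have nf : 0 < ⟦f⟧ by rewrite nrm_gt0.
rewrite lee_fin ler_pdivrMr// (coord_proj_supp dkk_system basis_const_gt0 _ fm).
set q := blk m.-1.
have mE : m.-1.+1 = m by rewrite prednK// ltnW.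
have /andP[qm mq] := bidxP lenP m.-1; rewrite -/q in qm mq.
rewrite -[leqLHS]/(m.-1.+1)%N mE in mq.
rewrite (masked_sum (fun j => j \in E) f mq).
apply: le_trans (ler_nrm_sum _ _ _ _) _.
apply: (le_trans (y := \sum_(0 <= n < q.+1) (10 * comb_const * C ^+ 2 * ⟦f⟧))).
  apply: ler_sum => n _; rewrite -big_filter; apply: (@block_part_le _ n).
    by rewrite filter_uniq// block_uniq.
  by move=> j; rewrite mem_filter (mem_block lenP) => /andP[_ /eqP].
rewrite sumr_const_nat subn0 -[leLHS]mulr_natl.
have hq : q.+1%:R <= 3 / ln 2 * ln (m%:R : R) by apply: log_blocks => //; rewrite -mE ltnS.
have c0 : 0 <= 10 * comb_const * C ^+ 2 * ⟦f⟧.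
  apply: mulr_ge0; last exact: ltW.
  by apply: mulr_ge0; [apply: mulr_ge0 => //; exact: ltW|exact: sqr_ge0].
by apply: le_trans (ler_wpM2r c0 hq) _; lra.
Qed.

Lemma dkk_L_ge1 m : (0 < m)%N -> (1 <= L_const hK dkk_vec m)%E.
Proof.
move=> m0; apply: ereal_sup_ubound; exists (dkk_vec 0), setT; split.
- exact: (system_neq0 dkk_system).
- move=> j; rewrite /bsupp/= dkk_coefE dkk_dual.
  by have [<-|_] := eqVneq 0%N j; rewrite ?eqxx.
have -> : coord_proj dkk_vec setT (dkk_vec 0) = dkk_vec 0.
  rewrite /coord_proj; apply: cvg_lim => //; apply/tendsP.
  apply: (tends_ext (N := 0)) (system_tends dkk_system (dkk_vec 0)) => n _.
  by rewrite /series/=; apply: eq_bigr => j _; rewrite in_setT dkk_coefE.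
by rewrite divff// nrm_eq0 (system_neq0 dkk_system).
Qed.

Section Conditional.
Variable delta : R.
Hypothesis delta0 : 0 < delta.
Hypothesis y_sum : forall n, ⟦\sum_(k <- block dyadic n) y k⟧ <= C.
Hypothesis y_even : forall n,
  (2 ^ n)%:R * delta <= ⟦\sum_(k <- block dyadic n | ~~ odd k) y k⟧.

(** The block sum of [y], written in averages, keeps its norm, and the union of the
    blocks with even index acts on it as the projection on the even terms. *)
Lemma dkk_L_lower n m : (bstart blen (bstart dyadic n.+1) <= m)%N ->
  (((2 ^ n)%:R * (delta / C ^+ 3))%:E <= L_const hK dkk_vec m)%E.
Proof.
move=> nm; set z := \sum_(k <- block dyadic n) y k.
have mz0 : mean_zero es blen 0.
  by move=> i; rewrite big1// => j _; rewrite (lin0 (system_linear sysS j)).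
set f := J2 z.
have [Af Bf] : A f = 0 /\ B f = z.
  by have := ABJ z mz0; rewrite (lin0 (proj1 bJ1)) add0r.
have ysz k : ys k z = (k \in block dyadic n)%:R.
  have := system_comb sy (fun=> 1) k (block_uniq dyadic n).
  by under eq_bigr do rewrite scale1r; move=> ->; case: ifP.
have fcoef j : dkk_coef j f = emb (lam (blen (blk j)))^-1 * (blk j \in block dyadic n)%:R.
  by rewrite /dkk_coef Af Bf (lin0 (system_linear sysS j)) add0r ysz.
have blocks_lt k : k \in block dyadic n -> (k < bstart dyadic n.+1)%N.
  by rewrite mem_index_iota => /andP[].
have fsupp M : (bstart blen (bstart dyadic n.+1) <= M)%N -> bsupp dkk_vec f `<=` `I_M.
  move=> nM j; rewrite /bsupp/= dkk_coefE fcoef.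
  case: (boolP (blk j \in block dyadic n)) => [/blocks_lt|_]; last by rewrite mulr0 eqxx.
  by rewrite (bidx_lt lenP) => h _; exact: leq_trans nM.
have z0 : z != 0.
  apply/eqP => z0; have := ysz (bstart dyadic n).
  rewrite z0 (lin0 (system_linear sy _)) mem_index_iota leqnn bstartS.
  rewrite -[X in (X < _)%N]addn0 ltn_add2l dyadic_gt0 => /esym/eqP.
  by rewrite oner_eq0.
have f0 : f != 0.
  by apply: contra z0 => /eqP f0; rewrite -Bf f0 (lin0 (proj1 bB)).
pose E := [set j | ~~ odd (blk j)].
have projE : coord_proj dkk_vec E f = J2 (\sum_(k <- block dyadic n | ~~ odd k) y k).
  rewrite (coord_proj_supp dkk_system basis_const_gt0 _ (fsupp _ (leqnn _))).
  rewrite (masked_sum (fun j => j \in E) f (leqnn _)).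
  rewrite -[X in J2 X]big_filter [X in J2 X](sum_seq_nat (n := bstart dyadic n.+1)); first last.
  - by move=> k; rewrite mem_filter => /andP[_ /blocks_lt].
  - by rewrite filter_uniq// block_uniq.
  rewrite (lin_sum (proj1 bJ2)); apply: eq_big_nat => i /andP[_ iN].
  rewrite mem_filter.
  have inblkE i' : i' \in block blen i -> (i' \in E) && (i' < bstart blen (bstart dyadic n.+1))%N
      = ~~ odd i.
    rewrite (mem_block lenP) => /eqP bi; rewrite -(bidx_lt lenP) bi iN andbT.
    by apply/idP/idP; rewrite in_setE /E /= bi.
  have [oi|oi] := boolP (odd i).
    rewrite /= (lin0 (proj1 bJ2)) big_seq_cond big1// => j /andP[jb].
    by rewrite inblkE// oi.
  rewrite big_seq_cond (eq_bigl (fun j => j \in block blen i)); last first.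
    by move=> j; case: (boolP (j \in _)) => //= jb; rewrite inblkE.
  rewrite -big_seq dkk_block Af Bf ysz.
  rewrite big1 ?(lin0 (proj1 bJ1)) ?add0r; last first.
    by move=> j _; rewrite (lin0 (system_linear sysS j)) scale0r.
  by case: (i \in _); rewrite ?scale1r ?scale0r.
apply: (@le_trans _ _ (⟦coord_proj dkk_vec E f⟧ / ⟦f⟧)%:E); last first.
  by apply: ereal_sup_ubound; exists f, E; split=> //; exact: fsupp.
have nf : 0 < ⟦f⟧ by rewrite nrm_gt0.
rewrite lee_fin ler_pdivlMr// projE.
have h1 : ⟦f⟧ <= C ^+ 2.
  apply: le_trans (J2_le _) _; rewrite expr2 ler_pM2l//; exact: y_sum.
have h2 : (2 ^ n)%:R * delta <= C * ⟦J2 (\sum_(k <- block dyadic n | ~~ odd k) y k)⟧.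
  apply: le_trans (y_even n) _; set u := \sum_(k <- _ | _) _.
  have [_ Bu] := ABJ u mz0; rewrite (lin0 (proj1 bJ1)) add0r in Bu.
  by rewrite -{1}Bu; exact: B_le.
rewrite -(ler_pM2l C0); apply: le_trans h2.
have d0 : 0 <= (2 ^ n)%:R * (delta / C ^+ 3) by rewrite mulr_ge0// divr_ge0 ?exprn_ge0// ltW.
have := ler_wpM2l d0 h1 => h3.
apply: le_trans (ler_wpM2l (ltW C0) h3) _.
by apply: le_of_eq; field; rewrite gt_eqF.
Qed.

Lemma dkk_L : equivalent [set m | (2 <= m)%N] (L_const hK dkk_vec)
  (fun m => (ln (m%:R : R))%:E).
Proof.
split.
  by exists (10 * comb_const * C ^+ 2 * (3 / ln 2)) => m m2; exact: dkk_L_upper.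
have bR : 1 < (b%:R : R) by rewrite ltr1n.
have lb : 0 < ln (b%:R : R) by exact: ln_gt0.
have dC : 0 < delta / C ^+ 3 by rewrite divr_gt0// exprn_gt0.
pose C8 := 8 * ln (b%:R : R) / (delta / C ^+ 3).
pose C2 := 2 * ln (b%:R : R).
have C80 : 0 <= C8 by apply: divr_ge0; [apply: mulr_ge0 => //|]; exact: ltW.
have C20 : 0 <= C2 by apply: mulr_ge0 => //; exact: ltW.
exists (C8 + C2) => m /= m2.
have bstart_pow k : (bstart blen k <= b ^ k)%N.
  elim: k => [|k IH]; first by rewrite bstart0.
  rewrite bstartS expnS; apply: leq_trans (leq_add IH (leqnn _)) _.
  by rewrite addnn -mul2n leq_mul2r b2 orbT.
have ln_lt k : (m < bstart blen k)%N -> ln (m%:R : R) <= k%:R * ln b%:R.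
  move=> mk; rewrite mulr_natl -lnXn ?(lt_trans ltr01)// -natrX.
  rewrite ler_ln ?posrE ?ltr0n ?expn_gt0 ?(ltnW m2) ?(ltnW b2)// ler_nat.
  exact: leq_trans (ltnW mk) (bstart_pow k).
have L1 := dkk_L_ge1 (ltnW m2).
suff [r [r0 rL hr]] : exists r : R, [/\ 0 <= r, (r%:E <= L_const hK dkk_vec m)%E &
    ln (m%:R : R) <= (C8 + C2) * r].
  apply: (@le_trans _ _ ((C8 + C2)%:E * r%:E)%E); first by rewrite -EFinM lee_fin.
  by apply: lee_wpmul2l => //; rewrite lee_fin addr_ge0.
have [m_small|m_large] := ltnP m (bstart blen (bstart dyadic 1)).
  exists 1; split=> //; rewrite mulr1; apply: le_trans (ln_lt _ m_small) _.
  by rewrite bstartS bstart0 /dyadic /= /C2 lerDr.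
(* The largest dyadic block of [y] whose averages fit in the first [m] indices. *)
pose g n := (bstart blen (bstart dyadic n.+1) <= m)%N.
have gm n : g n -> (n <= m)%N.
  move=> gn; apply: leq_trans gn; apply: leq_trans (bstart_ge lenP _).
  exact: leq_trans (leqnSn n) (bstart_ge dyadic_gt0 _).
have ex : exists n, g n by exists 0.
have [n gn nmax] := ex_maxnP ex gm.
exists ((2 ^ n)%:R * (delta / C ^+ 3)); split.
- by rewrite mulr_ge0// ltW.
- exact: dkk_L_lower.
have mn : (m < bstart blen (bstart dyadic n.+2))%N.
  by rewrite ltnNge; apply/negP => /nmax; rewrite ltnn.
apply: le_trans (ln_lt _ mn) _.
have dy k : (bstart dyadic k <= (2 ^ k).*2)%N.
  elim: k => [|k IH]; first by rewrite bstart0.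
  rewrite bstartS expnS mul2n; apply: leq_trans (leq_add IH (leqnn _)) _.
  by rewrite /dyadic addnn.
have h : (bstart dyadic n.+2)%:R <= 8 * (2 ^ n)%:R :> R.
  rewrite -natrM ler_nat; apply: leq_trans (dy _) _.
  by rewrite !expnS -!mul2n !mulnA.
apply: le_trans (ler_wpM2r (ltW lb) h) _.
have e8 : C8 * ((2 ^ n)%:R * (delta / C ^+ 3)) = 8 * (2 ^ n)%:R * ln b%:R.
  by rewrite /C8; field; rewrite !gt_eqF.
rewrite [leRHS]mulrDl e8 lerDl; apply: mulr_ge0 => //.
by apply: mulr_ge0 => //; exact: ltW.
Qed.

End Conditional.
End Construction.

(** * Retractions onto complemented subspaces *)

Section Complemented.
Variables (R : realType) (K : numFieldType) (hK : scalar_field R K).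
Local Notation "⟦ v ⟧" := (nrm hK v) (at level 0, v at level 99).

Lemma blin_continuous (V W : normedModType K) (f : {linear V -> W}) :
  continuous f -> bounded_linear hK f.
Proof.
move=> /linear_bounded_continuous/linear_boundedP/pinfty_ex_gt0[M M0 hM].
split; first by move=> a u v; rewrite linearP.
have ME : M = scalar_emb hK (scalar_re hK M) by rewrite scalar_emb_re// ltW.
exists (scalar_re hK M); first by rewrite -(ltr_scalar_emb hK) scalar_emb0 -ME.
by move=> v; rewrite -(ler_scalar_emb hK) scalar_embM -ME !emb_nrm.
Qed.

Lemma complemented_retraction (S X : normedModType K) :
  isomorphic_to_complemented_subspace hK S X ->
  exists (T : S -> X) (Q : X -> S), [/\ bounded_linear hK T, bounded_linear hK Q & forall s, Q (T s) = s].
Proof.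
move=> [Y [[P [cP PP rP]] [T [rT [c [C [c0 hcC]]]]]]].
have [lP [D D0 hD]] := blin_continuous cP.
have Tinj : injective T.
  move=> s s' E; apply/eqP; rewrite -subr_eq0 -(nrm_eq0 hK).
  have /andP[+ _] := hcC (s - s'); rewrite linearB E subrr nrm0 => h.
  by rewrite eq_le nrm_ge0 andbT -(ler_pM2l c0) mulr0.
have /choice[Q hQ] : forall f, exists s, T s = P f.
  move=> f; have : range P (P f) by exists f.
  by rewrite rP -rT => -[s _ <-]; exists s.
exists T, Q; split.
- split; first by move=> a u v; rewrite linearP.
  exists (`|C| + 1) => [|s]; first by rewrite ltr_wpDl.
  have /andP[_ h] := hcC s; apply: le_trans h _; rewrite ler_wpM2r ?nrm_ge0//.
  by rewrite (le_trans (ler_norm _))// lerDl.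
- split; first by move=> a u v; apply: Tinj; rewrite hQ linearP [RHS]linearP !hQ.
  exists (D / c) => [|f]; first by rewrite divr_gt0.
  have /andP[h _] := hcC (Q f); rewrite mulrAC ler_pdivlMr// mulrC.
  by apply: le_trans h _; rewrite hQ.
- move=> s; apply: Tinj; rewrite hQ.
  have : range T (T s) by exists s.
  by rewrite rT -rP => -[f _ <-]; rewrite PP.
Qed.

Lemma schauder_system_le (X : normedModType K) (x : nat -> X) xs (C C' : R) :
  C <= C' -> schauder_system hK x xs C -> schauder_system hK x xs C'.
Proof.
move=> CC [h1 h2 h3 h4]; split=> // n f; apply: le_trans (h3 n f) _.
by rewrite ler_wpM2r ?nrm_ge0.
Qed.

End Complemented.

Theorem theorem4p11 (R : realType) (K : numFieldType) (hK : scalar_field R K)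
    (X : completeNormedModType K) (x : nat -> X)
    (hx : is_basis hK x) (hP : type_P hK x)
    (S : completeNormedModType K) (coe : S -> nat -> K) (e : nat -> S)
    (hS : subsymmetric_sequence_space hK coe e)
    (hSX : isomorphic_to_complemented_subspace hK S X)
    (htype : nontrivial_type hK S) :
  exists b : nat -> X,
    [/\ is_basis hK b,
        almost_greedy hK b,
        equivalent [set m | (1 <= m)%N]
          (fundamental_function hK b)
          (fun m => (nrm hK (\sum_(j < m) e j))%:E) &
        equivalent [set m | (2 <= m)%N]
          (L_const hK b)
          (fun m => (ln (m%:R : R))%:E)].
Proof.
have [bx [c' [Cn [_ hCn]]]] := hx.
have [[CP0 hCP0] [c c0 hc]] := hP.
pose xs j f := coord x f j.
have [Cx Cx0 sx] : exists2 Cx : R, 0 < Cx & schauder_system hK x xs Cx :=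
  schauder_system_of_basis hK bx.
pose CP : R := `|CP0| + 1.
have CPgt0 : 0 < CP by rewrite ltr_wpDl.
have hCP k : nrm hK (\sum_(0 <= j < k) x j) <= CP.
  rewrite big_mkord; apply: le_trans (hCP0 k) _.
  by rewrite (le_trans (ler_norm _))// lerDl.
have xle j : nrm hK (x j) <= Cn by have /andP[] := hCn j.
have sy := cond_system Cx0 c0 CPgt0 sx hc hCP.
have yle := cond_vec_le Cx0 c0 CPgt0 hCP xle.
have ysle := cond_coef_le Cx0 c0 CPgt0 sx hc.
have ysum := cond_block_sum CPgt0 hCP.
have yeven := cond_block_even Cx0 sx hc.
have sS := subsymmetric_of_space hS.
have [b b2 hb] := lam_doubling sS htype.
have [T [Q [bT bQ QT]]] := complemented_retraction hSX.
have [A [B [J1 [J2 [[bA bB bJ1 bJ2] [A_mz JAB ABJ]]]]]] :=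
  mean_zero_absorbed sS (blen_gt0 b2) bT bQ QT.
have [_ [cA cA0 hA]] := bA; have [_ [cB cB0 hB]] := bB.
have [_ [cJ1 cJ10 hJ1]] := bJ1; have [_ [cJ2 cJ20 hJ2]] := bJ2.
pose bounds : seq R := [:: cA; cB; cJ1; cJ2; Cx + (2 + 8 * CP / c) * (2 * Cx);
  Cn + 2 * CP; 6 * Cx / c; 2 * CP].
pose C := 1 + \sum_(r <- bounds) `|r|.
have leC r : r \in bounds -> r <= C.
  move=> rb; apply: le_trans (ler_norm r) _; rewrite /C (big_rem _ rb)/=.
  rewrite addrCA lerDl addr_ge0// sumr_ge0// => *; exact: normr_ge0.
have C1 : 1 <= C by rewrite lerDl sumr_ge0// => *; exact: normr_ge0.
have leCM (V : normedModType K) (v : V) r t : r \in bounds -> t <= r * nrm hK v -> t <= C * nrm hK v.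
  by move=> /leC rC h; apply: le_trans h _; rewrite ler_wpM2r ?nrm_ge0.
have sy' : schauder_system hK (cond_vec x) (cond_coef xs) C.
  by apply: schauder_system_le sy; apply: leC; rewrite !inE eqxx ?orbT.
have yle' k : nrm hK (cond_vec x k) <= C.
  by apply: le_trans (yle k) _; apply: leC; rewrite !inE eqxx ?orbT.
have ysle' k f : mag hK (cond_coef xs k f) <= C * nrm hK f.
  by apply: leCM (ysle k f); rewrite !inE eqxx ?orbT.
have hA' f : nrm hK (A f) <= C * nrm hK f by apply: leCM (hA f); rewrite !inE eqxx ?orbT.
have hB' f : nrm hK (B f) <= C * nrm hK f by apply: leCM (hB f); rewrite !inE eqxx ?orbT.
have hJ1' q : nrm hK (J1 q) <= C * nrm hK q by apply: leCM (hJ1 q); rewrite !inE eqxx ?orbT.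
have hJ2' z : nrm hK (J2 z) <= C * nrm hK z by apply: leCM (hJ2 z); rewrite !inE eqxx ?orbT.
have ysum' n : nrm hK (\sum_(k <- block dyadic n) cond_vec x k) <= C.
  by apply: le_trans (ysum n) _; apply: leC; rewrite !inE eqxx ?orbT.
have C0 : 0 < C := lt_le_trans ltr01 C1.
exists (dkk_vec hK e b (cond_vec x) J1 J2); split.
- have sdk := dkk_system sS b2 C1 sy' yle' ysle' bA bB bJ1 bJ2 hA' hB' hJ1' hJ2' A_mz JAB ABJ.
  split; first by apply: (schauder_basis_of_system sdk); rewrite addr_gt0 ?mulr_gt0 ?exprn_gt0.
  exists (unit_fund hK e 1 / (8 * C ^+ 2)), (5 * (3 * C ^+ 2) * unit_fund hK e 1); split.
    by rewrite divr_gt0 ?(lam_gt0 sS)// mulr_gt0// exprn_gt0.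
  move=> j; rewrite (dkk_ge sS b2 C1 sy' ysle' hA' hB' ABJ).
  exact: (dkk_le sS b2 C1 yle' bJ1 bJ2 hJ1' hJ2').
- exact: (dkk_almost_greedy sS b2 hb C1 sy' yle' ysle' bA bB bJ1 bJ2 hA' hB' hJ1' hJ2' A_mz JAB ABJ).
- exact: (dkk_fundamental sS b2 hb C1 sy' yle' ysle' bA bB bJ1 bJ2 hA' hB' hJ1' hJ2' A_mz JAB ABJ).
- have delta0 : 0 < c / (2 * Cx) by rewrite divr_gt0// mulr_gt0.
  exact: (dkk_L sS b2 C1 sy' yle' ysle' bA bB bJ1 bJ2 hA' hB' hJ1' hJ2' A_mz JAB ABJ delta0 ysum' yeven).
Qed.
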